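(* The lists given in the context for the types $BCC_l$ $(l\ge1)$, $C^\vee BC_l$ $(l\ge1)$, $BB_l^\vee$ $(l\ge2)$ and $C^\vee C_l$ $(l\ge1)$ form the complete list of isomorphism classes of marked elliptic root systems with non-reduced affine quotient. That is: every marked elliptic root system with non-reduced affine quotient realizes exactly one row of these lists, and for every row of the list for $X_l$ there exists a marked elliptic root system $(R,G)$, unique up to isomorphism of marked elliptic root systems, with $R/G$ of type $X_l$ which realizes that row.
   Context: Root systems. Let $F$ be a finite-dimensional real vector space with a symmetric bilinear form $I$. For $\alpha\in F$ with $I(\alpha,\alpha)\ne0$ put $\alpha^\vee=2\alpha/I(\alpha,\alpha)$ and $r_\alpha(\lambda)=\lambda-I(\alpha^\vee,\lambda)\alpha$. A root system belonging to $(F,I)$ is a subset $R\subset F\setminus\{0\}$ such that: (R1) the subgroup $Q(R)$ generated by $R$ is a full lattice in $F$; (R2) $I(\alpha,\alpha)\neq0$ for $\alpha\in R$; (R3) $r_\alpha(R)=R$ for $\alpha\in R$; (R4) $I(\alpha^\vee,\beta)\in\mathbb Z$ for $\alpha,\beta\in R$; (R5) if $R=R_1\sqcup R_2$ with $R_1\perp R_2$, then $R_1=\emptyset$ or $R_2=\emptyset$. $R$ is reduced if $\alpha,c\alpha\in R$ ($c\in\mathbb R$) implies $c=\pm1$, otherwise non-reduced. $R$ is elliptic if $I$ has signature $(l,2,0)$ ($l\ge1$ positive directions, $2$-dimensional radical, no negative direction), affine if the signature is $(l,1,0)$. A marked elliptic root system (mERS) is a pair $(R,G)$ with $R$ elliptic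 and $G\subset\mathrm{rad}(I)$ a one-dimensional subspace such that $G\cap Q(R)$ has rank $1$. Let $\pi_G:F\to F/G$ be the projection, $\bar\alpha=\pi_G(\alpha)$; the affine quotient $R/G=\pi_G(R)$ is an affine root system for the induced form $I_{F/G}$. Root systems are isomorphic if a linear isomorphism of ambient spaces maps one onto the other; two mERSs are isomorphic if there is a linear isomorphism $\varphi$ with $\varphi(R_1)=R_2$, $\varphi(G_1)=G_2$. Non-reduced affine root systems, in $\bigoplus_{i=1}^l\mathbb R\varepsilon_i\oplus\mathbb Rb$ ($\varepsilon_i$ orthonormal, radical $\mathbb Rb$), with $B_s=\{\pm\varepsilon_i\}$, $B_m=\{\pm\varepsilon_i\pm\varepsilon_j\}_{i<j}$, $B_l=\{\pm2\varepsilon_i\}$: $BCC_l=(B_s\cup B_m\cup B_l)+\mathbb Zb$; $C^\vee BC_l=(B_s+\mathbb Zb)\cup(B_m+2\mathbb Zb)\cup(B_l+4\mathbb Zb)$; $BB_l^\vee=(B_s+\mathbb Zb)\cup(B_m+\mathbb Zb)\cup(B_l+2\mathbb Zb)$; $C^\vee C_l=(B_s+\mathbb Zb)\cup(B_m+2\mathbb Zb)\cup(B_l+2\mathbb Zb)$. Standard simple systems $\beta_0,\dots,\beta_l$: $\beta_i=\varepsilon_i-\varepsilon_{i+1}$ ($1\le i<l$), $\beta_l=\varepsilon_l$, and $\beta_0=b-2\varepsilon_1$ for $BCC_l$, $\beta_0=b-\varepsilon_1$ for $C^\vee BC_l$ and $C^\vee C_l$, $\beta_0=b-\varepsilon_1-\varepsilon_2$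 for $BB_l^\vee$. Paired simple systems. Fix a generator $a$ of $Q(R)\cap G$. For $\alpha\in R$ put $k(\alpha)=\min\{k\in\mathbb Z_{>0}:\alpha+ka\in R\}$ (counting number) and $\alpha^\ast=\alpha+k(\alpha)a$. Let $R^{\mathrm{dc}}=\{\alpha\in R:\frac12\alpha\notin R\}$. For $\alpha\in R$ define $\alpha'\in R$: $\alpha'=\alpha$ if $2\bar\alpha\notin R/G$; otherwise $\alpha'$ is the unique element of $R\cap\pi_G^{-1}(2\bar\alpha)$ with $\alpha'\in2\alpha+\mathbb Z_{\le0}a$ and $(\alpha')^\ast\in2\alpha+\mathbb Z_{>0}a$. A simple system of an affine root system is a basis of the ambient space consisting of roots such that every root is an integral combination of it with all coefficients $\ge0$ or all $\le0$. A paired simple system is a pair $(\Pi^{\mathrm{dc}},\Pi^{\mathrm{mc}})$ where $\Pi^{\mathrm{dc}}=\{\alpha_0,\dots,\alpha_l\}\subset R^{\mathrm{dc}}$ has image a simple system of $R^{\mathrm{dc}}/G$ (equivalently of $R/G$), satisfies: if some $\beta\in\pi_G^{-1}(\bar\alpha_i)\cap R$ has $2\beta\notin R$ then $2\alpha_i\notin R$; and $\Pi^{\mathrm{mc}}=\{\alpha_0',\dots,\alpha_l'\}$. Exponents. For $x,y$ with $\bar x=c\bar y\ne0$ put $(x:y)_G=c$. For $\alpha\in\Pi^{\mathrm{dc}}$ define $k^{\mathrm{nr}}(\alpha)$ by $\alpha=(\alpha:(\alpha')^\ast)_G(\alpha')^\ast-k^{\mathrm{nr}}(\alpha)a$. Let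 $I_R$ be the positive multiple of $I$ such that the values $I_R(\alpha,\alpha)$, $\alpha\in R$, are integers with gcd $2$. Let $n_\alpha$ ($\alpha\in\Pi^{\mathrm{dc}}$) be the positive integers such that $\sum n_\alpha\bar\alpha$ generates $Q(R/G)\cap\mathrm{rad}(I_{F/G})$. The exponent is $m_\alpha=\frac{I_R(\alpha,\alpha)}{2k^{\mathrm{nr}}(\alpha)}n_\alpha$; $m_{\max}=\max_\alpha m_\alpha$. A node $\alpha\in\Pi^{\mathrm{dc}}$ is collapsed if $m_\alpha<m_{\max}$. Elliptic diagram. The node set of $\Gamma(R,G)$ is $\Pi^{\mathrm{dc}}\sqcup\{(\alpha')^\ast:\alpha\in\Pi^{\mathrm{dc}}\text{ not collapsed}\}$. A node $\gamma$ is black (b) if $2\gamma\in R$ or $\frac12\gamma\in R$; gray (g) if $2\gamma,\frac12\gamma\notin R$ but $2\bar\gamma\in R/G$ or $\frac12\bar\gamma\in R/G$; white otherwise. Edges between nodes $\alpha,\beta$ record the integers $I(\alpha,\beta^\vee),I(\beta,\alpha^\vee)$. Realizing a row. $(R,G)$ realizes a row of the list for $X_l$ if, for some (equivalently any) paired simple system and a suitable numbering $\Pi^{\mathrm{dc}}=\{\alpha_0,\dots,\alpha_l\}$, the assignment $\bar\alpha_i\mapsto\beta_i$ ($0\le i\le l$) extends to an isomorphism of root systems from $R/G$ onto $X_l$, the collapsed nodes of $\Pi^{\mathrm{dc}}$ are exactly those indicated, and the colours and counting numbers are those indicated. Nodes for which no colour is given are white. ''$\times$'' means that the node is absent from the diagram.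 For nodes $\alpha_i$ with $2\bar\alpha_i\notin R/G$ one always has $k((\alpha_i')^\ast)=k(\alpha_i)$. The nodes $\alpha_i$ called ''middle'' are never collapsed. List for $BCC_l$ (middle nodes $\alpha_1,\dots,\alpha_{l-1}$). Format: [colour of $\alpha_l$, colour of $(\alpha_l')^\ast$; $k(\alpha_0)$, $k(\alpha_i)$ for middle $i$, $k(\alpha_l)$; $k((\alpha_l')^\ast)$]. No collapsed nodes: 1 [g,g;1,1,1;2], 2 [g,b;2,2,1;4], 3 [b,g;1,1,1;1], 4 [b,b;2,2,1;2]. Only $\alpha_l$ collapsed: 5 [b,×;1,1,1;2]. Only $\alpha_0$ collapsed: 6 [g,g;2,1,1;2], 7 [g,b;4,2,1;4], 8 [b,g;2,1,1;1], 9 [b,b;4,2,1;2]. $\alpha_0$ and $\alpha_l$ collapsed ($l\ge2$): 10 [b,×;2,1,1;2]. List for $C^\vee BC_l$ (middle nodes $\alpha_1,\dots,\alpha_{l-1}$, same format). No collapsed nodes: 1 [g,g;1,2,2;4], 2 [g,b;1,2,1;4], 3 [b,g;1,2,2;2], 4 [b,b;1,2,1;2]. Only $\alpha_l$ collapsed: 5 [b,×;1,2,2;4]. Only $\alpha_0$ collapsed: 6 [g,g;1,1,1;2], 7 [g,b;2,2,1;4], 8 [b,g;1,1,1;1], 9 [b,b;2,2,1;2]. $\alpha_0$ and $\alpha_l$ collapsed ($l\ge2$): 10 [b,×;1,1,1;2]. List for $BB_l^\vee$, $l\ge3$ (middle nodes $\alpha_2,\dots,\alpha_{l-1}$; $\alpha_0,\alpha_1$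 always collapsed). Format: [colour of $\alpha_l$, colour of $(\alpha_l')^\ast$; $k(\alpha_0)=k(\alpha_1)$, $k(\alpha_i)$ for middle $i$, $k(\alpha_l)$; $k((\alpha_l')^\ast)$]. $\alpha_l$ not collapsed: 1 [g,g;1,1,1;2], 2 [g,b;2,2,1;4], 3 [b,g;1,1,1;1], 4 [b,b;2,2,1;2]. $\alpha_l$ collapsed: 5 [b,×;1,1,1;2]. List for $BB_2^\vee$ ($\alpha_2$ never collapsed). Format: [colour of $\alpha_2$, colour of $(\alpha_2')^\ast$; $k(\alpha_0),k(\alpha_1),k(\alpha_2)$; $k((\alpha_2')^\ast)$]. No collapsed nodes: 1 [b,b;1,1,1;2]. Only $\alpha_0$ collapsed: 2 [b,b;2,1,1;2]. $\alpha_0,\alpha_1$ collapsed: 3 [g,g;1,1,1;2], 4 [g,b;2,2,1;4], 5 [b,g;1,1,1;1], 6 [b,b;2,2,1;2]. List for $C^\vee C_l$ (middle nodes $\alpha_1,\dots,\alpha_{l-1}$). Format: [colours of $\alpha_0,(\alpha_0')^\ast$; colours of $\alpha_l,(\alpha_l')^\ast$; $k(\alpha_0),k((\alpha_0')^\ast)$; $k(\alpha_i)$ for middle $i$; $k(\alpha_l),k((\alpha_l')^\ast)$]. No collapsed nodes: 1 [g,g;g,g;1,2;1;1,2], 2 [g,g;g,b;2,4;2;1,4], 3 [g,g;b,g;1,2;1;1,1], 4 [g,g;b,b;2,4;2;1,2], 5 [g,b;g,b;1,4;2;1,4], 6 [g,b;b,g;1,4;2;2,2], 7 [g,b;b,b;1,4;2;1,2],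 8 [b,g;b,g;1,1;1;1,1], 9 [b,g;b,b;2,2;2;1,2], 10 [b,b;b,b;1,2;2;1,2]. Only $\alpha_0$ collapsed: 11 [b,×;g,g;1,2;1;1,2], 12 [b,×;g,b;2,4;2;1,4], 13 [b,×;b,g;1,2;1;1,1], 14 [b,×;b,b;2,4;2;1,2]. $\alpha_0$ and $\alpha_l$ collapsed ($l\ge2$): 15 [b,×;b,×;1,2;1;1,2]. *)

(* Defs.v *)
From HB Require Import structures.
From mathcomp Require Import all_boot all_order all_algebra.
From mathcomp Require Import boolp classical_sets reals.

Set Implicit Arguments.
Unset Strict Implicit.
Unset Printing Implicit Defensive.

Import Order.TTheory GRing.Theory Num.Theory.

Local Open Scope classical_set_scope.
Local Open Scope ring_scope.

Section Lattices.
Variables (K : realType) (V : vectType K).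
Implicit Types (S R : set V) (a : V).

Definition is_subgroup S := S 0 /\ forall x y, S x -> S y -> S (x - y).

Definition zspan R : set V := smallest is_subgroup R.

Definition full_lattice S :=
  exists2 e : seq V, basis_of fullv e & S = zspan [set` e].

Definition zgenerator a S := S = zspan [set a].

(* Used for S = Q(R) `&` G, which is discrete: it has rank 1 iff it is
   infinite cyclic. *)
Definition rank_one S := exists2 a, a != 0 & zgenerator a S.

Definition radical (f : V -> V -> K) : set V := [set x | forall y, f x y = 0].

End Lattices.

Section RootSystems.
Variables (K : realType) (F : vectType K).
Implicit Types (I : {symmetric F}) (R : set F) (G : {vspace F}) (x y : F).

(* p positive, z null and n negative directions, in this order. *)
Definition has_signature I (p z n : nat) :=
  exists e : seq F,
    [/\ basis_of fullv e, pairwise (fun x y => I x y == 0) e,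
        count (fun x => 0 < I x x) e = p,
        count (fun x => I x x == 0) e = z
      & count (fun x => I x x < 0) e = n].

Definition coroot I x : F := (2 / I x x) *: x.

Definition reflection I x y : F := y - I (coroot I x) y *: x.

Record root_system I R : Prop := RootSystem {
  rs_nonzero : ~ R 0;
  rs_lattice : full_lattice (zspan R);
  rs_anisotropic : forall x, R x -> I x x != 0;
  rs_reflection : forall x, R x -> reflection I x @` R = R;
  rs_integral : forall x y, R x -> R y -> I (coroot I x) y \is a Num.int;
  rs_irreducible : forall R1 R2, R = R1 `|` R2 -> R1 `&` R2 = set0 ->
    (forall x y, R1 x -> R2 y -> I x y = 0) -> R1 = set0 \/ R2 = set0
}.

Definition elliptic I R :=
  root_system I R /\ exists2 l, (1 <= l)%N & has_signature I l 2 0.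

Definition marked_elliptic I R G :=
  [/\ elliptic I R, [set` G] `<=` radical I, \dim G = 1%N
    & rank_one (zspan R `&` [set` G])].

End RootSystems.

Definition reduced (K : realType) (V : vectType K) (R : set V) :=
  forall (x : V) (c : K), R x -> R (c *: x) -> c = 1 \/ c = - 1.

Definition marked_iso (K : realType) (F1 F2 : vectType K)
    (R1 : set F1) (G1 : {vspace F1}) (R2 : set F2) (G2 : {vspace F2}) :=
  exists phi : 'Hom(F1, F2),
    [/\ bijective phi, phi @` R1 = R2 & (phi @: G1)%VS = G2].

Section Quotient.
Variables (K : realType) (F : vectType K).
Implicit Types (I : {symmetric F}) (R : set F) (G : {vspace F}).

(* MathComp has no quotient of a vectType by a subspace. F / G is realized on
   the complement G^C: [proj G] is a surjective linear map with kernel G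
   (see [limg_proj] and [lker_proj]). *)
Definition quo G : vectType K := subvs_of (G^C)%VS.

Definition proj G : 'Hom(F, quo G) :=
  (linfun (vsproj (G^C)%VS) \o daddv_pi (G^C)%VS G)%VF.

(* The form induced on F / G (see [quo_form_proj]). *)
Definition quo_form I G (u v : quo G) : K := I (vsval u) (vsval v).

Definition quo_roots R G : set (quo G) := proj G @` R.

Lemma projE G x : vsval (proj G x) = daddv_pi (G^C)%VS G x.
Proof. by rewrite /proj comp_lfunE lfunE /= vsprojK // memv_pi. Qed.

Lemma capv_complr G : (G^C :&: G)%VS = 0%VS.
Proof. by rewrite capvC capv_compl. Qed.

Lemma proj_sub G x : x - vsval (proj G x) \in G.
Proof.
have /(daddv_pi_add (capv_complr G)) xE : x \in (G^C + G)%VS.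
  by rewrite addvC addv_complf memvf.
by rewrite -{1}xE projE addrAC subrr add0r memv_pi.
Qed.

Lemma lker_proj G : lker (proj G) = G.
Proof.
apply/vspaceP => x; rewrite memv_ker; apply/eqP/idP => [x0|xG].
  by have := proj_sub G x; rewrite x0 (linear0 vsval) subr0.
apply: val_inj; apply/eqP; rewrite (linear0 vsval) -memv0 -(capv_complr G) memv_cap.
by rewrite subvsP -[X in X \in G](subKr x) rpredB ?proj_sub.
Qed.

Lemma limg_proj G : limg (proj G) = fullv.
Proof.
apply/vspaceP => u; rewrite memvf; apply/memv_imgP.
exists (vsval u); rewrite ?memvf //; apply: val_inj => /=.
by rewrite projE daddv_pi_id ?capv_complr ?subvsP.
Qed.

Lemma quo_form_proj I G x y : [set` G] `<=` radical I ->
  quo_form I (proj G x) (proj G y) = I x y.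
Proof.
move=> GI; rewrite /quo_form.
have radE z t : z \in G -> I z t = 0 by move=> /GI; apply.
have radE' z t : z \in G -> I t z = 0.
  by move=> /radE zt; rewrite hermC zt mulr0.
have -> : I x y = I (vsval (proj G x)) y.
  by apply/eqP; rewrite -subr_eq0 -linearBl /= radE ?proj_sub.
by apply/esym/eqP; rewrite -subr_eq0 -linearBr /= radE' ?proj_sub.
Qed.

End Quotient.

Arguments quo_roots {K F} R G _.
Arguments quo_form {K F} I G u v.

Section AffineTypes.
Variables (K : realType) (l : nat).
Local Notation E := 'rV[K]_l.+1.

(* Coordinate 0 is the radical direction b; coordinates 1, ..., l are the
   epsilon_i. *)
Definition unitv (i : nat) : E := \row_(j < l.+1) ((j : nat) == i)%:R.
Local Notation b := (unitv 0).
Local Notation eps := unitv.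

Definition shortB : set E :=
  [set x | exists (i : nat) (s : bool),
     (1 <= i <= l)%N /\ x = (-1) ^+ s *: eps i].
Definition middleB : set E :=
  [set x | exists (i j : nat) (s t : bool),
     [/\ (1 <= i)%N, (i < j <= l)%N
       & x = (-1) ^+ s *: eps i + (-1) ^+ t *: eps j]].
Definition longB : set E :=
  [set x | exists (i : nat) (s : bool),
     (1 <= i <= l)%N /\ x = (-1) ^+ s *: (2 *: eps i)].

(* B + m Z b *)
Definition shiftb (B : set E) (m : int) : set E :=
  [set x | exists (y : E) (n : int), B y /\ x = y + b *~ (m * n)].

Variant affine_type := BCC | CvBC | BBv | CvC.

Definition affine_roots (X : affine_type) : set E :=
  match X with
  | BCC => shiftb (shortB `|` middleB `|` longB) 1
  | CvBC => shiftb shortB 1 `|` shiftb middleB 2 `|` shiftb longB 4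
  | BBv => shiftb shortB 1 `|` shiftb middleB 1 `|` shiftb longB 2
  | CvC => shiftb shortB 1 `|` shiftb middleB 2 `|` shiftb longB 2
  end.

Definition affine_simple (X : affine_type) (i : nat) : E :=
  if i == 0%N then
    match X with
    | BCC => b - 2 *: eps 1
    | CvBC | CvC => b - eps 1
    | BBv => b - eps 1 - eps 2
    end
  else if (i < l)%N then eps i - eps i.+1 else eps l.

End AffineTypes.

(* A family of roots is a simple system if it is a basis of the ambient space
   and every root has integral coordinates in it, all >= 0 or all <= 0. *)
Definition simple_system (K : realType) (V : vectType K) (R : set V)
    (n : nat) (beta : 'I_n -> V) :=
  [/\ basis_of fullv [tuple beta i | i < n], forall i, R (beta i)
    & forall x, R x -> exists c : 'I_n -> nat,
        x = \sum_i beta i *+ c i \/ x = - \sum_i beta i *+ c i].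

Variant color := White | Gray | Black.

(* [xget] picks the element with the stated property; in each use below it is
   unique for a marked elliptic root system, and the default is irrelevant. *)
Section PairedSimpleSystems.
Variables (K : realType) (F : vectType K).
Variables (I : {symmetric F}) (R : set F) (G : {vspace F}).
Variable a : F.
Implicit Types (x y : F).

Definition counting x : nat :=
  xget 0%N [set k | [/\ (0 < k)%N, R (x + a *+ k)
    & forall j, (0 < j)%N -> R (x + a *+ j) -> (k <= j)%N]].

Definition star x : F := x + a *+ counting x.

Definition dc_roots : set F := [set x | R x /\ ~ R (2^-1 *: x)].

(* x' *)
Definition prime_root x : F :=
  if `[< quo_roots R G (2 *: proj G x) >] then
    xget x [set y | [/\ R y, proj G y = 2 *: proj G x,
      exists n : nat, y = 2 *: x - a *+ n
      & exists n : nat, star y = 2 *: x + a *+ n.+1]]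
  else x.

Definition paired_simple_system n (adc amc : 'I_n -> F) :=
  [/\ forall i, dc_roots (adc i),
      simple_system (proj G @` dc_roots) (fun i => proj G (adc i)),
      forall i, (exists y, [/\ R y, proj G y = proj G (adc i)
                             & ~ R (2 *: y)]) -> ~ R (2 *: adc i)
    & forall i, amc i = prime_root (adc i)].

(* (x : y)_G *)
Definition ratio x y : K := xget 0 [set c | proj G x = c *: proj G y].

Definition knr x : K :=
  let y := star (prime_root x) in
  xget 0 [set k | x = ratio x y *: y - k *: a].

Definition is_gcd (S : set int) (g : int) :=
  forall d : int, (d %| g)%Z <-> forall m, S m -> (d %| m)%Z.

(* The factor c such that I_R = c I. *)
Definition form_scale : K :=
  xget 0 [set c | [/\ 0 < c,
    forall x, R x -> c * I x x \is a Num.int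
    & is_gcd [set m | exists2 x, R x & m%:~R = c * I x x] 2]].

Definition marks n (adc : 'I_n -> F) : {ffun 'I_n -> nat} :=
  xget [ffun=> 0%N] [set c | (forall i, (0 < c i)%N) /\
    zgenerator (\sum_i proj G (adc i) *+ c i)
      (zspan (quo_roots R G) `&` radical (quo_form I G))].

Definition exponent n (adc : 'I_n -> F) (i : 'I_n) : K :=
  form_scale * I (adc i) (adc i) / (2 * knr (adc i)) *+ marks adc i.

Definition max_exponent n (adc : 'I_n.+1 -> F) : K :=
  \big[Order.max/exponent adc ord0]_(i < n.+1) exponent adc i.

Definition collapsed n (adc : 'I_n.+1 -> F) (i : 'I_n.+1) :=
  exponent adc i < max_exponent adc.

Definition node_color x : color :=
  if `[< R (2 *: x) \/ R (2^-1 *: x) >] then Black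
  else if `[< quo_roots R G (2 *: proj G x) \/
              quo_roots R G (2^-1 *: proj G x) >] then Gray
  else White.

End PairedSimpleSystems.

(* The entries of a row at alpha_i: the colour of alpha_i, the colour of
   (alpha_i')^* with [None] for a node absent from the diagram, k(alpha_i) and
   k((alpha_i')^* ). *)
Record node_data := Node {
  nd_color : color;
  nd_star_color : option color;
  nd_k : nat;
  nd_star_k : nat
}.

Section Rows.
Local Notation g := Gray.
Local Notation bl := Black.
Local Notation gS := (Some Gray).
Local Notation bS := (Some Black).

(* Nodes for which no colour is given. *)
Definition white (k : nat) := Node White (Some White) k k.
Definition white_collapsed (k : nat) := Node White None k k.

(* A row for X_l is listed in the order alpha_0, ..., alpha_l. *)
Definition row_BC (l : nat) (x0 : node_data) (km : nat) (xl : node_data) :=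
  x0 :: rcons (nseq l.-1 (white km)) xl.

Definition row_B (l : nat) (k0 km : nat) (xl : node_data) :=
  [:: white_collapsed k0, white_collapsed k0
    & rcons (nseq l.-2 (white km)) xl].

Definition rows_BCC (l : nat) : seq (seq node_data) :=
  [:: row_BC l (white 1) 1 (Node g gS 1 2);
      row_BC l (white 2) 2 (Node g bS 1 4);
      row_BC l (white 1) 1 (Node bl gS 1 1);
      row_BC l (white 2) 2 (Node bl bS 1 2);
      row_BC l (white 1) 1 (Node bl None 1 2);
      row_BC l (white_collapsed 2) 1 (Node g gS 1 2);
      row_BC l (white_collapsed 4) 2 (Node g bS 1 4);
      row_BC l (white_collapsed 2) 1 (Node bl gS 1 1);
      row_BC l (white_collapsed 4) 2 (Node bl bS 1 2)]
  ++ (if (2 <= l)%N then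
        [:: row_BC l (white_collapsed 2) 1 (Node bl None 1 2)]
      else [::]).

Definition rows_CvBC (l : nat) : seq (seq node_data) :=
  [:: row_BC l (white 1) 2 (Node g gS 2 4);
      row_BC l (white 1) 2 (Node g bS 1 4);
      row_BC l (white 1) 2 (Node bl gS 2 2);
      row_BC l (white 1) 2 (Node bl bS 1 2);
      row_BC l (white 1) 2 (Node bl None 2 4);
      row_BC l (white_collapsed 1) 1 (Node g gS 1 2);
      row_BC l (white_collapsed 2) 2 (Node g bS 1 4);
      row_BC l (white_collapsed 1) 1 (Node bl gS 1 1);
      row_BC l (white_collapsed 2) 2 (Node bl bS 1 2)]
  ++ (if (2 <= l)%N then
        [:: row_BC l (white_collapsed 1) 1 (Node bl None 1 2)]
      else [::]).

Definition rows_BBv (l : nat) : seq (seq node_data) :=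
  if l == 2%N then
    [:: [:: white 1; white 1; Node bl bS 1 2];
        [:: white_collapsed 2; white 1; Node bl bS 1 2];
        [:: white_collapsed 1; white_collapsed 1; Node g gS 1 2];
        [:: white_collapsed 2; white_collapsed 2; Node g bS 1 4];
        [:: white_collapsed 1; white_collapsed 1; Node bl gS 1 1];
        [:: white_collapsed 2; white_collapsed 2; Node bl bS 1 2]]
  else
    [:: row_B l 1 1 (Node g gS 1 2);
        row_B l 2 2 (Node g bS 1 4);
        row_B l 1 1 (Node bl gS 1 1);
        row_B l 2 2 (Node bl bS 1 2);
        row_B l 1 1 (Node bl None 1 2)].

Definition rows_CvC (l : nat) : seq (seq node_data) :=
  [:: row_BC l (Node g gS 1 2) 1 (Node g gS 1 2);
      row_BC l (Node g gS 2 4) 2 (Node g bS 1 4);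
      row_BC l (Node g gS 1 2) 1 (Node bl gS 1 1);
      row_BC l (Node g gS 2 4) 2 (Node bl bS 1 2);
      row_BC l (Node g bS 1 4) 2 (Node g bS 1 4);
      row_BC l (Node g bS 1 4) 2 (Node bl gS 2 2);
      row_BC l (Node g bS 1 4) 2 (Node bl bS 1 2);
      row_BC l (Node bl gS 1 1) 1 (Node bl gS 1 1);
      row_BC l (Node bl gS 2 2) 2 (Node bl bS 1 2);
      row_BC l (Node bl bS 1 2) 2 (Node bl bS 1 2);
      row_BC l (Node bl None 1 2) 1 (Node g gS 1 2);
      row_BC l (Node bl None 2 4) 2 (Node g bS 1 4);
      row_BC l (Node bl None 1 2) 1 (Node bl gS 1 1);
      row_BC l (Node bl None 2 4) 2 (Node bl bS 1 2)]
  ++ (if (2 <= l)%N then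
        [:: row_BC l (Node bl None 1 2) 1 (Node bl None 1 2)]
      else [::]).

Definition rows (X : affine_type) (l : nat) : seq (seq node_data) :=
  match X with
  | BCC => rows_BCC l
  | CvBC => rows_CvBC l
  | BBv => rows_BBv l
  | CvC => rows_CvC l
  end.

Definition min_rank (X : affine_type) : nat := if X is BBv then 2 else 1.

(* Row number [row_no], counted from 1, of the list for X_l. *)
Record row_label := RowLabel { row_type : affine_type; row_rank : nat; row_no : nat }.

Definition valid_row (t : row_label) : bool :=
  (min_rank (row_type t) <= row_rank t)%N &&
  (1 <= row_no t <= size (rows (row_type t) (row_rank t)))%N.

Definition row_node (t : row_label) (i : nat) : node_data :=
  nth (white 0) (nth [::] (rows (row_type t) (row_rank t)) (row_no t).-1) i.

End Rows.

Section Realization.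
Variables (K : realType) (F : vectType K).
Variables (I : {symmetric F}) (R : set F) (G : {vspace F}).

Definition node_matches (a : F) n (adc amc : 'I_n.+1 -> F) (i : 'I_n.+1)
    (d : node_data) :=
  [/\ node_color R G (adc i) = nd_color d,
      (if nd_star_color d is Some c
       then ~ collapsed I R G a adc i /\
            node_color R G (star R a (amc i)) = c
       else collapsed I R G a adc i),
      counting R a (adc i) = nd_k d
    & counting R a (star R a (amc i)) = nd_star_k d].

Definition realizes (t : row_label) :=
  exists (a : F) (adc amc : 'I_(row_rank t).+1 -> F),
    [/\ zgenerator a (zspan R `&` [set` G]),
        paired_simple_system R G a adc amc,
        exists phi : 'Hom(quo G, 'rV[K]_(row_rank t).+1),
          [/\ bijective phi,
              phi @` quo_roots R G = affine_roots (row_type t)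
            & forall i, phi (proj G (adc i)) = affine_simple K _ (row_type t) i]
      & forall i, node_matches a adc amc i (row_node t i)].

End Realization.

(* Main.v *)
Require Import Defs.
From HB Require Import structures.
From mathcomp Require Import all_boot all_order all_algebra.
From mathcomp Require Import boolp classical_sets reals.
From mathcomp Require Import zify ring lra.

(** The lists are complete because a marked elliptic root system with
non-reduced quotient is a finite combinatorial object.

If x and 2x + g are roots for some g in G, integrality of the Cartan numbers
with both x and 2x + g confines every root, modulo the radical, to BC_l: a
maximal family of orthogonal roots of this kind plays the role of
eps_1, ..., eps_l ([frame_exists]). With a generator a of Q(R) `&` G and a lift
f(b) of b one gets coordinates in which every root is f(y) + m f(b) + n a, with
y in BC_l and m, n integers; such coordinates are a [frame]. The reflections act
transitively on the y of a given length, so the set of pairs (m, n) that occur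
with y depends only on its length, and products of two reflections make this
set periodic modulo 4 ([frame_tabulates]). Hence (R, G) is encoded by a table of
bits indexed by a length and two residues modulo 4, and two systems with the
same rank and table are isomorphic ([frames_iso]).

A frame can be changed by adding multiples of a to b and of b to the eps_i.
This freedom is used to make the standard simple roots of the quotient, lifted
by f, roots that satisfy the third condition of a paired simple system
([adapt]). The table of such an [adapted] frame is determined by six small
parameters ([adapted_params]). They range over a finite box, the same for all
ranks from 3 on; a computation in ranks 1, 2, 3 shows that the tables in the box
that can come from an adapted frame are those of the rows, up to the symmetry
of the diagram for C^v C_l and BB_2^v ([box_rowsP]), which is again a change of
frame ([adapted_row]).

Rows and tables determine each other. The colours, counting numbers and
exponents at the lifted simple roots are functions of the table, so a frame with
the table of a row realizes the row ([frame_realizes]). Conversely a realization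
defines f on the simple roots; root strings force the form to be the standard one
([form_f]), and the parameters of the table are read off from the node data
([box_readP]), which gives [realizes_frame]. An explicit system exists for every
row ([row_model]). Finally no system realizes two rows: the answers to a few
questions about shortest roots, asked only in terms of R, I and +-a, distinguish
all tables of rows of the same rank ([frame_signature], [row_signature_inj]). *)

Set Implicit Arguments.
Unset Strict Implicit.
Unset Printing Implicit Defensive.

(** * Tables on the residues modulo 4 *)

(** The lengths of the roots of BC_l. *)
Inductive len := Sh | Md | Lg.

Definition len_eqb c d := match c, d with Sh, Sh | Md, Md | Lg, Lg => true | _, _ => false end.
Lemma len_eqP : Equality.axiom len_eqb.
Proof. by case=> -[]; constructor. Qed.
HB.instance Definition _ := hasDecEq.Build len len_eqP.

Definition sqlen (c : len) : nat := match c with Sh => 1 | Md => 2 | Lg => 4 end.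

(** [T c m n] tells whether the vectors f(y) + m f(b) + n a with y of length c
are roots; only m, n < 4 matter. *)
Definition table := len -> nat -> nat -> bool.

(** The tables that occur are given by three pairs. The pair [pS0], [pS1] holds
the steps of the progressions of short roots over even and over odd multiples of
b, and [pM0], [pM1] those of the middle roots. The progressions of long roots
also have an offset; [pL0], [pL1] are those over even and odd multiples of b for
BCC_l, of 2b for C^v C_l. *)
Definition params : Type := (nat * nat) * (nat * nat) * ((nat * nat) * (nat * nat)).
Definition Params s0 s1 m0 m1 u0 u1 : params := ((s0, s1), (m0, m1), (u0, u1)).
Definition pS0 (p : params) := p.1.1.1.
Definition pS1 (p : params) := p.1.1.2.
Definition pM0 (p : params) := p.1.2.1.
Definition pM1 (p : params) := p.1.2.2.
Definition pL0 (p : params) := p.2.1.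
Definition pL1 (p : params) := p.2.2.

(** The progression with offset -u.1 and step u.2. Those symmetric about 0 have
as offset 0 or half the step. *)
Definition fib (u : nat * nat) (n : nat) := u.2 %| n + u.1.

Definition table_of (X : affine_type) (p : params) : table := fun c m n =>
  match c with
  | Sh => (if odd m then pS1 p else pS0 p) %| n
  | Md => match X with
          | BCC | BBv => (if odd m then pM1 p else pM0 p) %| n
          | CvBC | CvC => ~~ odd m && (pM0 p %| n)
          end
  | Lg => match X with
          | BCC => fib (if odd m then pL1 p else pL0 p) n
          | BBv => ~~ odd m && fib (pL0 p) n
          | CvC => ~~ odd m && fib (if odd m./2 then pL1 p else pL0 p) n
          | CvBC => (4 %| m) && fib (pL0 p) n
          end
  end.

(** The long roots over the double of a short simple root alpha form a
progression whose step is the counting number of alpha'^*. It passes through 2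
alpha exactly if alpha is black, and by symmetry through 2 alpha + (step / 2) a
otherwise. *)
Definition node_fib (d : node_data) : nat * nat :=
  (if nd_color d is Black then 0 else (nd_star_k d)./2, nd_star_k d).

(** In rank 1 the nodes 1 and l coincide, and the entries for the absent middle
roots are filled from that node. *)
Definition read_params (X : affine_type) (d0 d1 dl : node_data) : params :=
  match X with
  | BCC => Params (nd_k dl) (nd_k dl) (nd_k d1) (nd_k d1) (node_fib dl) (0, nd_k d0)
  | CvBC => Params (nd_k dl) (nd_k d0) (nd_k d1) (nd_k d1) (node_fib dl) (node_fib dl)
  | BBv => Params (nd_k dl) (nd_k dl) (nd_k d1) (nd_k d0) (node_fib dl) (node_fib dl)
  | CvC => Params (nd_k dl) (nd_k d0) (nd_k d1) (nd_k d1) (node_fib dl) (node_fib d0)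
  end.

Definition row_params (t : row_label) : params :=
  read_params (row_type t) (row_node t 0) (row_node t 1) (row_node t (row_rank t)).

Definition row_table (t : row_label) : table := table_of (row_type t) (row_params t).

Definition residues : seq nat := [:: 0; 1; 2; 3].

(** The triples (c, d, k) such that +-k occurs, for rank l, as a nonzero Cartan
integer <y^v, z> with y of length c and z of length d. *)
Definition reflections (l : nat) : seq (len * len * nat) :=
  [:: (Sh, Sh, 2); (Sh, Lg, 4); (Lg, Sh, 1); (Lg, Lg, 2)] ++
  (if 2 <= l then [:: (Sh, Md, 2); (Md, Sh, 1); (Md, Md, 2); (Md, Lg, 2); (Lg, Md, 1)] else [::]) ++
  (if 3 <= l then [:: (Md, Md, 1)] else [::]).

Definition add4 (x y : nat * nat) : nat * nat := ((x.1 + y.1) %% 4, (x.2 + y.2) %% 4).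
Definition grid : seq (nat * nat) := [seq (m, n) | m <- residues, n <- residues].
Definition points (T : table) c : seq (nat * nat) := [seq x <- grid | T c x.1 x.2].

(** Reflecting z + m' b + n' a, of length d, in y + m b + n a, of length c, with
<y^v, z> = -k changes (m', n') by k (m, n). The points are listed first to keep
the evaluation short. *)
Definition closed_under (T : table) (q : len * len * nat) :=
  let: (c, d, k) := q in
  let shifts := undup [seq ((k * x.1) %% 4, (k * x.2) %% 4) | x <- points T c] in
  all (fun v => all (fun y => let z := add4 y v in T d z.1 z.2) (points T d)) shifts.

(** The nested conditional makes the evaluation stop at the first failure. *)
Fixpoint closed_table_rec T (q : seq (len * len * nat)) :=
  if q is x :: q' then (if closed_under T x then closed_table_rec T q' else false) else true.
Definition closed_table l T := closed_table_rec T (reflections l).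

Lemma closed_table_all l T : closed_table l T = all (closed_under T) (reflections l).
Proof. by rewrite /closed_table; elim: (reflections l) => //= x s ->; case: ifP. Qed.

Lemma pointsP (T : table) c m n : m < 4 -> n < 4 -> ((m, n) \in points T c) = T c m n.
Proof.
move=> m4 n4; rewrite mem_filter /= andbC.
suff -> : (m, n) \in grid by [].
by apply/allpairsP; exists (m, n); split=> //=; rewrite !inE; lia.
Qed.

Lemma points_lt (T : table) c x : x \in points T c -> [/\ T c x.1 x.2, x.1 < 4 & x.2 < 4].
Proof.
rewrite mem_filter => /andP[Tx /allpairsP[[m n] /= [m4 n4 xE]]].
by split=> //; rewrite xE /=; [move: m4|move: n4]; rewrite !inE; lia.
Qed.

Lemma closed_tableP l (T : table) :
  (forall c d k m n m' n', (c, d, k) \in reflections l ->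
    m < 4 -> n < 4 -> m' < 4 -> n' < 4 -> T c m n -> T d m' n' ->
    T d ((m' + k * m) %% 4) ((n' + k * n) %% 4)) -> closed_table l T.
Proof.
move=> TP; rewrite closed_table_all; apply/allP => -[[c d] k] cdk.
apply/allP => v; rewrite mem_undup => /mapP[x /points_lt[Tx x1 x2] ->].
apply/allP => y /points_lt[Ty y1 y2] /=; rewrite /add4 /= !modnDmr.
exact: (TP c d k x.1 x.2 y.1 y.2).
Qed.

Lemma closed_table_shift l (T : table) c d k m n m' n' : closed_table l T ->
  (c, d, k) \in reflections l -> m < 4 -> n < 4 -> m' < 4 -> n' < 4 ->
  T c m n -> T d m' n' -> T d ((m' + k * m) %% 4) ((n' + k * n) %% 4).
Proof.
rewrite closed_table_all => /allP Tcl cdk m4 n4 m4' n4' Tx Ty.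
have /allP /(_ ((k * m) %% 4, (k * n) %% 4)) := Tcl _ cdk.
rewrite mem_undup => H; have /H : ((k * m) %% 4, (k * n) %% 4) \in
    [seq ((k * x.1) %% 4, (k * x.2) %% 4) | x <- points T c].
  by apply/mapP; exists (m, n); rewrite ?pointsP.
by move=> /allP /(_ (m', n')); rewrite pointsP //= !modnDmr => /(_ Ty).
Qed.

(** [tcount] to [tnode] are the notions attached to a node of the diagram,
computed from the table. Periodicity modulo 4 bounds counting numbers by 4. *)
Definition tcount (T : table) c m n : nat :=
  if T c m ((n + 1) %% 4) then 1 else if T c m ((n + 2) %% 4) then 2
  else if T c m ((n + 3) %% 4) then 3 else 4.

Definition tdouble (T : table) m := has (T Lg (m.*2 %% 4)) residues.

(** alpha' = 2 alpha - [tprime T m] a, for a short simple root alpha with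
b-coefficient m. *)
Definition tprime (T : table) m : nat :=
  if T Lg (m.*2 %% 4) 0 then 0 else if T Lg (m.*2 %% 4) 3 then 1
  else if T Lg (m.*2 %% 4) 2 then 2 else 3.
Definition tprime_res T m := (4 - tprime T m) %% 4.
Definition tprime_count T m := tcount T Lg (m.*2 %% 4) (tprime_res T m).

(** The nodes alpha_0, alpha_1 (singled out for BB_l^v only), the middle nodes
and alpha_l. *)
Variant node_kind := N0 | N1 | Nm | Nl.

Definition kind_len (X : affine_type) (u : node_kind) : len :=
  match u with
  | N0 => match X with BCC => Lg | BBv => Md | _ => Sh end
  | N1 | Nm => Md
  | Nl => Sh
  end.

(** The coefficient of b in the simple root. *)
Definition kind_b (u : node_kind) : nat := if u is N0 then 1 else 0.
Definition kind_mark (X : affine_type) (u : node_kind) : nat :=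
  match X, u with
  | BCC, N0 => 1
  | BCC, _ => 2
  | BBv, (N0 | N1) => 1
  | BBv, _ => 2
  | _, _ => 1
  end.

Definition node_kind_of (X : affine_type) (l i : nat) : node_kind :=
  if i == 0 then N0
  else if i < l then (if X is BBv then (if i == 1 then N1 else Nm) else Nm)
  else Nl.

Definition kinds (X : affine_type) (l : nat) : seq node_kind :=
  match X with
  | BBv => [:: N0; N1; Nl] ++ (if 3 <= l then [:: Nm] else [::])
  | _ => [:: N0; Nl] ++ (if 2 <= l then [:: Nm] else [::])
  end.

Definition doubled (X : affine_type) T (u : node_kind) :=
  if kind_len X u is Sh then tdouble T (kind_b u) else false.

(** Twice k^nr, which is a half-integer at nodes that have a doubled root over
them. *)
Definition tknr2 X T u : nat :=
  if doubled X T u then tprime_count T (kind_b u) - tprime T (kind_b u)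
  else (tcount T (kind_len X u) (kind_b u) 0).*2.

(** Comparison of the exponents at [u] and [v] after clearing denominators: the
exponent is |alpha|^2 n_alpha / k^nr, with |alpha|^2 in units of the norm of a
short root. *)
Definition texp_lt X T u v :=
  sqlen (kind_len X u) * kind_mark X u * tknr2 X T v
  < sqlen (kind_len X v) * kind_mark X v * tknr2 X T u.

Definition tcollapsed X T l u := has (texp_lt X T u) (kinds X l).

Definition tcolor X T u :=
  if doubled X T u then
    if T Lg ((kind_b u).*2 %% 4) 0 then Black else Gray
  else White.

Definition tstar_color X T u :=
  if doubled X T u then
    let m := kind_b u in
    let s := tprime_count T m - tprime T m in
    if ~~ odd s && T Sh m (s./2 %% 4) then Black else Gray
  else White.

Definition tstar_k X T u :=
  let m := kind_b u in
  if doubled X T u then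
    tcount T Lg (m.*2 %% 4) ((tprime_res T m + tprime_count T m) %% 4)
  else tcount T (kind_len X u) m (tcount T (kind_len X u) m 0 %% 4).

Definition tnode X T l u : node_data :=
  Node (tcolor X T u)
       (if tcollapsed X T l u then None else Some (tstar_color X T u))
       (tcount T (kind_len X u) (kind_b u) 0)
       (tstar_k X T u).

(** * The rows and the tables in the box *)
Definition color_eqb c1 c2 := match c1, c2 with White, White | Gray, Gray | Black,
  Black => true | _, _ => false end.
Definition nd_eqb d e := [&& color_eqb (nd_color d) (nd_color e),
  match nd_star_color d, nd_star_color e with None, None => true | Some c,
    Some c' => color_eqb c c' | _, _ => false end, nd_k d == nd_k e & nd_star_k d == nd_star_k e].

(** The progressions in Z/4 that are symmetric about 0. *)
Definition fibs := [:: (0,1); (0,2); (1,2); (0,4); (2,4)].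

(** For C^v BC_l and C^v C_l the middle roots lie over even multiples of b only,
hence a single step. In rank 1 there are no middle roots and the entry is the
one that [read_params] would return. *)
Definition middle_box (X : affine_type) (l s0 : nat) : seq (nat * nat) :=
  if l == 1 then [:: (s0, s0)] else
  match X with
  | CvBC | CvC => [:: (1, 1); (2, 2)]
  | _ => [:: (1, 1); (1, 2); (2, 1); (2, 2)]
  end.

(** For BCC_l the simple root alpha_0 is long with b-coefficient 1 and n = 0, so
its progression has offset 0. *)
Definition long_box (X : affine_type) : seq ((nat * nat) * (nat * nat)) :=
  match X with
  | BCC => [seq (u, v) | u <- fibs, v <- [:: (0, 1); (0, 2); (0, 4)]]
  | CvC => [seq (u, v) | u <- fibs, v <- fibs]
  | _ => [seq (u, u) | u <- fibs]
  end.
Definition box (X : affine_type) (l : nat) : seq params :=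
  flatten [seq [seq Params s.1 s.2 m.1 m.2 u.1 u.2 | m <- middle_box X l s.1, u <- long_box X]
    | s <- [:: (1, 1); (1, 2); (2, 1); (2, 2)]].

(** The roots of length c lie over the multiples of [step X c] b. *)
Definition step (X : affine_type) (c : len) : nat :=
  match c, X with
  | Sh, _ => 1
  | Md, (BCC | BBv) => 1
  | Md, _ => 2
  | Lg, BCC => 1
  | Lg, (BBv | CvC) => 2
  | Lg, CvBC => 4
  end.

(** The third condition of a paired simple system at a short simple root with
b-coefficient m: if some root over its image has no double, then neither has the
simple root itself. *)
Definition tgood (T : table) m := has (fun n => T Sh m n && ~~ T Lg (m.*2 %% 4) (n.*2 %% 4))
  residues
  ==> ~~ T Lg (m.*2 %% 4) 0.

(** Closed under reflections, with a lattice that contains a, and with the third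
condition at the short simple roots. *)
Definition admissible X l p := let T := table_of X p in
  if [&& has (fun m => T Sh m 1) residues, tgood T 0 &
    (if X is CvC then tgood T 1 else true)] then closed_table l T else false.

(** The effect on the parameters of the symmetry of the diagram: it exchanges
alpha_0 and alpha_l for C^v C_l, and alpha_0 and alpha_1 for BB_2^v. *)
Definition swap l X p := match X with
  | CvC => let m := if l == 1 then pS1 p else pM0 p in Params (pS1 p) (pS0 p) m m (pL1 p) (pL0 p)
  | _ => Params (pS0 p) (pS1 p) (pM1 p) (pM0 p) (pL0 p) (pL1 p) end.
Definition swappable X l := match X with CvC => true | BBv => l == 2 | _ => false end.

Lemma color_eqP c d : color_eqb c d -> c = d.
Proof. by case: c; case: d. Qed.

Lemma nd_eqP d e : nd_eqb d e -> d = e.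
Proof.
case: d e => [c [s|] k k'] [c2 [s2|] k2 k2'] /and4P[/color_eqP /= -> //].
  by move=> /color_eqP -> /eqP -> /eqP ->.
by move=> _ /eqP -> /eqP ->.
Qed.

Lemma nth_row_BC l x0 km xl i : 0 < l -> i <= l ->
  nth (white 0) (row_BC l x0 km xl) i = if i == 0 then x0 else if i < l then white km else xl.
Proof.
case: l => // l _; case: i => // i il /=.
rewrite nth_rcons size_nseq nth_nseq ltnS.
by move: il; rewrite ltnS leq_eqVlt => /orP[/eqP ->|il]; rewrite ?ltnn ?eqxx ?il.
Qed.

Lemma nth_row_B l k0 km xl i : 1 < l -> i <= l ->
  nth (white 0) (row_B l k0 km xl) i =
    if i <= 1 then white_collapsed k0 else if i < l then white km else xl.
Proof.
case: l => [//|[//|l]] _; case: i => [//|[//|i]] il /=.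
rewrite nth_rcons size_nseq nth_nseq !ltnS.
by move: il; rewrite !ltnS leq_eqVlt => /orP[/eqP ->|il]; rewrite ?ltnn ?eqxx ?il.
Qed.

(** Rows of rank at least 3 differ from those of rank 3 only in the number of
middle nodes. *)
Definition expand_row X l (r : seq node_data) : seq node_data :=
  let d := nth (white 0) r in
  if X is BBv then row_B l (nd_k (d 0)) (nd_k (d 2)) (d 3)
  else row_BC l (d 0) (nd_k (d 1)) (d 3).

Lemma rows_expand X n : rows X n.+3 = [seq expand_row X n.+3 r | r <- rows X 3].
Proof. by case: X. Qed.

Lemma row_node_large X n j i : i <= n.+3 ->
  row_node (RowLabel X n.+3 j) i =
  row_node (RowLabel X 3 j) (if i <= 1 then i else if i < n.+3 then 2 else 3).
Proof.
move=> il; have il3 : (if i <= 1 then i else if i < n.+3 then 2 else 3) <= 3.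
  by case: ifP => [|_]; [lia|case: ifP].
set i' := if _ then _ else _ in il3 *.
have [e1 e2 e3] : [/\ (i' == 0) = (i == 0), (i' <= 1) = (i <= 1) & (i' < 3) = (i < n.+3)].
  rewrite /i'; case: (leqP i 1) => i1; first by split=> //; lia.
  by case: ltnP => i3; split=> //; lia.
rewrite /row_node (rows_expand X n) [in RHS](rows_expand X 0).
case: (ltnP j.-1 (size (rows X 3))) => jn; last by rewrite !nth_default ?size_map.
rewrite !(nth_map [::]) // /expand_row; move: (nth [::] _ _) => r.
by case: (X); rewrite ?nth_row_BC ?nth_row_B ?e1 ?e2 ?e3.
Qed.

Lemma size_rows_large X n : size (rows X n.+3) = size (rows X 3).
Proof. by case: X. Qed.

Lemma row_params_large X n j : row_params (RowLabel X n.+3 j) = row_params (RowLabel X 3 j).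
Proof.
have e0 : 0 <= n.+3 by []. have e1 : 1 <= n.+3 by [].
have := row_node_large X j (leqnn n.+3); rewrite ltnn => e3.
rewrite /row_params; congr (read_params X _ _ _); last exact: e3.
  exact: (row_node_large X j e0).
exact: (row_node_large X j e1).
Qed.

(** The types that exist in rank l, for l = 1, 2, 3. *)
Definition for_types l (P : affine_type -> bool) := [&& P BCC, P CvBC, P CvC & (l == 1) || P BBv].

Definition for_rows (P : row_label -> bool) :=
  all (fun l => for_types l (fun X =>
    all (fun j => P (RowLabel X l j.+1)) (iota 0 (size (rows X l))))) [:: 1; 2; 3].

Lemma for_rowsP P X l j : for_rows P -> l <= 3 -> valid_row (RowLabel X l j) -> P (RowLabel X l j).
Proof.
move=> PP l3 /andP[/= Xl /andP[j0 jn]].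
have l0 : 0 < l by case: X Xl {jn} => /=; lia.
have lin : l \in [:: 1; 2; 3] by rewrite !inE; lia.
have /and4P[P1 P2 P3 P4] := allP PP l lin.
have {}P4 : X = BBv -> all (fun j => P (RowLabel BBv l j.+1)) (iota 0 (size (rows BBv l))).
  by move=> XB; move: P4 Xl; rewrite XB /=; case: eqP => [->|].
case: j j0 jn => // j _ jn; have jin : j \in iota 0 (size (rows X l)) by rewrite mem_iota.
by case: X Xl jn jin P4 => Xl jn jin P4; [move/allP: P1|move/allP: P2|move/allP: (P4
  erefl)|move/allP: P3]; apply.
Qed.

(** What is needed of the table of a row: it is closed, contains the simple
roots, has the right projection to the affine root system, satisfies the third
condition of a paired simple system, generates a, is symmetric under a -> -a,
and returns the node data of the row. *)
Definition row_fact (t : row_label) : bool :=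
  let X := row_type t in let l := row_rank t in let T := row_table t in
  [&& closed_table l T,
      [&& T Sh 0 0, T Md 0 0 & T (kind_len X N0) 1 0],
      all (fun c => all (fun m => has (T c m) residues == (step X c %| m)) residues) [:: Sh; Md;
        Lg],
      tgood T 0 && (if X is CvC then tgood T 1 else true),
      has (fun m => T Sh m 1) residues,
      all (fun c => all (fun m => all (fun n => T c m n == T c m ((4 - n) %% 4)) residues)
        residues) [:: Sh; Md; Lg] &
      all (fun i => nd_eqb (row_node t i) (tnode X T l (node_kind_of X l i))) (iota 0 l.+1)].

Lemma row_fact_small : for_rows row_fact.
Proof. by vm_compute. Qed.

Lemma row_table_large X n j : row_table (RowLabel X n.+3 j) = row_table (RowLabel X 3 j).
Proof. by rewrite /row_table row_params_large. Qed.

Lemma node_kind_large X n i : i <= n.+3 ->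
  node_kind_of X n.+3 i = node_kind_of X 3 (if i <= 1 then i else if i < n.+3 then 2 else 3).
Proof.
by case: i => [|[|i]] // il; rewrite /node_kind_of /=; case: ltnP => //; case: X.
Qed.

(** Ranks 1, 2, 3 are checked by computation. A higher rank has the tables of
rank 3 and the same set of Cartan integers, so it has the same facts. *)
Lemma row_fact_valid t : valid_row t -> row_fact t.
Proof.
case: t => X l j tv; have [l3|l3] := leqP l 3; first exact: for_rowsP row_fact_small l3 tv.
case: l l3 tv => [//|[//|[//|n]]] _ tv.
have /(for_rowsP row_fact_small (leqnn 3)) : valid_row (RowLabel X 3 j).
  move: tv => /andP[_ /andP[j0 jn]]; apply/andP; split; first by case: (X).
  by rewrite j0 -(size_rows_large X n).
rewrite /row_fact [row_type _]/= [row_rank _]/= row_table_large.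
move: (row_table _) => T /and5P[h1 h2 h3 h4 /and3P[h5 h6 /allP h7]].
apply/and5P; split; [exact: h1|exact: h2|exact: h3|exact: h4|apply/and3P; split;
  [exact: h5|exact: h6|]].
apply/allP => i; rewrite mem_iota => /= il.
rewrite row_node_large // node_kind_large //.
have -> u : tnode X T n.+3 u = tnode X T 3 u by case: (X).
apply: h7; rewrite !inE; case: (i) => [|[|k]] //=; case: ifP => //.
Qed.

Lemma row_node_tnode t i : valid_row t -> i <= row_rank t ->
  row_node t i = tnode (row_type t) (row_table t) (row_rank t) (node_kind_of (row_type t)
    (row_rank t) i).
Proof.
move=> /row_fact_valid /and5P[_ _ _ _ /and3P[_ _ /allP h]] il.
by apply/nd_eqP/h; rewrite mem_iota.
Qed.

(** Distinct admissible parameters give distinct node data: the parameters can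
be recovered from the data at the nodes 0, 1 and l. *)
Definition box_read l X := all (fun p => if admissible X l p then
   let T := table_of X p in let d i := tnode X T l (node_kind_of X l i) in
   p == read_params X (d 0) (d 1) (d l) else true) (box X l).
Definition box_rows l X := all (fun p => if admissible X l p then
   has (fun j => let q := row_params (RowLabel X l j.+1) in (p == q) || swappable X l && (swap l
     X p == q)) (iota 0 (size (rows X l))) else true) (box X l).

Definition box_fact l := for_types l (fun X => box_read l X && box_rows l X).

Lemma box_fact_small : all box_fact [:: 1; 2; 3].
Proof. by vm_compute. Qed.

Lemma box_fact_min l X : 0 < l -> min_rank X <= l -> box_read (minn l 3) X && box_rows (minn l 3) X.
Proof.
move=> l0 lX; have lin : minn l 3 \in [:: 1; 2; 3] by rewrite !inE; lia.
have /and4P[h1 h2 h3 h4] := allP box_fact_small _ lin.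
case: X lX => //= l2; move: h4; case: eqP => //; lia.
Qed.

Lemma box_readP l X p : 0 < l -> min_rank X <= l -> p \in box X l -> admissible X l p ->
  let d i := tnode X (table_of X p) l (node_kind_of X l i) in p = read_params X (d 0) (d 1) (d l).
Proof.
move=> l0 lX pb pa; have /andP[/allP h _] := box_fact_min l0 lX.
have [l3|l3] := leqP l 3; first by have := h p; rewrite (minn_idPl l3) pb pa => /(_ isT)/eqP.
case: l l3 l0 lX pb pa h => [//|[//|[//|n]]] _ _ _ pb pa h.
have := h p pb; rewrite (_ : admissible X _ p = true) // => /eqP e d; rewrite {1}e.
have dE i i' : i <= n.+3 -> (if i <= 1 then i else if i < n.+3 then 2 else 3) = i' ->
    tnode X (table_of X p) 3 (node_kind_of X 3 i') = d i.
  by move=> il ii; rewrite /d (@node_kind_large X n i il) ii; case: (X).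
congr (read_params X _ _ _); apply: dE => //; first by rewrite ltnn.
Qed.

(** The completeness of the lists, in terms of tables: every admissible choice
of parameters is that of a row, up to the symmetry of the diagram. *)
Lemma box_rowsP l X p : 0 < l -> min_rank X <= l -> p \in box X l -> admissible X l p ->
  exists j, valid_row (RowLabel X l j) /\
    (p = row_params (RowLabel X l j) \/ swappable X l /\ swap l X p = row_params (RowLabel X l j)).
Proof.
move=> l0 lX pb pa; have /andP[_ /allP h] := box_fact_min l0 lX.
have [l3|l3] := leqP l 3.
  have := h p; rewrite (minn_idPl l3) pb pa => /(_ isT)/hasP[j].
  rewrite mem_iota => jn jP; exists j.+1; split; first by rewrite /valid_row lX.
  by case/orP: jP => [/eqP|/andP[sw /eqP]]; [left|right].
case: l l3 l0 lX pb pa h => [//|[//|[//|n]]] _ _ lX pb pa h.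
have := h p pb; rewrite (_ : admissible X _ p = true) // => /hasP[j].
rewrite mem_iota => jn jP; exists j.+1; split; first by rewrite /valid_row lX size_rows_large.
rewrite row_params_large.
by case/orP: jP => [/eqP|/andP[sw /eqP]]; [left|right; split=> //; case: (X) sw].
Qed.

(** * Queries that separate the tables *)

(** Is there a short root x such that x + a is a root or not, as told by [s],
and such that the roots among 2x, 2x + a, 2x + 2a, 2x + 3a are those marked in
[w]? Short roots have period 2, so residues 0 and 1 suffice. *)
Definition short_query T (s : bool) (w : seq bool) :=
  has (fun m => has (fun n => [&& T Sh m n, T Sh m (n + 1) == s &
    [seq T Lg m.*2 ((n.*2 + j) %% 4) | j <- residues] == w]) [:: 0; 1]) [:: 0; 1].

(** The same for the vectors x + x' + j a, where x, x' are short roots whose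
finite parts have a sum of length [d]. *)
Definition pair_query T d (w : seq bool) :=
  has (fun m => has (fun n => T Sh m n && has (fun m' => has (fun n' => T Sh m' n' &&
    ([seq T d ((m + m') %% 4) ((n + n' + j) %% 4) | j <- residues] == w)) residues) residues) [::
      0; 1]) [:: 0; 1].
Definition bits (w : seq nat) : seq bool := [seq k == 1 | k <- w].
Definition short_patterns := [seq bits w | w <- [:: [:: 0; 0; 0; 0]; [:: 1; 1; 1; 1]; [:: 1; 0;
  1; 0];
  [:: 0; 1; 0; 1]; [:: 0; 0; 1; 0]; [:: 1; 0; 0; 0]]].
Definition long_patterns := [seq bits w | w <- [:: [:: 0; 0; 0; 0]; [:: 1; 1; 1; 1]; [:: 1; 0; 1;
  0]; [:: 1; 0; 0; 0]]].
Definition middle_patterns := [seq bits w | w <- [:: [:: 0; 0; 0; 0]; [:: 1; 1; 1; 1]; [:: 1; 0;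
  1; 0]]].

(** The patterns are chosen so that the answers separate all rows of one rank;
middle roots exist from rank 2 on. *)
Definition signature l T : seq bool :=
  [seq short_query T s w | s <- [:: false; true], w <- short_patterns]
  ++ [seq pair_query T Lg w | w <- long_patterns]
  ++ (if 2 <= l then [seq pair_query T Md w | w <- middle_patterns] else [::]).

Import Order.TTheory GRing.Theory Num.Theory.
Local Open Scope ring_scope.

(** * The finite root system BC *)
Section FiniteRoots.
Variables (K : realType) (l : nat).
Local Notation E := 'rV[K]_l.+1.
Local Notation eps := (unitv K l).
Implicit Types (u v w y z : E).

Definition dot v w : K := \sum_(i < l) v 0 (lift ord0 i) * w 0 (lift ord0 i).

(** As sets of integral vectors, the roots of length Sh, Md, Lg are the vectors
of square norm 1, those of square norm 2 and the doubles of the former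
([shortP], [middleP], [longP]). This makes closure under reflections a matter of
norms. *)
Definition finite_roots (c : len) : set E :=
  match c with Sh => @shortB K l | Md => @middleB K l | Lg => @longB K l end.

Definition integral_vec v := v 0 0 = 0 /\ forall j, v 0 j \is a Num.int.

Lemma dotC v w : dot v w = dot w v.
Proof. by apply: eq_bigr => i _; rewrite mulrC. Qed.

Lemma dotDl u v w : dot (u + v) w = dot u w + dot v w.
Proof. by rewrite -big_split; apply: eq_bigr => i _; rewrite mxE mulrDl. Qed.

Lemma dotZl k v w : dot (k *: v) w = k * dot v w.
Proof. by rewrite mulr_sumr; apply: eq_bigr => i _; rewrite mxE mulrA. Qed.

Lemma dotNl v w : dot (- v) w = - dot v w.
Proof. by rewrite -scaleN1r dotZl mulN1r. Qed.

Lemma dotDr u v w : dot w (u + v) = dot w u + dot w v.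
Proof. by rewrite dotC dotDl !(dotC w). Qed.

Lemma dotZr k v w : dot w (k *: v) = k * dot w v.
Proof. by rewrite dotC dotZl dotC. Qed.

Lemma dotNr v w : dot w (- v) = - dot w v.
Proof. by rewrite dotC dotNl dotC. Qed.

Definition dotE := (dotDl, dotDr, dotNl, dotNr, dotZl, dotZr).

Lemma dot_ge0 v : 0 <= dot v v.
Proof. by apply: sumr_ge0 => i _; rewrite -expr2 sqr_ge0. Qed.

Lemma unitvE i (j : 'I_l.+1) : eps i 0 j = ((j : nat) == i)%:R.
Proof. by rewrite mxE. Qed.

Lemma dot_unit v (i : 'I_l) : dot (eps i.+1) v = v 0 (lift ord0 i).
Proof.
rewrite /dot (bigD1 i) //= unitvE lift0 eqxx mul1r big1 ?addr0 // => j ji.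
by rewrite unitvE lift0 eqSS (inj_eq val_inj) (negPf ji) mul0r.
Qed.

Lemma dot_unitS v i : (i < l)%N -> dot (eps i.+1) v = v 0 (inord i.+1).
Proof.
move=> il; rewrite (dot_unit v (Ordinal il)); congr (v 0 _).
by apply: val_inj; rewrite /= inordK.
Qed.

Lemma dot_eps i j : (1 <= i <= l)%N -> dot (eps i) (eps j) = (i == j)%:R.
Proof.
case: i => // i /andP[_ il]; rewrite dot_unitS // unitvE inordK //.
Qed.

Lemma dotb v : dot (eps 0) v = 0.
Proof. by rewrite /dot big1 // => i _; rewrite unitvE lift0 mul0r. Qed.

Lemma dotbr v : dot v (eps 0) = 0.
Proof. by rewrite dotC dotb. Qed.

Lemma integral_dot v w : integral_vec v -> integral_vec w -> dot v w \is a Num.int.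
Proof. by move=> [_ vi] [_ wi]; apply: rpred_sum => i _; apply: rpredM. Qed.

Lemma integral_vecD v w : integral_vec v -> integral_vec w -> integral_vec (v + w).
Proof.
by move=> [v0 vi] [w0 wi]; split=> [|j]; rewrite mxE ?v0 ?w0 ?addr0 // rpredD.
Qed.

Lemma integral_vecZ k v : k \is a Num.int -> integral_vec v -> integral_vec (k *: v).
Proof. by move=> ki [v0 vi]; split=> [|j]; rewrite mxE ?v0 ?mulr0 // rpredM. Qed.

Lemma integral_vecN v : integral_vec v -> integral_vec (- v).
Proof. by rewrite -scaleN1r; apply: integral_vecZ; rewrite rpredN rpred1. Qed.

Lemma integral_eps i : (1 <= i)%N -> integral_vec (eps i).
Proof.
move=> i1; split=> [|j]; rewrite unitvE; first by case: i i1.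
exact: natr_int.
Qed.

Lemma sign_int (s : bool) : (-1) ^+ s \is a @Num.int K.
Proof. by case: s; rewrite ?expr0 ?expr1 ?rpredN rpred1. Qed.

Lemma sqr_int_ge1 (x : K) : x \is a Num.int -> x != 0 -> 1 <= x * x.
Proof.
move=> xi x0; have x1 := norm_intr_ge1 xi x0.
have -> : x * x = `|x| * `|x| by rewrite -!expr2 real_normK ?num_real.
nra.
Qed.

(** Splitting off a nonzero coordinate reduces the classification of integral
vectors of norm 1 and 2 to smaller norms. *)
Lemma dot_split v (i : 'I_l) :
  dot v v = v 0 (lift ord0 i) * v 0 (lift ord0 i)
    + dot (v - v 0 (lift ord0 i) *: eps i.+1) (v - v 0 (lift ord0 i) *: eps i.+1).
Proof.
set k := v 0 _; rewrite !dotE (dotC v (eps _)) !dot_unit unitvE lift0 eqxx mulr1n -/k; ring.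
Qed.

Lemma dot0_eq0 v : integral_vec v -> dot v v = 0 -> v = 0.
Proof.
move=> [v0 vi] /eqP; rewrite psumr_eq0 => [|i _]; last by rewrite -expr2 sqr_ge0.
move=> /allP v_0; apply/rowP => j; rewrite mxE.
case: (unliftP ord0 j) => [i ->|-> //].
by have /implyP /(_ isT) := v_0 i (mem_index_enum _); rewrite mulf_eq0 orbb => /eqP.
Qed.

Lemma nonzero_coord v : dot v v != 0 -> exists i : 'I_l, v 0 (lift ord0 i) != 0.
Proof.
move=> vn; apply/existsP; apply: contraNT vn => /existsPn v0.
by apply/eqP/big1 => i _; have /negPn/eqP -> := v0 i; rewrite mul0r.
Qed.

Lemma sqr1_sign (k : K) : k * k = 1 -> exists s : bool, k = (-1) ^+ s.
Proof.
move=> k1; have /eqP : (k - 1) * (k + 1) = 0 by lra.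
rewrite mulf_eq0 => /orP[] /eqP k0; [exists false|exists true]; rewrite ?expr0 ?expr1; lra.
Qed.

Lemma shortP v : finite_roots Sh v <-> integral_vec v /\ dot v v = 1.
Proof.
split=> [[i [s [/andP[i1 il] ->]]]|[vi v1]].
  split; first by exact: (integral_vecZ (sign_int s) (integral_eps i1)).
  by rewrite !dotE dot_eps ?i1 // eqxx mulr1 -signr_addb addbb.
have [|i ki] := @nonzero_coord v; first by rewrite v1 oner_eq0.
have k1 := sqr_int_ge1 (vi.2 _) ki.
have := dot_split v i; rewrite v1.
set k := v _ _ in ki k1 *; set w := v - _ => vE.
have w0 := dot_ge0 w.
have wi : integral_vec w.
  apply: (integral_vecD vi (integral_vecN _)); apply: (integral_vecZ (vi.2 _)).
  exact: integral_eps.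
have /(dot0_eq0 wi) /eqP : dot w w = 0 by lra.
rewrite subr_eq0 => /eqP ->.
have [s ks] : exists s : bool, k = (-1) ^+ s by apply: sqr1_sign; lra.
by exists i.+1, s; rewrite ks; split => //; rewrite ltn_ord.
Qed.

Lemma int_sqr_neq2 (x : K) : x \is a Num.int -> x * x != 2.
Proof.
move=> /intrP[z ->]; rewrite -intrM -[2]/(2%:~R) eqr_int.
apply/eqP => z2; have : (`|z|%N * `|z|%N = 2)%N by rewrite -abszM z2.
by case: (absz z) => [|[|n]]; rewrite ?mulnS //; lia.
Qed.

(** A nonzero integral coordinate has square 1 because 2 is not a square; what
remains has norm 1. *)
Lemma middle_sum v : integral_vec v -> dot v v = 2 ->
  exists u w, [/\ finite_roots Sh u, finite_roots Sh w, dot u w = 0 & v = u + w].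
Proof.
move=> vi v2.
have [|i ki] := @nonzero_coord v; first by rewrite v2 pnatr_eq0.
have k1 := sqr_int_ge1 (vi.2 _) ki.
have := dot_split v i; have := int_sqr_neq2 (vi.2 (lift ord0 i)); rewrite v2.
set k := v _ _ in ki k1 *; set w := v - _ => k2 vE.
have wi : integral_vec w.
  apply: (integral_vecD vi (integral_vecN _)); apply: (integral_vecZ (vi.2 _)).
  exact: integral_eps.
have w0 := dot_ge0 w.
have wn : dot w w != 0 by apply: contraNneq k2 => w_0; rewrite vE w_0 addr0.
have [j kj] := nonzero_coord wn.
have w1 : 1 <= dot w w.
  have := sqr_int_ge1 (wi.2 _) kj; rewrite (dot_split w j).
  have := dot_ge0 (w - w 0 (lift ord0 j) *: eps j.+1); lra.
have kk : k * k = 1 by lra.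
exists (k *: eps i.+1), w; split; last by rewrite addrC subrK.
- apply/shortP; split; first exact: (integral_vecZ (vi.2 _) (integral_eps _)).
  by rewrite !dotE dot_unit unitvE lift0 eqxx mulr1.
- by apply/shortP; split=> //; lra.
- by rewrite !dotE !dot_unit unitvE lift0 eqxx mulr1n -/k; ring.
Qed.

Lemma middleP v : finite_roots Md v <-> integral_vec v /\ dot v v = 2.
Proof.
split=> [[i [j [s [t [i1 /andP[ij jl] ->]]]]]|[vi v2]].
  have j1 : (1 <= j)%N by lia.
  split.
    apply: integral_vecD; apply: integral_vecZ; rewrite ?sign_int //; exact: integral_eps.
  have [il jl'] : (1 <= i <= l)%N /\ (1 <= j <= l)%N by split; lia.
  rewrite !dotE !dot_eps // !eqxx !mulr1 (gtn_eqF ij) (ltn_eqF ij) !mulr0 addr0 add0r.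
  by rewrite -!signr_addb !addbb.
have [u [w [[i [s [il uE]]] [j [t [jl wE]]] uw ->]]] := middle_sum vi v2.
have ij : i != j.
  move: uw; rewrite uE wE !dotE dot_eps //; case: eqP => // _ /eqP.
  by rewrite mulr1 mulf_eq0 !signr_eq0.
case: (ltngtP i j) ij => // ij _; rewrite uE wE.
- by exists i, j, s, t; split=> //; lia.
- by exists j, i, t, s; split; rewrite 1?addrC //; lia.
Qed.

Lemma longP v : finite_roots Lg v <-> exists2 w, finite_roots Sh w & v = 2 *: w.
Proof.
split=> [[i [s [il ->]]]|[w [i [s [il ->]]] ->]].
  by exists ((-1) ^+ s *: eps i); [exists i, s | rewrite !scalerA mulrC].
by exists i, s; split=> //; rewrite !scalerA mulrC.
Qed.

Lemma finite_rootsP c v : finite_roots c v -> integral_vec v /\ dot v v = (sqlen c)%:R.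
Proof.
case: c => [/shortP|/middleP|/longP[w /shortP[wi w1] ->]] //.
split; first exact: integral_vecZ.
by rewrite !dotE w1 mulr1 -natrM.
Qed.

Lemma finite_rootsN c v : finite_roots c v -> finite_roots c (- v).
Proof.
have shN w : finite_roots Sh w -> finite_roots Sh (- w).
  by move=> /shortP[wi w1]; apply/shortP; split; [exact: integral_vecN|rewrite !dotE opprK].
case: c => [|/middleP[vi v1]|/longP[w /shN wN ->]]; first exact: shN.
- by apply/middleP; split; [exact: integral_vecN|rewrite !dotE opprK].
- by apply/longP; exists (- w); rewrite // scalerN.
Qed.

Lemma dot_sqr_le v w : dot v w * dot v w <= dot v v * dot w w.
Proof.
have [v0|vn] := eqVneq (dot v v) 0.
  suff -> : dot v w = 0 by rewrite !mul0r v0 mul0r.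
  apply: big1 => i _.
  move/eqP: v0; rewrite psumr_eq0 => [|j _]; last by rewrite -expr2 sqr_ge0.
  move=> /allP /(_ i (mem_index_enum _)) /implyP /(_ isT).
  by rewrite mulf_eq0 orbb => /eqP ->; rewrite mul0r.
have v0 : 0 < dot v v by rewrite lt_def vn dot_ge0.
have := dot_ge0 (dot v v *: w - dot v w *: v); rewrite !dotE (dotC w v).
nra.
Qed.

Lemma int_abs_lt2 (x : K) : x \is a Num.int -> x * x < 4 -> [\/ x = 0, x = 1 | x = - 1].
Proof.
move=> /intrP[z ->] z2.
have : (z * z < 4)%R by rewrite -(ltr_int K) rmorphM.
move=> {}z2; have : z = 0 \/ z = 1 \/ z = -1 by nia.
by case=> [->|[->|->]]; [constructor 1|constructor 2|constructor 3].
Qed.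

Lemma int_abs_le2 (x : K) : x \is a Num.int -> x * x <= 4 ->
  [\/ x = 0, x = 1 \/ x = -1 | x = 2 \/ x = - 2].
Proof.
move=> /intrP[z ->] z2.
have {}z2 : (z * z <= 4)%R by rewrite -(ler_int K) rmorphM.
have : z = 0 \/ z = 1 \/ z = -1 \/ z = 2 \/ z = -2 by nia.
case=> [->|[->|[->|[->|->]]]]; [constructor 1|constructor 2|constructor 2|constructor
  3|constructor 3] => //; by [left|right].
Qed.

Definition cartan y z : K := 2 * dot y z / dot y y.

Lemma short_dot y z : finite_roots Sh y -> integral_vec z -> dot z z < 4 ->
   [\/ dot y z = 0, dot y z = 1 | dot y z = - 1].
Proof.
move=> /shortP[yi y1] zi z2; apply: int_abs_lt2; first exact: integral_dot.
by have := dot_sqr_le y z; rewrite y1 mul1r => h; apply: le_lt_trans h z2.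
Qed.

Lemma cartanZr y k z : cartan y (k *: z) = k * cartan y z.
Proof. by rewrite /cartan dotZr; ring. Qed.

Lemma cartan_short y z : finite_roots Sh y -> cartan y z = 2 * dot y z.
Proof. by move=> /shortP[_ y1]; rewrite /cartan y1 divr1. Qed.

Lemma cartan_middle y z : finite_roots Md y -> cartan y z = dot y z.
Proof. by move=> /middleP[_ y1]; rewrite /cartan y1 mulrC mulKf ?pnatr_eq0. Qed.

Lemma cartan_long y z : finite_roots Sh y -> cartan (2 *: y) z = dot y z.
Proof.
move=> /shortP[_ y1]; rewrite /cartan !dotE y1 mulr1 -natrM.
by rewrite mulrA -natrM mulrC mulKf ?pnatr_eq0.
Qed.

(** The exception of rank 2: the Cartan integer 1 between two middle roots needs
three distinct eps_i. *)
Lemma middle_dot_rank2 y z : l = 2%N -> finite_roots Md y -> finite_roots Md z ->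
  [\/ dot y z = 0, dot y z = 2 | dot y z = - 2].
Proof.
move=> l2 [i [j [s [t [i1 /andP[ij jl] ->]]]]] [i' [j' [s' [t' [i1' /andP[ij' jl'] ->]]]]].
have [-> ->] : i = 1%N /\ i' = 1%N by lia.
have [-> ->] : j = 2%N /\ j' = 2%N by lia.
rewrite !dotE !dot_eps; do ?lia; rewrite !eqxx /= !mulr1 !mulr0 addr0 add0r.
rewrite -!signr_addb; case: (s (+) s'); case: (t (+) t'); rewrite ?expr0 ?expr1.
- by constructor 3; lra.
- by constructor 1; lra.
- by constructor 1; lra.
- by constructor 2; lra.
Qed.

Lemma middle_rank y : finite_roots Md y -> (2 <= l)%N.
Proof. by case=> i [j [s [t [i1 ij _]]]]; lia. Qed.

(** Cauchy-Schwarz bounds the Cartan integers of each pair of lengths. *)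
Lemma cartan_reflections c d y z : finite_roots c y -> finite_roots d z ->
  cartan y z = 0 \/ exists2 k, (c, d, k) \in reflections l &
                    cartan y z = k%:R \/ cartan y z = - k%:R.
Proof.
have refl3 (k : nat) (C D : K) (S : (c, d, k) \in reflections l) :
    [\/ D = 0, D = 1 | D = -1] -> C = k%:R * D ->
    C = 0 \/ exists2 k, (c, d, k) \in reflections l & C = k%:R \/ C = - k%:R.
  case=> -> ->; [left; ring|right|right]; exists k => //; [left|right]; ring.
have lt4 (n : nat) : (n < 4)%N -> (n%:R < 4 :> K) by rewrite ltr_nat.
case: c d refl3 => -[] refl3 yc zd; have [yi y1] := finite_rootsP yc;
  have [zi z1] := finite_rootsP zd;
  move: (yc) (zd).
- move=> _ _; apply: (refl3 2%N) (short_dot yc zi _) (cartan_short _ yc); rewrite ?z1 ?lt4 //.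
- move=> _ /middle_rank l2; apply: (refl3 2%N) (short_dot yc zi _) (cartan_short _ yc);
  rewrite ?z1 ?lt4 //.
  by rewrite /reflections l2.
- move=> _ /longP[w ws zE]; have [wi w1] := finite_rootsP ws.
  apply: (refl3 4%N) (short_dot yc wi _) _; rewrite ?w1 ?lt4 //.
  by rewrite zE cartanZr cartan_short // mulrA -natrM.
- move=> /middle_rank l2 _; apply: (refl3 1%N) (short_dot zd yi _) _; rewrite ?y1 ?lt4 //.
    by rewrite /reflections l2.
  by rewrite cartan_middle // dotC mul1r.
- move=> /middle_rank l2 _; rewrite cartan_middle //.
  have [l3|l3] := boolP (3 <= l)%N.
    have := dot_sqr_le y z; rewrite y1 z1 -natrM => /(int_abs_le2 (integral_dot yi zi)).
    case; [by left|move=> h|move=> h]; right; [exists 1%N|exists 2%N] => //.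
    + by rewrite /reflections l2 l3.
    + by rewrite /reflections l2 l3.
  have l2' : l = 2%N by lia.
  case: (middle_dot_rank2 l2' yc zd) => ->; first by left.
  1,2: by right; exists 2%N; [rewrite /reflections l2|auto].
- move=> /middle_rank l2 /longP[w ws zE]; have [wi w1] := finite_rootsP ws.
  apply: (refl3 2%N) (short_dot ws yi _) _; rewrite ?y1 ?lt4 //.
    by rewrite /reflections l2.
  by rewrite zE cartanZr cartan_middle // dotC.
- move=> /longP[w ws yE] _.
  apply: (refl3 1%N) (short_dot ws zi _) _; rewrite ?z1 ?lt4 //.
  by rewrite yE cartan_long // mul1r.
- move=> /longP[w ws yE] /middle_rank l2.
  apply: (refl3 1%N) (short_dot ws zi _) _; rewrite ?z1 ?lt4 //.
    by rewrite /reflections l2.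
  by rewrite yE cartan_long // mul1r.
- move=> /longP[w ws yE] /longP[x xs zE]; have [xi x1] := finite_rootsP xs.
  apply: (refl3 2%N) (short_dot ws xi _) _; rewrite ?x1 ?lt4 //.
  by rewrite zE cartanZr yE cartan_long.
Qed.

Lemma cartan_int c d y z : finite_roots c y -> finite_roots d z -> cartan y z \is a Num.int.
Proof.
move=> yc zd; have [->//|[k _ [] ->]] := cartan_reflections yc zd.
  exact: natr_int.
by rewrite rpredN natr_int.
Qed.

(** A reflection is an isometry with integral coefficients, and the roots of
each length are characterized by norm and integrality. *)
Lemma finite_reflection c d y z : finite_roots c y -> finite_roots d z ->
  finite_roots d (z - cartan y z *: y).
Proof.
move=> yc; have [yi yn] := finite_rootsP yc.
have y0 : dot y y != 0 by rewrite yn pnatr_eq0; case: (c).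
have isom w : dot (w - cartan y w *: y) (w - cartan y w *: y) = dot w w.
  by rewrite !dotE (dotC w y) /cartan; field.
have refl e w : finite_roots e w -> integral_vec (w - cartan y w *: y).
  move=> we; have [wi _] := finite_rootsP we.
  by apply/(integral_vecD wi)/integral_vecN/integral_vecZ => //; exact: cartan_int yc we.
case: d => [zd|zd|/longP[w ws ->]].
- by apply/shortP; split; [exact: refl zd|rewrite isom; case/shortP: zd].
- by apply/middleP; split; [exact: refl zd|rewrite isom; case/middleP: zd].
- apply/longP; exists (w - cartan y w *: y); last by rewrite cartanZr scalerBr scalerA.
  by apply/shortP; split; [exact: refl ws|rewrite isom; case/shortP: ws].
Qed.

(** The converse of [cartan_reflections]: it turns a condition on actual roots
into one on the list [reflections]. *)
Lemma reflections_witness c d k : (0 < l)%N -> (c, d, k) \in reflections l ->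
  exists y z, [/\ finite_roots c y, finite_roots d z & cartan y z = k%:R].
Proof.
move=> l0 cdk.
have e1 : finite_roots Sh (eps 1).
  by exists 1%N, false; rewrite expr0 scale1r.
have e2 : finite_roots Lg (2 *: eps 1) by apply/longP; exists (eps 1).
have e11 : dot (eps 1) (eps 1) = 1 by rewrite dot_eps // eqxx.
have m12 : (2 <= l)%N -> finite_roots Md (eps 1 + eps 2).
  by move=> l2; exists 1%N, 2%N, false, false; rewrite expr0 !scale1r.
have e12 : dot (eps 1) (eps 2) = 0 by rewrite dot_eps.
have e21 : dot (eps 2) (eps 1) = 0 by rewrite dotC.
have e22 : (2 <= l)%N -> dot (eps 2) (eps 2) = 1 by move=> l2; rewrite dot_eps // eqxx.
have m12n : (2 <= l)%N -> dot (eps 1 + eps 2) (eps 1 + eps 2) = 2.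
  by move=> l2; have [] := finite_rootsP (m12 l2).
move: cdk; rewrite /reflections !mem_cat !inE => /orP[|/orP[]].
- case/or4P => /eqP[-> -> ->].
  + by exists (eps 1), (eps 1); rewrite cartan_short ?e11 ?mulr1.
  + by exists (eps 1), (2 *: eps 1); rewrite cartanZr cartan_short ?e11 //; split=> //; ring.
  + by exists (2 *: eps 1), (eps 1); rewrite cartan_long ?e11.
  + by exists (2 *: eps 1), (2 *: eps 1); rewrite cartanZr cartan_long ?e11 //; split=> //; ring.
- case: ifP => // l2; rewrite !inE => /orP[|/or4P[]] /eqP[-> -> ->]; have m := m12 l2.
  + by exists (eps 1), (eps 1 + eps 2); rewrite cartan_short // dotDr e11 e12; split=> //; ring.
  + by exists (eps 1 + eps 2), (eps 1); rewrite cartan_middle // dotDl e11 e21; split=> //; ring.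
  + by exists (eps 1 + eps 2), (eps 1 + eps 2); rewrite cartan_middle // m12n.
  + by exists (eps 1 + eps 2), (2 *: eps 1); rewrite cartan_middle // dotZr dotDl e11 e21;
    split=> //; ring.
  + by exists (2 *: eps 1), (eps 1 + eps 2); rewrite cartan_long // dotDr e11 e12; split=> //; ring.
- case: ifP => // l3; rewrite !inE => /eqP[-> -> ->].
  have l2 : (2 <= l)%N by lia.
  exists (eps 1 + eps 2), (eps 1 + eps 3); split; first exact: m12.
    by exists 1%N, 3%N, false, false; rewrite expr0 !scale1r.
  by rewrite (cartan_middle _ (m12 l2)) !dotDl !dotDr e11 e21 !dot_eps //=; lra.
Qed.

End FiniteRoots.

(** * Affine root systems and their simple roots *)

(** The coefficients n_i with b = sum n_i beta_i. *)
Definition node_mark (X : affine_type) (i : nat) : nat :=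
  match X with
  | BCC => if i == 0%N then 1 else 2
  | BBv => if (i <= 1)%N then 1 else 2
  | _ => 1
  end.

Section SimpleRoots.
Variables (K : realType) (l : nat).
Local Notation E := 'rV[K]_l.+1.
Local Notation eps := (unitv K l).
Implicit Types (v w y z : E) (X : affine_type).

Lemma affine_rootsP X v : affine_roots X v <->
  exists c y (m : int), [/\ finite_roots c y, (step X c %| m)%Z & v = y + eps 0 *~ m].
Proof.
split.
  have shift (B : set E) k w : (forall y, B y -> exists c, finite_roots c y /\ step X c = k) ->
      shiftb B k w -> exists c y (m : int), [/\ finite_roots c y,
        (step X c %| m)%Z & w = y + eps 0 *~ m].
    move=> BP [y [n [/BP[c [yc sc]] ->]]]; exists c, y, (k%:Z * n); split => //.
    by rewrite sc dvdz_mulr.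
  case: X shift => shift /=.
  - apply: (shift _ 1%N) => // y [[yS|yM]|yL]; [exists Sh|exists Md|exists Lg] => //.
  - case=> [[]|]; [apply: (shift _ 1%N)|apply: (shift _ 2%N)|apply: (shift _ 4%N)] => // y yB;
      by [exists Sh|exists Md|exists Lg].
  - case=> [[]|]; [apply: (shift _ 1%N)|apply: (shift _ 1%N)|apply: (shift _ 2%N)] => // y yB;
      by [exists Sh|exists Md|exists Lg].
  - case=> [[]|]; [apply: (shift _ 1%N)|apply: (shift _ 2%N)|apply: (shift _ 2%N)] => // y yB;
      by [exists Sh|exists Md|exists Lg].
move=> [c [y [m [yc /dvdzP[n ->] ->]]]].
have sh k (B : set E) : B y -> step X c = k -> shiftb B k (y + eps 0 *~ (n * (step X c)%:Z)).
  by move=> yB ->; exists y, n; split=> //; rewrite mulrC.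
case: X c yc sh => [] [] yc sh /=; try (by left; left; apply: sh); try (by left; right; apply: sh);
  try (by right; apply: sh).
- by apply: sh => //; left; left.
- by apply: sh => //; left; right.
- by apply: sh => //; right.
Qed.

Definition psum v (j : nat) : K := \sum_(i < l | (i < j)%N) v 0 (lift ord0 i).

Lemma psumD v w j : psum (v + w) j = psum v j + psum w j.
Proof. by rewrite -big_split; apply: eq_bigr => i _; rewrite mxE. Qed.

Lemma psumZ k v j : psum (k *: v) j = k * psum v j.
Proof. by rewrite mulr_sumr; apply: eq_bigr => i _; rewrite mxE. Qed.

Lemma psumN v j : psum (- v) j = - psum v j.
Proof. by rewrite -scaleN1r psumZ mulN1r. Qed.

Lemma psum_eps i j : (1 <= i <= l)%N -> psum (eps i) j = (i <= j)%N%:R.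
Proof.
case: i => // i /andP[_ il]; rewrite /psum.
have [ij|ij] := leqP i.+1 j.
  rewrite (bigD1 (Ordinal il)) //= unitvE lift0 /= eqxx big1 ?addr0 // => k /andP[_ ki].
  by rewrite unitvE lift0 eqSS (_ : (k : nat) == i = false) //; apply/negbTE.
rewrite big1 // => k kj; rewrite unitvE lift0 eqSS.
by case: eqP => // ki; move: kj; rewrite ki ltnNge -ltnS ij.
Qed.

Lemma psum_eps0 j : psum (eps 0) j = 0.
Proof. by rewrite /psum big1 // => k _; rewrite unitvE lift0. Qed.

Lemma psumS v j (jl : (j < l)%N) : psum v j.+1 = psum v j + v 0 (lift ord0 (Ordinal jl)).
Proof.
rewrite /psum (bigD1 (Ordinal jl)) //= addrC; congr (_ + _); apply: eq_bigl => i.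
by rewrite -(inj_eq val_inj) /= ltnS [RHS]ltn_neqAle andbC.
Qed.

Lemma psum0 v : psum v 0 = 0.
Proof. by rewrite /psum big_pred0. Qed.

(** The coordinates of a vector with respect to the simple roots. Apart from
beta_0 these are the differences eps_i - eps_(i+1), so partial sums of
coordinates occur. *)
Definition simple_coef X v (j : nat) : K := (node_mark X j)%:R * v 0 0 + psum v j.

Lemma eps_gt : eps l.+1 = 0.
Proof. by apply/rowP => j; rewrite unitvE mxE ltn_eqF. Qed.

Lemma affine_simpleS X i : (i < l)%N -> affine_simple K l X i.+1 = eps i.+1 - eps i.+2.
Proof.
move=> il; rewrite /affine_simple /=; case: ltnP => // li.
have -> : i.+1 = l by apply/eqP; rewrite eqn_leq il li.
by rewrite eps_gt subr0.
Qed.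

Lemma sum_eps (f : nat -> K) (k : 'I_l.+1) n :
  \sum_(i < l) f i * eps (i + n.+1) 0 k = if (n < k)%N then f (k - n.+1)%N else 0.
Proof.
case: ltnP => kn; last first.
  rewrite big1 // => i _; rewrite unitvE ltn_eqF ?mulr0 //.
  by rewrite addnS ltnS (leq_trans kn) // leq_addl.
have kl : (k - n.+1 < l)%N by have := ltn_ord k; lia.
rewrite (bigD1 (Ordinal kl)) //= unitvE subnK // eqxx mulr1 big1 ?addr0 // => i ik.
rewrite unitvE; case: eqP => [ki|]; last by rewrite mulr0.
case/eqP: ik; apply: val_inj => /=; lia.
Qed.

Lemma simple_expand X v : (min_rank X <= l)%N ->
  v = \sum_(i < l.+1) simple_coef X v i *: affine_simple K l X i.
Proof.
move=> rk; apply/rowP => k; rewrite big_ord_recl mxE summxE mxE.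
have -> : \sum_(i < l) (simple_coef X v (lift ord0 i) *: affine_simple K l X (lift ord0 i)) 0 k =
   (if (0 < k)%N then simple_coef X v k else 0) - (if (1 < k)%N then simple_coef X v k.-1 else 0).
  have := sum_eps (fun i => simple_coef X v i.+1) k 0;
    have := sum_eps (fun i => simple_coef X v i.+1) k 1.
  have -> : (if (1 < k)%N then simple_coef X v (k - 2).+1 else 0) = (if (1 < k)%N then
    simple_coef X v k.-1 else 0).
    by case: ltnP => // k1; congr simple_coef; lia.
  have -> : (if (0 < k)%N then simple_coef X v (k - 1).+1 else 0) = (if (0 < k)%N then
    simple_coef X v k else 0).
    by case: ltnP => // k1; congr simple_coef; lia.
  move=> <- <-; rewrite -sumrB; apply: eq_bigr => i _.
  by rewrite mxE lift0 affine_simpleS // [X in _ * X]mxE [X in _ * (_ + X)]mxE mulrBr addn1 addn2.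
have kl := ltn_ord k; have vk : forall j (jl : (j < l)%N),
  k = j.+1 :> nat -> v 0 k = psum v j.+1 - psum v j.
  by move=> j jl kj; rewrite psumS addrAC subrr add0r; congr (v 0 _); apply: val_inj; rewrite /= kj.
case k0 : (nat_of_ord k) => [|[|[|j]]] /=.
- rewrite (_ : k = ord0); last by apply: val_inj.
  rewrite /simple_coef psum0 addr0 /=.
  by case: X rk => rk; rewrite /affine_simple /= ?mxE /=; ring.
- rewrite (vk 0%N) ?k0 //; last by lia.
  rewrite /simple_coef !psum0; case: X rk => rk; rewrite /affine_simple /= ?mxE k0 /=; ring.
- rewrite (vk 1%N) ?k0 //; last by lia.
  rewrite /simple_coef !psum0; case: X rk => rk; rewrite /affine_simple /= ?mxE k0 /=; ring.
- rewrite (vk j.+2) ?k0 //; last by lia.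
  rewrite /simple_coef !psum0; case: X rk => rk; rewrite /affine_simple /= ?mxE k0 /=; ring.
Qed.

Lemma simple_basis X : (min_rank X <= l)%N ->
  basis_of fullv [tuple affine_simple K l X i | i < l.+1].
Proof.
move=> rk; rewrite basisEdim dimvf dim_matrix mul1r size_tuple leqnn andbT.
apply/subvP => v _; rewrite (simple_expand v rk); apply: memv_suml => i _.
apply/memvZ/memv_span; apply/mapP; exists i; rewrite ?mem_enum //.
Qed.

Lemma simple_coef_eq X v (c : 'I_l.+1 -> K) : (min_rank X <= l)%N ->
  v = \sum_(i < l.+1) c i *: affine_simple K l X i -> forall i : 'I_l.+1, c i = simple_coef X v i.
Proof.
move=> rk vE i; have /andP[_ /freeP fr] := simple_basis rk.
have := fr (fun i => c i - simple_coef X v i).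
have -> : \sum_(j < l.+1) (c j - simple_coef X v j) *: [tuple affine_simple K l X i | i <
  l.+1]`_j = 0.
  under eq_bigr => j _ do rewrite -tnth_nth tnth_mktuple scalerBl.
  by rewrite sumrB -vE -simple_expand // subrr.
by move=> /(_ erefl i) /eqP; rewrite subr_eq0 => /eqP.
Qed.

Lemma psum_int y j : integral_vec y -> psum y j \is a Num.int.
Proof. by move=> [_ yi]; apply: rpred_sum. Qed.

(** In BC_l with its standard order every root is positive or negative. *)
Lemma psum_sign c y : finite_roots c y ->
  (forall j, 0 <= psum y j) \/ (forall j, psum y j <= 0).
Proof.
have sgn (s : bool) (k : K) : 0 <= k -> if s then (-1) ^+ s * k <= 0 else 0 <= (-1) ^+ s * k.
  by case: s => k0; rewrite ?expr0 ?expr1; lra.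
have shS z : finite_roots Sh z -> (forall j, 0 <= psum z j) \/ (forall j, psum z j <= 0).
  move=> [i [s [il ->]]]; case: s (sgn s) => sg; [right|left] => j;
  by rewrite psumZ; apply: sg; rewrite psum_eps.
case: c => [|[i [j [s [t [i1 /andP[ij jl] ->]]]]]|/longP[w /shS wS ->]]; first exact: shS.
  have [il jl'] : (1 <= i <= l)%N /\ (1 <= j <= l)%N by split; lia.
  have le k : ((j <= k)%N%:R : K) <= (i <= k)%N%:R by rewrite ler_nat; case: leqP => //; lia.
  by case: s; [right|left] => k; have := le k; have := ler0n K (j <= k)%N;
    rewrite psumD !psumZ !psum_eps //; case: t; rewrite ?expr0 ?expr1; lra.
by case: wS => wS; [left|right] => j; have := wS j; rewrite psumZ; lra.
Qed.

Lemma psum_bound c y j : finite_roots c y ->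
  - (if c is Sh then 1 else 2) <= psum y j <= (if c is Sh then 1 else 2).
Proof.
have sgn (s : bool) (k : K) : 0 <= k <= 1 -> -1 <= (-1) ^+ s * k <= 1.
  by case: s; rewrite ?expr0 ?expr1; lra.
have eps01 i : (1 <= i <= l)%N -> 0 <= psum (eps i) j <= 1.
  by move=> il; rewrite psum_eps // ler0n lern1 leq_b1.
have shS z : finite_roots Sh z -> -1 <= psum z j <= 1.
  by move=> [i [s [il ->]]]; rewrite psumZ; apply: sgn; apply: eps01.
case: c => [|[i [k [s [t [i1 /andP[ik kl] ->]]]]]|/longP[w /shS wS ->]]; first exact: shS.
- have [il kl'] : (1 <= i <= l)%N /\ (1 <= k <= l)%N by split; lia.
  by have := sgn s _ (eps01 _ il); have := sgn t _ (eps01 _ kl'); rewrite psumD !psumZ; lra.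
- by rewrite psumZ; lra.
Qed.

Lemma psum1_bound c y : finite_roots c y -> c != Lg -> -1 <= psum y 1 <= 1.
Proof.
case: c => // [yc _|[i [j [s [t [i1 /andP[ij jl] ->]]]]] _]; first exact: psum_bound yc.
have [il jl'] : (1 <= i <= l)%N /\ (1 <= j <= l)%N by split; lia.
rewrite psumD !psumZ !psum_eps // (_ : (j <= 1)%N = false) ?mulr0 ?addr0; last by lia.
by case: s; case: (i <= 1)%N; rewrite ?expr0 ?expr1 /= ?mulr0n ?mulr1n; lra.
Qed.

Lemma simple_coef_shift X c y (m : int) j : finite_roots c y ->
  simple_coef X (y + eps 0 *~ m) j = (node_mark X j)%:R * m%:~R + psum y j.
Proof.
move=> yc; have [[y0 _] _] := finite_rootsP yc.
rewrite /simple_coef psumD -scaler_int psumZ psum_eps0 mulr0 addr0 !mxE y0 add0r.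
by rewrite mulr1.
Qed.

(** A positive multiple of b contributes at least the marks, which dominate the
partial sums of a finite root. *)
Lemma simple_coef_pos X c y (m : int) : finite_roots c y -> (step X c %| m)%Z -> 1 <= m ->
  forall j, 0 <= simple_coef X (y + eps 0 *~ m) j.
Proof.
move=> yc sm m1 j; rewrite (simple_coef_shift _ _ _ yc).
have m1' : 1 <= m%:~R :> K by rewrite (ler_int K 1 m).
have m2' : (1 < step X c)%N -> 2 <= m%:~R :> K.
  rewrite (ler_int K 2 m); case/dvdzP: sm m1 => q ->; move: (step X c) => s qs s2.
  have q1 : 1 <= q by nia.
  by nia.
have := psum_bound j yc.
have b1 : c != Lg -> -1 <= psum y 1 <= 1 by apply: psum1_bound.
have p0 := psum0 y.
case: X c sm m2' yc b1 => [] [] sm m2' yc b1; case: j => [|[|j]] /=;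
  (try have := m2' isT); (try have := b1 isT); rewrite ?p0; lra.
Qed.

(** Roots with b-coefficient at least 1 have coefficients >= 0, those with
coefficient at most -1 are their opposites, and for b-coefficient 0 the signs
are those of the finite root. *)
Lemma simple_combination X v : (min_rank X <= l)%N -> affine_roots X v ->
  exists c : 'I_l.+1 -> nat, v = \sum_(i < l.+1) affine_simple K l X i *+ c i \/
                             v = - \sum_(i < l.+1) affine_simple K l X i *+ c i.
Proof.
move=> rk /affine_rootsP[c [y [m [yc sm ->]]]].
have [[y0 yi] _] := finite_rootsP yc.
have pos w : (forall j, simple_coef X w j \is a Num.int) -> (forall j, 0 <= simple_coef X w j) ->
    exists c : 'I_l.+1 -> nat, w = \sum_(i < l.+1) affine_simple K l X i *+ c i.
  move=> wi w0; exists (fun i => Num.truncn (simple_coef X w i)).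
  rewrite {1}(simple_expand w rk); apply: eq_bigr => i _.
  by rewrite -scaler_nat truncnK // natrEint wi w0.
have int e z k : finite_roots e z -> forall j, simple_coef X (z + eps 0 *~ k) j \is a Num.int.
  move=> ze j; rewrite (simple_coef_shift _ _ _ ze) rpredD ?rpredM ?natr_int ?intr_int //.
  by apply: psum_int; have [] := finite_rootsP ze.
have ncy := finite_rootsN yc.
have neg : - (y + eps 0 *~ m) = - y + eps 0 *~ (- m) by rewrite opprD mulrNz.
have [m0|m0|m0] := ltgtP m 0.
- have [|c' cE] := pos (- y + eps 0 *~ (- m)) (int _ _ _ ncy).
    by apply: simple_coef_pos ncy _ _; [rewrite rpredN|lia].
  by exists c'; right; rewrite -cE -neg opprK.
- have [|c' cE] := pos (y + eps 0 *~ m) (int _ _ _ yc).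
    by apply: simple_coef_pos yc _ _ => //; lia.
  by exists c'; left.
- have cf z j : finite_roots c z -> simple_coef X (z + eps 0 *~ 0) j = psum z j.
    by move=> zc; rewrite (simple_coef_shift _ _ _ zc) mulr0 add0r.
  case: (psum_sign yc) => sg; rewrite m0.
    have [|c' cE] := pos (y + eps 0 *~ 0) (int _ _ _ yc); first by move=> j; rewrite cf.
    by exists c'; left.
  have [|c' cE] := pos (- y + eps 0 *~ 0) (int _ _ _ ncy).
    by move=> j; rewrite cf // psumN oppr_ge0.
  by exists c'; right; rewrite -cE !mulr0z !addr0 opprK.
Qed.

Lemma sum_marks X : (min_rank X <= l)%N ->
  \sum_(i < l.+1) affine_simple K l X i *+ node_mark X i = eps 0.
Proof.
move=> rk; rewrite [RHS](simple_expand _ rk); apply: eq_bigr => i _.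
by rewrite /simple_coef psum_eps0 addr0 unitvE mulr1 scaler_nat.
Qed.

End SimpleRoots.

(** * Forms, subgroups and frames *)
Definition res (m : int) : nat := absz (m %% 4)%Z.

Section Forms.
Variables (K : realType) (F : vectType K) (I : {symmetric F}).
Implicit Types x y z : F.

Lemma formC x y : I x y = I y x.
Proof. by rewrite hermC expr0 mul1r. Qed.
Lemma formDl x y z : I (x + y) z = I x z + I y z. Proof. exact: linearDl. Qed.
Lemma formZl k x y : I (k *: x) y = k * I x y. Proof. exact: linearZl_LR. Qed.
Lemma formDr x y z : I z (x + y) = I z x + I z y. Proof. exact: linearDr. Qed.
Lemma formZr k x y : I y (k *: x) = k * I y x. Proof. by rewrite !(formC y) formZl. Qed.
Lemma formNl x y : I (- x) y = - I x y. Proof. by rewrite -scaleN1r formZl mulN1r. Qed.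
Lemma formNr x y : I y (- x) = - I y x. Proof. by rewrite !(formC y) formNl. Qed.
Lemma form0l x : I 0 x = 0. Proof. exact: linear0l. Qed.
Definition formE := (formDl, formDr, formZl, formZr, formNl, formNr).

Variable R : set F.
Hypothesis rs : root_system I R.

Lemma root_reflection x y : R x -> R y -> R (y - (2 * I x y / I x x) *: x).
Proof.
move=> Rx Ry; have <- : reflection I x y = y - (2 * I x y / I x x) *: x.
  by rewrite /reflection /coroot formZl mulrAC.
by have <- := rs_reflection rs Rx; exists y.
Qed.

Lemma rootN x : R x -> R (- x).
Proof.
move=> Rx; have := root_reflection Rx Rx.
by rewrite mulfK ?(rs_anisotropic rs) // scaler_nat mulr2n opprD addNKr.
Qed.

End Forms.

Lemma zspan_gen (K : realType) (V : vectType K) (R : set V) x : R x -> zspan R x.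
Proof. exact: sub_gen_smallest. Qed.

Lemma zspan_subgroup (K : realType) (V : vectType K) (R : set V) : is_subgroup (zspan R).
Proof.
split=> [A [[A0 _] _] //|x y Rx Ry A AP].
by case: (AP) => [[_ AB] _]; apply: AB; [exact: Rx|exact: Ry].
Qed.

Section Subgroups.
Variables (K : realType) (V : vectType K) (R : set V).
Implicit Types x y : V.
Lemma zspan0 : zspan R 0. Proof. exact: (zspan_subgroup R).1. Qed.
Lemma zspanB x y : zspan R x -> zspan R y -> zspan R (x - y).
Proof. exact: (zspan_subgroup R).2. Qed.
Lemma zspanN x : zspan R x -> zspan R (- x).
Proof. by move=> Rx; rewrite -sub0r; apply: zspanB => //; apply: zspan0. Qed.
Lemma zspanD x y : zspan R x -> zspan R y -> zspan R (x + y).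
Proof. by move=> Rx Ry; rewrite -[y]opprK; apply: zspanB => //; apply: zspanN. Qed.
Lemma zspanMn x n : zspan R x -> zspan R (x *+ n).
Proof.
by move=> Rx; elim: n => [|n IH]; rewrite ?mulr0n ?mulrS; [exact: zspan0|exact: zspanD].
Qed.
Lemma zspanMz x (n : int) : zspan R x -> zspan R (x *~ n).
Proof. by case: n => n Rx; [exact: (zspanMn n Rx)|rewrite NegzE mulrNz;
  exact: (zspanN (zspanMn n.+1 Rx))]. Qed.
Lemma zspan_sum (J : Type) (r : seq J) (P : pred J) (g : J -> V) :
  (forall i, P i -> zspan R (g i)) -> zspan R (\sum_(i <- r | P i) g i).
Proof. by move=> Rg; apply: (big_ind (zspan R)); [exact: zspan0|exact: zspanD|]. Qed.
Lemma zspan_ind (P : V -> Prop) : P 0 -> (forall x y, P x -> P y -> P (x - y)) ->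
  (forall x, R x -> P x) -> forall x, zspan R x -> P x.
Proof. by move=> P0 PB RP x; apply; split. Qed.
End Subgroups.

Lemma zspan1P (K : realType) (V : vectType K) (y x : V) :
  zspan [set y]%classic x <-> exists n : int, x = y *~ n.
Proof.
split=> [|[n ->]]; last by apply: zspanMz; apply: zspan_gen.
move: x; apply: zspan_ind => [|_ _ [n ->] [m ->]|_ ->]; first by exists 0.
  by exists (n - m); rewrite mulrzBr.
by exists 1.
Qed.

Section Frames.
Variables (K : realType) (F : vectType K).
Implicit Types (I : {symmetric F}) (R : set F) (G : {vspace F}).

(** Coordinates adapted to (R, G): f identifies the span of b, eps_1, ..., eps_l
with a complement of G = Ka so that I is a multiple of the standard form, all
roots have integral coordinates, and f sends the short and middle roots of BC_l
to roots. Long roots are left out: 2 eps_i + n a may be a root without 2 eps_i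
being one. *)
Record frame I R G (l : nat) (f : 'Hom('rV[K]_l.+1, F)) (a : F) (kappa : K) : Prop := Frame {
  fr_rank : (0 < l)%N;
  fr_marking : G = <[a]>%VS;
  fr_inj : forall v q, f v + q *: a = 0 -> v = 0 /\ q = 0;
  fr_surj : forall x, exists v q, x = f v + q *: a;
  fr_pos : 0 < kappa;
  fr_form : forall v q w r, I (f v + q *: a) (f w + r *: a) = kappa * dot v w;
  fr_gen : zgenerator a (zspan R `&` [set` G])%classic;
  fr_cover : forall x, R x -> exists c y (m n : int),
    finite_roots c y /\ x = f y + f (unitv K l 0) *~ m + a *~ n;
  fr_short : forall y, finite_roots Sh y -> R (f y);
  fr_middle : forall y, finite_roots Md y -> R (f y);
  fr_b : zspan R (f (unitv K l 0))
}.

Definition point l (f : 'Hom('rV[K]_l.+1, F)) a y (m n : int) : F :=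
  f y + f (unitv K l 0) *~ m + a *~ n.

(** The table T records R in the frame. *)
Definition tabulates R l (f : 'Hom('rV[K]_l.+1, F)) a (T : table) :=
  forall c y m n, finite_roots c y -> R (point f a y m n) <-> T c (res m) (res n).

Section FrameTheory.
Variables (I : {symmetric F}) (R : set F) (G : {vspace F}) (l : nat).
Variables (f : 'Hom('rV[K]_l.+1, F)) (a : F) (kappa : K).
Hypotheses (rs : root_system I R) (fr : frame I R G f a kappa).
Local Notation eps := (unitv K l).
Local Notation pt := (point f a).
Implicit Types (v w y z : 'rV[K]_l.+1) (c d : len) (m n : int).

Lemma pointE y m n : pt y m n = f (y + eps 0 *~ m) + n%:~R *: a.
Proof. by rewrite /point linearD raddfMz scaler_int. Qed.

Lemma point_inj y z m n m' n' : y 0 0 = 0 -> z 0 0 = 0 ->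
  pt y m n = pt z m' n' -> [/\ y = z, m = m' & n = n'].
Proof.
move=> y0 z0 /eqP; rewrite -subr_eq0 !pointE opprD addrACA -linearB -scalerBl => /eqP.
move=> /(fr_inj fr)[yz /eqP]; rewrite subr_eq0 eqr_int => /eqP ->.
have /rowP/(_ ord0) := yz; rewrite -!scaler_int !mxE y0 z0 !add0r !mulr1 => /eqP.
rewrite subr_eq0 eqr_int => /eqP mm; split=> //.
by move/eqP: yz; rewrite mm subr_eq0 => /eqP /addIr.
Qed.

Lemma form_point y m n z m' n' : I (pt y m n) (pt z m' n') = kappa * dot y z.
Proof.
rewrite !pointE (fr_form fr) -!scaler_int !dotE !dotb !dotbr.
by rewrite !mulr0 !addr0.
Qed.

Lemma pointB y z m n m' n' (k : int) :
  pt z m' n' - k%:~R *: pt y m n = pt (z - k%:~R *: y) (m' - k * m) (n' - k * n).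
Proof.
rewrite /point; have -> : f (z - k%:~R *: y) = f z - k%:~R *: f y by rewrite linearB linearZ.
rewrite -!scaler_int !scalerDr !scalerA.
rewrite opprD addrACA; congr (_ + _); last by rewrite -scalerBl intrB intrM.
by rewrite opprD addrACA -scalerBl intrB intrM.
Qed.

(** In a frame a reflection acts on the three coordinates separately: as a
finite reflection on y, and by subtracting k (m, n). *)
Lemma point_reflection c d y m n z m' n' (k : int) :
  finite_roots c y -> finite_roots d z -> cartan y z = k%:~R ->
  R (pt y m n) -> R (pt z m' n') -> R (pt (z - cartan y z *: y) (m' - k * m) (n' - k * n)).
Proof.
move=> yc zd ck Ry Rz; have := root_reflection rs Ry Rz.
rewrite !form_point; have -> : 2 * (kappa * dot y z) / (kappa * dot y y) = cartan y z.
  rewrite /cartan; have [_ ->] := finite_rootsP yc.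
  have := lt0r_neq0 (fr_pos fr); have : (sqlen c)%:R != 0 :> K by rewrite pnatr_eq0; case: (c).
  by move=> c0 k0; field; rewrite ?k0 ?c0.
congr R; rewrite ck; exact: pointB.
Qed.

(** Reflections in f(z), z short or middle, fix m and n, and they suffice to
connect any two finite roots of the same length. *)
Section Orbits.
Let reach y z := forall m n, R (pt y m n) -> R (pt z m n).

Let reach_trans x y z : reach x y -> reach y z -> reach x z.
Proof. by move=> xy yz m n /xy /yz. Qed.

Lemma point0 y : pt y 0 0 = f y.
Proof. by rewrite /point !mulr0z !addr0. Qed.

Let reach_reflection e z c y : e != Lg -> finite_roots e z -> finite_roots c y ->
  reach y (y - cartan z y *: z).
Proof.
move=> eL ze yc m n Ry; have /intrP[k ck] := cartan_int ze yc.
have := point_reflection ze yc ck (_ : R (pt z 0 0)) Ry; rewrite !mulr0 !subr0; apply.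
by rewrite point0; case: (e) eL ze => // _; [exact: fr_short fr _|exact: fr_middle fr _].
Qed.

Lemma short_trichotomy y z : finite_roots Sh y -> finite_roots Sh z ->
  [\/ z = y, z = - y | dot y z = 0].
Proof.
move=> yS zS; have [yi y1] := finite_rootsP yS; have [zi z1] := finite_rootsP zS.
have [||yz|yz] := short_dot yS zi; first by rewrite z1 ltr_nat.
- by constructor 3.
- constructor 1; apply/eqP; rewrite -subr_eq0; apply/eqP/dot0_eq0.
    exact: integral_vecD zi (integral_vecN yi).
  by rewrite !dotE (dotC z y) yz y1 z1 /=; lra.
- constructor 2; apply/eqP; rewrite -addr_eq0; apply/eqP/dot0_eq0.
    exact: integral_vecD zi yi.
  by rewrite !dotE (dotC z y) yz y1 z1 /=; lra.
Qed.

Lemma middleB y z : finite_roots Sh y -> finite_roots Sh z -> dot y z = 0 ->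
  finite_roots Md (y - z).
Proof.
move=> yS zS yz; have [yi y1] := finite_rootsP yS; have [zi z1] := finite_rootsP zS.
apply/middleP; split; first exact: integral_vecD yi (integral_vecN zi).
by rewrite !dotE (dotC z y) yz y1 z1 /=; lra.
Qed.

Lemma middleD y z : finite_roots Sh y -> finite_roots Sh z -> dot y z = 0 ->
  finite_roots Md (y + z).
Proof.
move=> yS zS yz; rewrite -[z]opprK; apply: middleB => //; first exact: finite_rootsN.
by rewrite dotNr yz oppr0.
Qed.

Let reach_short y z : finite_roots Sh y -> finite_roots Sh z ->
  reach y z /\ reach (2 *: y) (2 *: z).
Proof.
move=> yS zS; have [yi y1] := finite_rootsP yS; have [zi z1] := finite_rootsP zS.
have yL : finite_roots Lg (2 *: y) by apply/longP; exists y.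
case: (short_trichotomy yS zS) => [->|->|yz]; first by split=> m n.
  have c2 : cartan y y = 2 by rewrite cartan_short // y1 mulr1.
  have e w : w - (2 : K) *: w = - w by rewrite scaler_nat mulr2n opprD addNKr.
  split; first by have := @reach_reflection Sh y Sh y isT yS yS; rewrite c2 e.
  have := @reach_reflection Sh y Lg (2 *: y) isT yS yL.
  by rewrite cartanZr c2 -scalerA e scalerN.
have mM := middleB yS zS yz.
have c1 : cartan (y - z) y = 1.
  by rewrite cartan_middle // !dotE (dotC z y) yz y1 oppr0 addr0.
split; first by have := @reach_reflection Md (y - z) Sh y isT mM yS; rewrite c1 scale1r subKr.
have := @reach_reflection Md (y - z) Lg (2 *: y) isT mM yL.
by rewrite cartanZr c1 mulr1 -scalerBr subKr.
Qed.

Let reach_half u u' w : finite_roots Sh u -> finite_roots Sh u' -> finite_roots Sh w ->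
  dot u w = 0 -> dot u' w = 0 -> reach (u + w) (u' + w).
Proof.
move=> uS u'S wS uw u'w; have [ui u1] := finite_rootsP uS.
have mM := middleD uS wS uw.
case: (short_trichotomy uS u'S) => [->|->|uu']; first by move=> m n.
  have := @reach_reflection Sh u Md (u + w) isT uS mM.
  rewrite cartan_short // dotDr uw u1 addr0 mulr1 scaler_nat mulr2n.
  by rewrite opprD addrACA subrr add0r (addrC w).
have mm := middleB uS u'S uu'.
have := @reach_reflection Md (u - u') Md (u + w) isT mm mM.
rewrite cartan_middle // !dotE uw u'w u1 (dotC u' u) uu' !oppr0 !addr0 scale1r.
by rewrite opprB (addrC u') addrACA subrr add0r (addrC w).
Qed.

Let reach_middle y z : finite_roots Md y -> finite_roots Md z -> reach y z.
Proof.
have aux u w u' w' : finite_roots Sh u -> finite_roots Sh w -> finite_roots Sh u' ->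
    finite_roots Sh w' -> dot u w = 0 -> dot u' w' = 0 -> dot u' w = 0 -> reach (u + w) (u' + w').
  move=> uS wS u'S w'S uw u'w' u'w; apply: (reach_trans (reach_half uS u'S wS uw u'w)).
  by rewrite !(addrC u'); apply: reach_half; rewrite // dotC.
move=> /middleP[yi y2] /middleP[zi z2].
have [u [w [uS wS uw ->]]] := middle_sum yi y2.
have [u' [w' [u'S w'S u'w' ->]]] := middle_sum zi z2.
have swap : u' = w \/ u' = - w -> reach (u + w) (u' + w').
  move=> u'wE; have u'u : dot u' u = 0.
    by case: u'wE => ->; rewrite ?dotNl dotC uw ?oppr0.
  by rewrite addrC; apply: aux; rewrite // dotC.
case: (short_trichotomy wS u'S) => [u'E|u'E|wu']; [by apply: swap; left|by apply: swap; right|].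
by apply: aux; rewrite // dotC.
Qed.

(** Hence the pairs (m, n) that occur with y depend only on the length of y. *)
Lemma root_orbit c y z m n : finite_roots c y -> finite_roots c z ->
  R (pt y m n) -> R (pt z m n).
Proof.
case: c => [yS zS|yM zM|/longP[y' yS ->] /longP[z' zS ->]].
- exact: (reach_short yS zS).1.
- exact: reach_middle.
- exact: (reach_short yS zS).2.
Qed.
End Orbits.

End FrameTheory.
End Frames.

(** * The table of a frame *)
Section FrameTable.
Variables (K : realType) (F : vectType K) (I : {symmetric F}) (R : set F) (G : {vspace F}) (l :
  nat).
Variables (f : 'Hom('rV[K]_l.+1, F)) (a : F) (kappa : K).
Hypotheses (rs : root_system I R) (fr : frame I R G f a kappa).
Local Notation eps := (unitv K l).
Local Notation pt := (point f a).
Implicit Types (v w y z : 'rV[K]_l.+1) (c d : len) (m n : int).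

Definition fibre c m n := exists2 y, finite_roots c y & R (pt y m n).

Lemma fibreP c y m n : finite_roots c y -> R (pt y m n) <-> fibre c m n.
Proof.
move=> yc; split=> [Ry|[z zc]]; first by exists y.
exact: (root_orbit rs fr zc yc).
Qed.

(** Two roots y, z realizing the Cartan integer k give the reflection; replacing
y by -y gives the other sign. *)
Lemma fibre_closed c d k m n m' n' : (c, d, k) \in reflections l ->
  fibre c m n -> fibre d m' n' ->
  fibre d (m' - k%:Z * m) (n' - k%:Z * n) /\ fibre d (m' + k%:Z * m) (n' + k%:Z * n).
Proof.
move=> cdk cmn dmn; have [y [z [yc zd yz]]] := reflections_witness K (fr_rank fr) cdk.
have Rz := (fibreP m' n' zd).2 dmn.
split.
  have := point_reflection rs fr (k := k%:Z) yc zd yz ((fibreP m n yc).2 cmn) Rz.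
  by apply: (fibreP _ _ (finite_reflection yc zd)).1.
have yz' : cartan (- y) z = (- k%:Z)%:~R.
  by rewrite /cartan !dotE opprK mulrN mulNr -/(cartan y z) yz mulrNz.
have ync := finite_rootsN yc.
have := point_reflection rs fr ync zd yz' ((fibreP m n ync).2 cmn) Rz.
rewrite !mulNr !opprK.
by apply: (fibreP _ _ (finite_reflection ync zd)).1.
Qed.

Lemma fibre_short0 : fibre Sh 0 0.
Proof.
have e1 : finite_roots Sh (eps 1).
  by exists 1%N, false; rewrite expr0 scale1r (fr_rank fr).
by exists (eps 1); rewrite // point0; apply: (fr_short fr).
Qed.

Lemma fibre_middle0 : (2 <= l)%N -> fibre Md 0 0.
Proof.
move=> l2; have m12 : finite_roots Md (eps 1 + eps 2).
  by exists 1%N, 2%N, false, false; rewrite expr0 !scale1r l2.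
by exists (eps 1 + eps 2); rewrite // point0; apply: (fr_middle fr).
Qed.

(** Reflecting a short root over 0 in a middle or long root with Cartan integer
1 produces a short root with the same (m, n). *)
Lemma fibre_short c m n : fibre c m n -> fibre Sh m n.
Proof.
move=> cmn; have closed k q := @fibre_closed c Sh k m n 0 0 q cmn fibre_short0.
case: c cmn closed => // [[y yM _]|_] closed.
  have l2 := middle_rank yM.
  by have [|_] := closed 1%N; [rewrite /reflections l2|rewrite !add0r !mul1r].
by have [|_] := closed 1%N; [rewrite /reflections|rewrite !add0r !mul1r].
Qed.

(** The lattice Q(R) contains f(b) and a, and all roots have classes (m, n) of
short roots. So a subgroup of Z^2 that contains these classes contains (1, 0)
and (0, 1). *)
Lemma fibre_span (P : int -> int -> Prop) : P 0 0 ->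
  (forall m n m' n', P m n -> P m' n' -> P (m - m') (n - n')) ->
  (forall m n, fibre Sh m n -> P m n) -> P 1 0 /\ P 0 1.
Proof.
move=> P0 PB PS.
have span x : zspan R x -> exists v m n, [/\ v 0 0 = 0, x = pt v m n & P m n].
  move: x; apply: zspan_ind.
  - exists 0, 0, 0; split=> //; first by rewrite mxE.
    by rewrite /point linear0 !mulr0z !addr0.
  - move=> _ _ [v [m [n [v0 -> mn]]]] [w [m' [n' [w0 -> mn']]]].
    exists (v - w), (m - m'), (n - n'); split; [by rewrite !mxE v0 w0 subr0| |exact: PB].
    by have := pointB f a w v m' n' m n 1; rewrite !mul1r !scale1r.
  - move=> x Rx; have [c [y [m [n [yc xE]]]]] := fr_cover fr Rx.
    have [[y0 _] _] := finite_rootsP yc.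
    exists y, m, n; split=> //; apply: PS; apply: (@fibre_short c); exists y => //.
    by rewrite /point -xE.
have z0 : (0 : 'rV[K]_l.+1) 0 0 = 0 by rewrite mxE.
have is_span x m n : pt 0 m n = x -> zspan R x -> P m n.
  move=> xE /span[v [m' [n' [v0]]]]; rewrite -xE => e.
  by have [_ -> ->] := point_inj fr z0 v0 e.
have aQ : zspan R a.
  have : zspan [set a]%classic a by apply: zspan_gen.
  by rewrite -(fr_gen fr) => -[].
split; [apply: (is_span _ _ _ _ (fr_b fr))|apply: (is_span _ _ _ _ aQ)].
  by rewrite /point linear0 add0r mulr0z addr0.
by rewrite /point linear0 add0r mulr0z add0r.
Qed.

Definition period c : nat := if c is Lg then 4 else 2.

(** Reflecting in a short root of class (p, q), with the largest Cartan integer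
possible, moves classes by [period c] (p, q), and the classes of short roots
generate Z^2. *)
Lemma fibre_period c m n m' n' :
  fibre c (m + (period c)%:Z * m') (n + (period c)%:Z * n') <-> fibre c m n.
Proof.
pose P p q := forall c m n, fibre c (m + (period c)%:Z * p) (n + (period c)%:Z * q) <-> fibre c m n.
have P0 : P 0 0 by move=> e p q; rewrite !mulr0 !addr0.
have PB p q p' q' : P p q -> P p' q' -> P (p - p') (q - q').
  move=> Ppq Ppq' e i j; rewrite -[X in _ <-> X](Ppq e) -[X in X <-> _](Ppq' e).
  by rewrite !mulrBr -!addrA !addNr !addr0.
have [P1 P2] : P 1 0 /\ P 0 1.
  apply: fibre_span => // p q pq e.
  have step i j : fibre e i j -> fibre e (i - (period e)%:Z * p) (j - (period e)%:Z * q) /\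
                                 fibre e (i + (period e)%:Z * p) (j + (period e)%:Z * q).
    move=> ij; apply: (@fibre_closed Sh) => //.
    case: e ij => // -[y /middle_rank l2 _].
    by rewrite /reflections l2.
  by move=> i j; split=> [/step[]|/step[]//]; rewrite !addrK.
have Pm p q : P p q -> P (- p) (- q) by move=> /(PB _ _ _ _ P0); rewrite !sub0r.
have PD p q p' q' : P p q -> P p' q' -> P (p + p') (q + q').
  by move=> Ppq /Pm Ppq'; have := PB _ _ _ _ Ppq Ppq'; rewrite !opprK.
have mulP p q (k : int) : P p q -> P (k * p) (k * q).
  move=> Ppq; have nat_P (j : nat) : P (j%:Z * p) (j%:Z * q).
    elim: j => [|j IH]; first by rewrite !mul0r.
    by rewrite intS !mulrDl !mul1r; apply: PD.
  by case: k => k; [exact: nat_P|rewrite NegzE !mulNr; apply/Pm/nat_P].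
have := PD _ _ _ _ (mulP _ _ m' P1) (mulP _ _ n' P2).
by rewrite !mulr1 !mulr0 addr0 add0r => /(_ c m n).
Qed.

Lemma fibre_res c m n : fibre c m n <-> fibre c (res m) (res n).
Proof.
have rE p : p = (res p)%:Z + 4 * (p %/ 4)%Z.
  have p0 : 0 <= (p %% 4)%Z by rewrite modz_ge0.
  by rewrite /res gez0_abs // mulrC addrC -divz_eq.
have := fibre_period c (res m) (res n) ((4 %/ period c)%N%:Z * (m %/ 4)%Z) ((4 %/ period c)%N%:Z
  * (n %/ 4)%Z).
have perE k : (period c)%:Z * ((4 %/ period c)%N%:Z * k) = 4 * k by rewrite mulrA -PoszM; case: (c).
by rewrite !perE -!rE.
Qed.

Definition fibre_table : table := fun c (m n : nat) => `[< fibre c m%:Z n%:Z >].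

Lemma frame_tabulates : tabulates R f a fibre_table.
Proof.
move=> c y m n yc; apply: (iff_trans (fibreP m n yc)).
apply: (iff_trans (fibre_res c m n)); exact: (rwP (asboolP _)).
Qed.

Lemma fibre_tableP c (m n : int) : fibre_table c (res m) (res n) <-> fibre c m n.
Proof. by rewrite fibre_res; split=> /asboolP. Qed.

Lemma res_nat (n : nat) : res n%:Z = (n %% 4)%N.
Proof. by rewrite /res modz_nat. Qed.

Lemma fibre_table_mod c (m n : nat) : fibre_table c (m %% 4)%N (n %% 4)%N <-> fibre c m%:Z n%:Z.
Proof. by rewrite -fibre_tableP !res_nat. Qed.

(** The classes of the short roots cannot all have even first or even second
component, since they generate Z^2; by periodicity an odd component can be taken
to be 1. *)
Lemma fibre_parity : (exists m, fibre Sh m 1) /\ (exists n, fibre Sh 1 n).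
Proof.
have odd_fibre (g : int -> int -> int) : (g 0 0 = 0) ->
    (forall m n m' n', g (m - m') (n - n') = g m n - g m' n') ->
    g 1 0 = 1 \/ g 0 1 = 1 -> exists m n q, fibre Sh m n /\ g m n = 1 + 2 * q.
  move=> g0 gB g1; apply: contrapT => no.
  have [P1 P2] : (2 %| g 1 0)%Z /\ (2 %| g 0 1)%Z.
    apply: (@fibre_span (fun m n => 2 %| g m n)%Z) => [|m n m' n' gm gn|m n mn].
    - by rewrite g0.
    - by rewrite gB rpredB.
    - apply/negPn/negP => odd; apply: no; exists m, n, (g m n %/ 2)%Z; split=> //; lia.
  by case: g1 => g1; rewrite g1 in P1 P2.
split.
- have [m [n [q [mn nE]]]] := odd_fibre (fun _ n => n) erefl (fun _ _ _ _ => erefl) (or_intror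
  erefl).
  by exists m; rewrite -(fibre_period _ _ _ 0 q) mulr0 addr0 -nE.
- have [m [n [q [mn mE]]]] := odd_fibre (fun m _ => m) erefl (fun _ _ _ _ => erefl) (or_introl
  erefl).
  by exists n; rewrite -(fibre_period _ _ _ q 0) mulr0 addr0 -mE.
Qed.

End FrameTable.

(** * Adapted frames and their parameters *)

(** There are no middle roots in rank 1. *)
Definition relevant (l : nat) (c : len) : bool := (c != Md) || (2 <= l)%N.

(** A nonempty subset of Z/4 that is stable under the reflections of an affine
A_1 and under -1 is a progression symmetric about 0. *)
Lemma fib_classify (Q : nat -> bool) : (exists n, (n < 4)%N /\ Q n) ->
  (forall n, (n < 4)%N -> Q n -> Q ((4 - n) %% 4)%N) ->
  (forall m n, (m < 4)%N -> (n < 4)%N -> Q m -> Q n -> Q ((n + 2 * m) %% 4)%N) ->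
  exists2 u, u \in fibs & forall n, (n < 4)%N -> Q n = fib u n.
Proof.
move=> Qn QN QD.
have e1 := QN 1%N isT; have e3 := QN 3%N isT.
have d02 := QD 2%N 0%N isT isT; have d10 := QD 1%N 0%N isT isT; have d01 := QD 1%N 1%N isT isT.
have d12 := QD 1%N 2%N isT isT.
have forall4 (P : nat -> Prop) : P 0%N -> P 1%N -> P 2%N -> P 3%N -> forall n, (n < 4)%N -> P n.
  by move=> p0 p1 p2 p3 [|[|[|[|]]]].
have {Qn}: [|| Q 0, Q 1, Q 2 | Q 3]%N.
  by case: Qn => n [n4]; move: n n4; apply: forall4 => ->; rewrite ?orbT.
case q0 : (Q 0%N) d02 d10 d01 d12 e1 e3 => d02 d10 d01 d12 e1 e3;
  case q1 : (Q 1%N) d02 d10 d01 d12 e1 e3 => d02 d10 d01 d12 e1 e3;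
case q2 : (Q 2%N) d02 d10 d01 d12 e1 e3 => d02 d10 d01 d12 e1 e3;
case q3 : (Q 3%N) d02 d10 d01 d12 e1 e3 => d02 d10 d01 d12 e1 e3 //= _;
 rewrite /= ?modnn ?q0 ?q1 ?q2 ?q3 in d02 d10 d01 d12 e1 e3;
   try by [move: (d10 isT isT)|move: (e1 isT)|move: (e3 isT)|move: (d12 isT isT)].
- by exists (0, 1)%N => //; apply: forall4; rewrite ?q0 ?q1 ?q2 ?q3.
- by exists (0, 2)%N => //; apply: forall4; rewrite ?q0 ?q1 ?q2 ?q3.
- by exists (0, 4)%N => //; apply: forall4; rewrite ?q0 ?q1 ?q2 ?q3.
- by exists (1, 2)%N => //; apply: forall4; rewrite ?q0 ?q1 ?q2 ?q3.
- by exists (2, 4)%N => //; apply: forall4; rewrite ?q0 ?q1 ?q2 ?q3.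
Qed.

(** The case of a set that contains 0 and has period 2. *)
Lemma fib2_classify (Q : nat -> bool) : Q 0%N ->
  (forall n, Q ((n + 2) %% 4)%N = Q (n %% 4)%N) ->
  forall n, (n < 4)%N -> Q n = ((if Q 1%N then 1 else 2) %| n)%N.
Proof.
move=> q0 Q2 [|[|[|[|//]]]] _; rewrite ?q0 ?dvdn0 //.
- by case: (Q 1%N).
- by have := Q2 0%N; rewrite /= => ->; rewrite q0; case: (Q 1%N).
- by have := Q2 1%N; rewrite /= => ->; case: (Q 1%N).
Qed.

Section Adapted.
Variables (K : realType) (F : vectType K) (I : {symmetric F}) (R : set F) (G : {vspace F}) (l :
  nat).
Variables (f : 'Hom('rV[K]_l.+1, F)) (a : F) (kappa : K) (X : affine_type).
Local Notation fibre := (fibre R f a).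

(** The quotient R/G is the standard affine root system of type X, the lifts of
the standard simple roots are roots, and the third condition of a paired simple
system holds at the short simple roots, i.e. over eps_l and, for C^v C_l, over b
- eps_1. *)
Record adapted : Prop := Adapted {
  ad_rank : (min_rank X <= l)%N;
  ad_proj : forall c (m : int), relevant l c -> (exists n, fibre c m n) <-> (step X c %| m)%Z;
  ad_simple : fibre (kind_len X N0) 1 0;
  ad_good : forall m : int, m = 0 \/ X = CvC /\ m = 1 -> fibre Lg (2 * m) 0 ->
    forall n, fibre Sh m n -> fibre Lg (2 * m) (2 * n)
}.

Hypotheses (rs : root_system I R) (fr : frame I R G f a kappa) (ad : adapted).
Let T := fibre_table R f a.
Implicit Types (m n : nat).

Let TP c m n : T c m n <-> fibre c m%:Z n%:Z.
Proof. by split=> /asboolP. Qed.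

Let Tmod c m n : T c (m %% 4)%N (n %% 4)%N <-> fibre c m%:Z n%:Z.
Proof. exact: (fibre_table_mod rs fr). Qed.

Let l0 : (0 < l)%N := fr_rank fr.

Lemma reflections_rel c d k : (c, d, k) \in reflections 2 -> (relevant l c) -> relevant l d ->
  (c, d, k) \in reflections l.
Proof.
rewrite /relevant; case: (leqP 2 l) => l2.
  have -> : reflections l = reflections 2 ++ (if (3 <= l)%N then [:: (Md, Md, 1%N)] else [::]).
    by rewrite /reflections l2.
  by move=> h _ _; rewrite mem_cat h.
by case: l l0 l2 => [|[|]] // _ _; case: c d => [] [] //; rewrite !inE !xpair_eqE.
Qed.

Let Tclosed c d k m n m' n' : (c, d, k) \in reflections 2 -> T c m n -> T d m' n' ->
  T d ((m' + k * m) %% 4)%N ((n' + k * n) %% 4)%N.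
Proof.
move=> cdk /TP cmn /TP dmn; apply/Tmod; rewrite !PoszD !PoszM.
have rel e (i j : int) : fibre e i j -> relevant l e.
  by move=> [y ye _]; case: e ye => // /middle_rank; rewrite /relevant => ->.
have cdk' := reflections_rel cdk (rel _ _ _ cmn) (rel _ _ _ dmn).
by have [_] := fibre_closed rs fr cdk' cmn dmn.
Qed.

Let TN c m n : (m < 4)%N -> T c m n -> T c ((4 - m) %% 4)%N ((4 * n - n) %% 4)%N.
Proof.
move=> m4 /TP[y yc Ry]; apply/Tmod.
have := fibre_period rs fr c (- m%:Z) (- n%:Z) ((4 %/ period c)%N%:Z) ((4 %/ period c)%N%:Z * n%:Z).
have perE k : (period c)%:Z * ((4 %/ period c)%N%:Z * k) = 4 * k by rewrite mulrA -PoszM; case: (c).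
have := perE 1; rewrite mulr1 => ->; rewrite perE mulr1 => e.
have -> : (4 - m)%N%:Z = - m%:Z + 4 by rewrite -subzn; [rewrite addrC|exact: ltnW].
have -> : (4 * n - n)%N%:Z = - n%:Z + 4 * n%:Z by rewrite -subzn ?PoszM 1?addrC // leq_pmull.
apply/e; exists (- y); first exact: finite_rootsN.
have := rootN rs Ry; rewrite /point linearN !opprD !mulrNz.
by [].
Qed.

Let Tperiod c m n i j : c != Lg -> T c ((m + 2 * i) %% 4)%N ((n + 2 * j) %% 4)%N = T c (m %% 4)%N
  (n %% 4)%N.
Proof.
move=> cL; have cp : period c = 2%N by case: c cL.
apply/idP/idP => /Tmod h; apply/Tmod; move: h; have := fibre_period rs fr c m n i j;
  by rewrite cp -!PoszM -!PoszD => -[h1 h2] h; first [exact: (h1 h)|exact: (h2 h)].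
Qed.

Let T0 : T Sh 0 0 /\ T Sh 1 0.
Proof.
split; apply/TP; first exact: (fibre_short0 fr).
exact: (fibre_short rs fr (ad_simple ad)).
Qed.

Let forall4 (P : nat -> Prop) : P 0%N -> P 1%N -> P 2%N -> P 3%N -> forall n, (n < 4)%N -> P n.
Proof. by move=> p0 p1 p2 p3 [|[|[|[|]]]]. Qed.

Let Tfib2 c m n : c != Lg -> T c m 0 -> (m < 4)%N -> (n < 4)%N ->
  T c m n = ((if T c m 1 then 1 else 2) %| n)%N.
Proof.
move=> cL cm m4; move: n; apply: fib2_classify => // n.
by have := Tperiod m n 0 1 cL; rewrite addn0 (modn_small m4).
Qed.

Let Tshort m n : (m < 4)%N -> (n < 4)%N ->
  T Sh m n = ((if odd m then if T Sh 1 1 then 1 else 2 else if T Sh 0 1 then 1 else 2) %| n)%N.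
Proof.
move=> m4 n4; have [t0 t1] := T0.
have e i : T Sh i.+2 n = T Sh i n \/ (1 < i)%N.
  case: i => [|[|]]; [left|left|by right].
    by have := @Tperiod Sh 0 n 1 0 isT; rewrite addn0 (modn_small n4).
  by have := @Tperiod Sh 1 n 1 0 isT; rewrite addn0 (modn_small n4).
move: m m4; apply: forall4 => /=; [by rewrite Tfib2|by rewrite Tfib2| |].
- by case: (e 0%N) => // ->; rewrite Tfib2.
- by case: (e 1%N) => // ->; rewrite Tfib2.
Qed.

Let Tmiddle m n : (2 <= l)%N -> (m < 4)%N -> (n < 4)%N ->
  T Md m n = match X with
    | BCC | BBv => ((if odd m then if T Md 1 1 then 1 else 2 else if T Md 0 1 then 1 else 2) %| n)%N
    | _ => ~~ odd m && ((if T Md 0 1 then 1 else 2) %| n)%N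
    end.
Proof.
move=> l2 m4 n4; have t0 : T Md 0 0 by apply/TP; exact: (fibre_middle0 fr).
have e i : T Md i.+2 n = T Md i n \/ (1 < i)%N.
  case: i => [|[|]]; [left|left|by right].
    by have := @Tperiod Md 0 n 1 0 isT; rewrite addn0 (modn_small n4).
  by have := @Tperiod Md 1 n 1 0 isT; rewrite addn0 (modn_small n4).
have rM : relevant l Md by rewrite /relevant l2.
have [t1|[n1 t1]] : step X Md = 1%N /\ T Md 1 0 \/ step X Md = 2%N /\ (forall k, T Md 1 k = false).
  case XE : X (ad_simple ad) => /= simp; [left|right|left|right]; split=> //.
  - by have [t _] := T0; apply: (@Tclosed Lg Md 1 1 0 0 0 isT) => //; apply/TP.
  - move=> k; apply/negP => /TP h; have := (ad_proj ad 1 rM).1 (ex_intro _ _ h).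
    by rewrite XE.
  - by apply/TP.
  - move=> k; apply/negP => /TP h; have := (ad_proj ad 1 rM).1 (ex_intro _ _ h).
    by rewrite XE.
- have [st t] := t1; have -> : forall A B : bool, match X with BCC | BBv => A | _ => B end = A.
    by move=> A B; case: (X) st.
  move: m m4; apply: forall4 => /=; [by rewrite Tfib2|by rewrite Tfib2| |].
  + by case: (e 0%N) => // ->; rewrite Tfib2.
  + by case: (e 1%N) => // ->; rewrite Tfib2.
- have -> : forall A B : bool, match X with BCC | BBv => A | _ => B end = B.
    by move=> A B; case: (X) n1.
  move: m m4; apply: forall4 => /=; [by rewrite Tfib2|by rewrite t1| |].
  + by case: (e 0%N) => // ->; rewrite Tfib2.
  + by case: (e 1%N) => // ->; rewrite t1.
Qed.

Let Tlong_shift m n : X = BCC \/ X = BBv -> (m < 4)%N -> (n < 4)%N ->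
  T Lg ((m + 2) %% 4)%N n = T Lg m n.
Proof.
move=> XB m4 n4; have sh i : T Lg i n -> T Lg ((i + 2) %% 4)%N n.
  have := ad_simple ad; case: XB => -> /= simp.
    have /TP t : fibre Lg 1%:Z 0%:Z by [].
    by have := @Tclosed Lg Lg 2 1 0 i n isT t; rewrite muln0 addn0 (modn_small n4).
  have /TP t : fibre Md 1%:Z 0%:Z by [].
  by have := @Tclosed Md Lg 2 1 0 i n isT t; rewrite muln0 addn0 (modn_small n4).
apply/idP/idP => [/sh|/sh //].
by rewrite modnDml -addnA modnDr modn_small.
Qed.

Let Tlong m : (step X Lg %| m)%N -> (m <= 2)%N ->
  exists2 u, u \in fibs & forall n, (n < 4)%N -> T Lg m n = fib u n.
Proof.
move=> sm m2; have m4 : (m < 4)%N by lia.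
have m3 : (3 * m %% 4)%N = m \/ X = BCC /\ m = 1%N.
  case: m sm m2 {m4} => [|[|[|]]] //; [by left| |by left].
  by case: (X) => //; right.
have m3T n : (n < 4)%N -> T Lg (3 * m %% 4)%N n -> T Lg m n.
  move=> n4; case: m3 => [->//|[XB m1]]; rewrite m1.
  by rewrite -(@Tlong_shift 1 n) //; left.
apply: fib_classify.
- have [n mn] : exists n : int, fibre Lg m n by apply: (ad_proj ad m%:Z (isT : relevant l Lg)).2;
  exact: sm.
  exists (res n); split; first by rewrite /res; lia.
  by have := (fibre_tableP rs fr Lg m n).2 mn; rewrite res_nat modn_small.
- move=> n n4 t; apply: m3T; first by rewrite ltn_mod.
  have := TN m4 t; have -> : ((4 - m) %% 4 = 3 * m %% 4)%N by lia.
  by have -> : ((4 * n - n) %% 4 = (4 - n) %% 4)%N by lia.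
- move=> i j i4 j4 ti tj; apply: m3T; first by rewrite ltn_mod.
  by have := @Tclosed Lg Lg 2 m i m j isT ti tj; rewrite -mulSn.
Qed.

Let box_memP s0 s1 m0 m1 u0 u1 : s0 \in [:: 1; 2]%N -> s1 \in [:: 1;
  2]%N -> u0 \in fibs -> u1 \in fibs ->
  (if l == 1%N then m0 = s0 /\ m1 = s0 else [/\ m0 \in [:: 1; 2]%N, m1 \in [:: 1; 2]%N &
      if X is BCC then True else if X is BBv then True else m1 = m0]) ->
  (match X with BCC => is_true (fib u1 0) | CvC => True | _ => u1 = u0 end) ->
  Params s0 s1 m0 m1 u0 u1 \in box X l.
Proof.
move=> s0b s1b u0b u1b mb ub; apply/flatten_mapP; exists (s0, s1).
  by move: s0b s1b; rewrite !inE => /orP[] /eqP -> /orP[] /eqP ->.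
apply/allpairsP; exists ((m0, m1), (u0, u1)); split=> //=; rewrite /middle_box /long_box.
  case: ifP mb => _; first by case=> -> ->; rewrite inE.
  case=> m0b m1b mm.
  move: m0b m1b mm; rewrite !inE => /orP[] /eqP -> /orP[] /eqP ->; by case: (X).
have uu : (u0, u0) \in [seq (u, u) | u <- fibs] by apply/mapP; exists u0.
case: (X) ub => [u10|->|->|_] //.
- apply/allpairsP; exists (u0, u1); split=> //.
  by move: u1b u10; rewrite !inE; do 4 (case/orP; first by move/eqP => ->); move/eqP => ->.
- by apply/allpairsP; exists (u0, u1); split.
Qed.

(** Progressions of short and middle roots contain 0 and have period 2, those of
long roots are symmetric. Periodicity and translations by roots over b reduce m
to 0 or 1, for the long roots of C^v C_l to 0 or 2. *)
Lemma adapted_params : exists2 p, p \in box X l &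
  forall c m n, relevant l c -> (m < 4)%N -> (n < 4)%N -> T c m n = table_of X p c m n.
Proof.
have in12 (t : bool) : (if t then 1 else 2)%N \in [:: 1; 2]%N by case: t.
have s0 := in12 (T Sh 0 1); have s1 := in12 (T Sh 1 1).
have [|//|u0 u0f u0E] := @Tlong 0; first by rewrite dvdn0.
pose m' k := (if T Md k 1 then 1 else 2)%N.
pose m0 := if l == 1%N then (if T Sh 0 1 then 1 else 2)%N else m' 0%N.
pose m1 := if l == 1%N then (if T Sh 0 1 then 1 else 2)%N else
  match X with BCC | BBv => m' 1%N | _ => m' 0%N end.
have mE : if l == 1%N then m0 = (if T Sh 0 1 then 1 else 2)%N /\ m1 = (if T Sh 0 1 then 1 else 2)%N
   else [/\ m0 \in [:: 1; 2]%N, m1 \in [:: 1; 2]%N &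
      if X is BCC then True else if X is BBv then True else m1 = m0].
  by rewrite /m0 /m1 /m'; case: (l == 1%N) => //; case: (X); split=> //; exact: in12.
have [u1 [u1f u1E u1L]] : exists u1, [/\ u1 \in fibs,
    match X with BCC => is_true (fib u1 0) | CvC => True | _ => u1 = u0 end &
    forall m n, (m < 4)%N -> (n < 4)%N -> T Lg m n = match X with
          | BCC => fib (if odd m then u1 else u0) n
          | BBv => ~~ odd m && fib u0 n
          | CvC => ~~ odd m && fib (if odd m./2 then u1 else u0) n
          | CvBC => (4 %| m)%N && fib u0 n
          end].
  have none m n : ~~ (step X Lg %| m)%N -> T Lg m n = false.
    move=> sm; apply/negP => /TP h; case/negP: sm.
    exact: ((@ad_proj ad Lg m isT).1 (ex_intro _ _ h)).
  case XE : X none (ad_simple ad) => /= none simp.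
  - have [||u1 u1f u1E] := @Tlong 1; [by rewrite XE|by []|].
    have u10 : fib u1 0 by rewrite -u1E //; apply/TP.
    exists u1; split=> //.
    have sh := @Tlong_shift _ _ (or_introl XE).
    move=> m n m4 n4; move: m m4; apply: forall4; rewrite -?u0E -?u1E //.
      by rewrite -(sh 0%N).
    by rewrite -(sh 1%N).
  - exists u0; split=> // m n m4 n4; move: m m4; apply: forall4;
      [by rewrite u0E|by rewrite none|by rewrite none|by rewrite none].
  - exists u0; split=> // m n m4 n4.
    have sh := @Tlong_shift _ _ (or_intror XE).
    move: m m4; apply: forall4;
      [by rewrite u0E|by rewrite none| |by rewrite none].
    by rewrite /= -u0E // -(sh 0%N).
  - have [||u1 u1f u1E] := @Tlong 2; [by rewrite XE|by []|].
    exists u1; split=> // m n m4 n4; move: m m4; apply: forall4;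
      [by rewrite u0E|by rewrite none|by rewrite u1E|by rewrite none].
exists (Params (if T Sh 0 1 then 1 else 2) (if T Sh 1 1 then 1 else 2) m0 m1 u0 u1)%N.
  exact: box_memP s0 s1 u0f u1f mE u1E.
move=> [] m n rc m4 n4; rewrite /table_of /pS0 /pS1 /pM0 /pM1 /pL0 /pL1 /=.
- by rewrite Tshort.
- have l2 : (2 <= l)%N by move: rc; rewrite /relevant.
  rewrite Tmiddle // /m0 /m1 (_ : (l == 1%N) = false); last by lia.
  by case: (X).
- by rewrite u1L.
Qed.

End Adapted.

(** * Changes of frame *)
Lemma hom_of_linear (K : realType) (U V : vectType K) (g : U -> V) :
  linear g -> exists h : 'Hom(U, V), h =1 g.
Proof.
move=> lin; pose m := GRing.isLinear.Build _ _ _ _ g lin.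
pose gl : {linear U -> V} := HB.pack g m.
by exists (linfun gl) => v; rewrite lfunE.
Qed.

Section ChangeFrame.
Variables (K : realType) (F : vectType K) (I : {symmetric F}) (R : set F) (G : {vspace F}) (l :
  nat).
Variables (f : 'Hom('rV[K]_l.+1, F)) (a : F) (kappa : K).
Hypotheses (fr : frame I R G f a kappa).
Local Notation eps := (unitv K l).
Implicit Types (y v u : 'rV[K]_l.+1).

Lemma frame_a_span : zspan R a.
Proof.
have : zspan [set a]%classic a by apply: zspan_gen.
by rewrite -(fr_gen fr) => -[].
Qed.

(** The new frame has e_i + u_i b in place of e_i and b + r a in place of b. The
roots that the new f must send short and middle roots to have to be roots
already; everything else is a change of coordinates. *)
Lemma change_frame u (r : int) : integral_vec u ->
  (forall c y (m : int), c != Lg -> finite_roots c y -> dot y u = m%:~R -> R (point f a y m 0)) ->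
  exists f' : 'Hom('rV[K]_l.+1, F), frame I R G f' a kappa /\
    forall y (k m n : int), y 0 0 = 0 -> dot y u = k%:~R ->
      point f' a y m n = point f a y (m + k) (n + r * m).
Proof.
move=> ui Ru; have lin : linear (fun v => f v + dot v u *: f (eps 0) + (r%:~R * v 0 0) *: a).
  move=> k v w; have -> : f (k *: v + w) = k *: f v + f w by rewrite linearP.
  rewrite dotDl dotZl !mxE mulrDr (mulrCA _ k) !scalerDl -!scalerA.
  by rewrite !scalerDr [LHS](AC (2*2*2) ((1*3*5)*(2*4*6))).
have [f' f'E] := hom_of_linear lin.
have f'E2 v : f' v = f (v + dot v u *: eps 0) + (r%:~R * v 0 0) *: a.
  by rewrite f'E (linearD f) (linearZ _ (eps 0)) /=.
have ptE y (k m n : int) : y 0 0 = 0 -> dot y u = k%:~R ->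
    point f' a y m n = point f a y (m + k) (n + r * m).
  move=> y0 yu; rewrite /point !f'E y0 yu dotb mulr0 !scale0r !addr0 unitvE mulr1.
  rewrite mulrzDl mulrzDr -!scaler_int !scalerA [m%:~R * _]mulrC -intrM !scaler_int.
  rewrite -!addrA; congr (_ + _); rewrite addrCA; congr (_ + _); congr (_ + _).
  by rewrite addrC -!mulrzDr.
have int_dot y : finite_roots Sh y \/ finite_roots Md y \/ finite_roots Lg y -> exists k : int,
  dot y u = k%:~R.
  have i c : finite_roots c y -> exists k : int, dot y u = k%:~R.
    by move=> /finite_rootsP[yi _]; apply/intrP/integral_dot.
  by case=> [|[]]; apply: i.
exists f'; split => //; split.
- exact: fr_rank fr.
- exact: fr_marking fr.
- move=> v q; rewrite f'E2 -addrA -scalerDl => /(fr_inj fr)[v0 q0].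
  have : dot (v + dot v u *: eps 0) u = 0 by rewrite v0 /dot big1 // => i _; rewrite mxE mul0r.
  rewrite !dotE dotb mulr0 addr0 => vu.
  move: v0; rewrite vu scale0r addr0 => v0; split=> //.
  by move: q0; rewrite v0 mxE mulr0 add0r.
- move=> x; have [w [q ->]] := fr_surj fr x.
  exists (w - dot w u *: eps 0), (q - r%:~R * (w - dot w u *: eps 0) 0 0).
  rewrite f'E2 !dotE dotb mulr0 oppr0 addr0 subrK -addrA -scalerDl.
  by rewrite addrCA subrr addr0.
- exact: fr_pos fr.
- move=> v q w s; rewrite !f'E2 -!addrA -!scalerDl (fr_form fr) !dotE !dotb !dotbr.
  by rewrite !mulr0 !addr0.
- exact: fr_gen fr.
- move=> x Rx; have [c [y [m [n [yc xE]]]]] := fr_cover fr Rx.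
  have [k yk] : exists k : int, dot y u = k%:~R by apply: int_dot; case: (c) yc; auto.
  have [[y0 _] _] := finite_rootsP yc.
  exists c, y, (m - k), (n - r * (m - k)); split=> //.
  by rewrite -[RHS]/(point f' a _ _ _) (ptE _ _ _ _ y0 yk) !subrK.
- move=> y yS; have [k yk] := int_dot y (or_introl yS).
  have [[y0 _] _] := finite_rootsP yS.
  have := Ru Sh y k isT yS yk.
  have := ptE y k 0 0 y0 yk; rewrite mulr0 !add0r => <-.
  by rewrite /point !mulr0z !addr0.
- move=> y yM; have [k yk] := int_dot y (or_intror (or_introl yM)).
  have [[y0 _] _] := finite_rootsP yM.
  have := Ru Md y k isT yM yk.
  have := ptE y k 0 0 y0 yk; rewrite mulr0 !add0r => <-.
  by rewrite /point !mulr0z !addr0.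
- rewrite f'E dotb scale0r addr0 unitvE mulr1; apply: zspanD; first exact: fr_b fr.
  by rewrite scaler_int; apply: zspanMz; exact: frame_a_span.
Qed.
End ChangeFrame.

Section Adapt.
Variables (K : realType) (F : vectType K) (I : {symmetric F}) (R : set F) (G : {vspace F}) (l :
  nat).
Variables (a : F) (kappa : K).
Hypothesis rs : root_system I R.
Implicit Types (f : 'Hom('rV[K]_l.+1, F)).

Lemma fibre_relevant f c (m n : int) : fibre R f a c m n -> relevant l c.
Proof. by case: c => // -[y /middle_rank]; rewrite /relevant => ->. Qed.

Lemma shift_b f (r : int) : frame I R G f a kappa ->
  exists f' : 'Hom('rV[K]_l.+1, F), frame I R G f' a kappa /\
    forall c m n, fibre R f' a c m n <-> fibre R f a c m (n + r * m).
Proof.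
move=> fr; have i0 : integral_vec (0 : 'rV[K]_l.+1) by split=> [|j]; rewrite mxE.
have dot0 (y : 'rV[K]_l.+1) : dot y 0 = 0 by rewrite dotC -(scale0r y) dotZl mul0r.
have [|f' [fr' f'E]] := change_frame fr r i0.
  move=> c y m cL yc; rewrite dot0 => /esym/eqP; rewrite intr_eq0 => /eqP ->.
  rewrite point0; case: c cL yc => // _; [exact: (fr_short fr)|exact: (fr_middle fr)].
exists f'; split=> // c m n; split=> -[y yc Ry]; exists y => //;
  have [[y0 _] _] := finite_rootsP yc;
 by have := f'E y 0 m n y0; rewrite dot0 addr0 => e; rewrite -?e // e // in Ry *.
Qed.

(** The affine type is determined by which multiples of b carry long or middle
roots: long roots over b give BCC_l; otherwise long roots over 2b, with or
without middle roots over b, give BB_l^v or C^v C_l; in the remaining case C^v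
BC_l. Then b is shifted by a multiple of a to make the lift of beta_0 a root,
for C^v C_l one without a double if possible. *)
Lemma adapt f : frame I R G f a kappa -> (exists n, fibre R f a Lg 0 n) ->
  (fibre R f a Lg 0 0 -> forall n, fibre R f a Sh 0 n -> fibre R f a Lg 0 (2 * n)) ->
  exists X (f' : 'Hom('rV[K]_l.+1, F)), frame I R G f' a kappa /\ adapted R f' a X.
Proof.
move=> fr L0 good0.
pose P c m := exists n, fibre R f a c m n.
have PD c d k m m' : (c, d, k) \in reflections 2 -> P c m -> P d m' ->
    P d (m' - k%:Z * m) /\ P d (m' + k%:Z * m).
  move=> cdk [n cn] [n' cn'].
  have h := reflections_rel fr cdk (fibre_relevant cn) (fibre_relevant cn').
  have [h1 h2] := fibre_closed rs fr h cn cn'.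
  by split; [exists (n' - k%:Z * n)|exists (n' + k%:Z * n)].
have Pres c m : P c m <-> P c (res m).
  split=> -[n cn].
    by exists (res n); apply: (fibre_res rs fr c m n).1.
  exists n; apply: (fibre_res rs fr c m n).2.
  have := (fibre_res rs fr c (res m) n).1 cn.
  by rewrite res_nat modn_small //; rewrite /res; lia.
have Ppos c m : P c m -> P Sh m.
  by move=> [n /(fibre_short rs fr) h]; exists n.
have S0 : P Sh 0 by exists 0; apply: (fibre_short0 fr).
have M0 : (2 <= l)%N -> P Md 0 by move=> l2; exists 0; apply: (fibre_middle0 fr).
have S1 : P Sh 1 by have [_] := fibre_parity rs fr.
have Sall m : P Sh m.
  apply/Pres; have : (res m < 4)%N by rewrite /res; lia.
  have [_ S2] := @PD Sh Sh 2%N 1 0 isT S1 S0; have [_ S3] := @PD Sh Sh 2%N 1 1 isT S1 S1.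
  by case: (res m) => [|[|[|[|]]]].
have Mrel c m : P c m -> relevant l c by move=> [n /fibre_relevant].
have forall4 (Q : nat -> Prop) : Q 0%N -> Q 1%N -> Q 2%N -> Q 3%N -> forall n, (n < 4)%N -> Q n.
  by move=> p0 p1 p2 p3 [|[|[|[|]]]].
(* P c m: some root of length c lies over m b; the type is read off from P. *)
have proj X : (min_rank X <= l)%N -> (forall c (m : nat),
  relevant l c -> c != Sh -> (m < 4)%N -> P c m <-> (step X c %| m)%N) ->
    forall f' : 'Hom('rV[K]_l.+1, F), (forall c m, (exists n, fibre R f' a c m n) <-> P c m) ->
    forall c (m : int), relevant l c -> (exists n, fibre R f' a c m n) <-> (step X c %| m)%Z.
  move=> lX PX f' f'E c m rc; rewrite f'E Pres.
  have -> : (step X c %| m)%Z <-> (step X c %| res m)%N.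
    by rewrite /res; case: (c) (X) => [] [] /=; split; lia.
  case: eqVneq (PX c) => [->|cS] PXc; first by rewrite dvd1n; split.
  by apply: PXc => //; rewrite /res; lia.
have finish X (r : int) : (min_rank X <= l)%N ->
    (forall c (m : nat), relevant l c -> c != Sh -> (m < 4)%N -> P c m <-> (step X c %| m)%N) ->
    fibre R f a (kind_len X N0) 1 r ->
    (X = CvC -> fibre R f a Lg 2 (2 * r) -> forall n,
      fibre R f a Sh 1 (n + r) -> fibre R f a Lg 2 (2 * n + 2 * r)) ->
    exists X (f' : 'Hom('rV[K]_l.+1, F)), frame I R G f' a kappa /\ adapted R f' a X.
  move=> lX PX simp good1; have [f' [fr' f'E]] := shift_b r fr.
  exists X, f'; split=> //; split=> //.
  - apply: proj => // c m; split=> -[n].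
      by rewrite f'E => h; exists (n + r * m).
    by exists (n - r * m); rewrite f'E subrK.
  - by rewrite f'E mulr1 add0r.
  - move=> m [->|[XC ->]].
      rewrite !mulr0 !f'E mulr0 addr0 => /good0 h n.
      by rewrite !f'E !mulr0 !addr0 => /h.
    rewrite mulr1 !f'E add0r mulrC => /(good1 XC) h n.
    by rewrite !f'E mulr1 (mulrC r) => /h.
have PLN m : P Lg m -> P Lg (- m).
  by move=> Lm; have [] := @PD Lg Lg 2%N m m isT Lm Lm; rewrite [m - _](_ : _ = - m) //; ring.
have L4 : P Lg 4 -> P Lg 0 by move=> /Pres.
have L13 : P Lg 3 <-> P Lg 1.
  by split=> /PLN /Pres.
have [[n1 L1]|nL1] := EM (P Lg 1).
  have PL1 : P Lg 1 by exists n1.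
  have L2 : P Lg 2 by have [_] := @PD Lg Lg 2%N 1 0 isT PL1 L0.
  apply: (finish BCC n1) => // [|c m rc cS m4].
    by rewrite /=; exact: fr_rank fr.
  split=> // _; case: c rc cS => // rc _; last first.
    by move: m m4; apply: forall4 => //; apply/L13.
  have {}M0 := M0 rc.
  have st k : P Md k -> P Md (k + 1) by move=> Mk; have [_] := @PD Lg Md 1%N 1 k isT PL1 Mk.
  by elim: m {m4} => // k /st; rewrite addrC -intS.
have no3 : ~ P Lg 3 by move/L13.
have [L2|nL2] := EM (P Lg 2).
  have [[n1 M1]|nM1] := EM (P Md 1).
    have PM1 : P Md 1 by exists n1.
    have rM := Mrel _ _ PM1.
    apply: (finish BBv n1) => // c m rc cS m4.
    case: c rc cS => // rc _; last first.
      by move: m m4; apply: forall4; split.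
    split=> // _; have {}M0 := M0 rc.
    have [_ M3] := @PD Sh Md 2%N 1 1 isT S1 PM1; have [_ M2] := @PD Sh Md 2%N 1 0 isT S1 M0.
    by move: m m4; apply: forall4.
  have [r [r1 rg]] : exists r, fibre R f a Sh 1 r /\
      (fibre R f a Lg 2 (2 * r) -> forall n, fibre R f a Sh 1 (n + r) ->
        fibre R f a Lg 2 (2 * n + 2 * r)).
    have [[r [r1 rn]]|no] := EM (exists r, fibre R f a Sh 1 r /\ ~ fibre R f a Lg 2 (2 * r)).
      by exists r; split=> // /rn.
    have [r r1] := S1; exists r; split=> // _ n nr; rewrite -mulrDr.
    by apply: contrapT => h; apply: no; exists (n + r).
  apply: (finish CvC r) => // [|c m rc cS m4]; first by rewrite /=; exact: fr_rank fr.
  case: c rc cS => // rc _; last first.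
    by move: m m4; apply: forall4; split.
  have {}M0 := M0 rc; have [_ M2] := @PD Sh Md 2%N 1 0 isT S1 M0.
  move: m m4; apply: forall4; split=> // M3; case: nM1.
  by have [] := @PD Sh Md 2%N 1 3 isT S1 M3.
have [r r1] := S1.
apply: (finish CvBC r) => // [|c m rc cS m4]; first by rewrite /=; exact: fr_rank fr.
case: c rc cS => // rc _; last first.
  by move: m m4; apply: forall4; split.
have {}M0 := M0 rc; have [_ M2] := @PD Sh Md 2%N 1 0 isT S1 M0.
have nM1 : ~ P Md 1 by move=> M1; have [_] := @PD Md Lg 2%N 1 0 isT M1 L0.
move: m m4; apply: forall4; split=> // M3; case: nM1.
by have [] := @PD Sh Md 2%N 1 3 isT S1 M3.
Qed.

End Adapt.

(** * From adapted frames to rows *)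
Lemma res_lt m : (res m < 4)%N.
Proof. by rewrite /res; lia. Qed.

Lemma resD m n : res (m + n) = ((res m + res n) %% 4)%N.
Proof. by rewrite /res; lia. Qed.

(** Here k is the b-coefficient that the change eps_i -> eps_i + b adds to a
root of length c. *)
Lemma swap_table_CvC l p m n (k : int) c :
  match c with Sh => k = 1 \/ k = -1 | Md => k = 0 \/ k = 2 \/ k = -2 | Lg => k = 2 \/ k = -2 end ->
  (c = Md -> l != 1%N) ->
  table_of CvC p c (res (m + k)) n = table_of CvC (swap l CvC p) c (res m) n.
Proof.
move=> kE; rewrite resD; have := res_lt m; case: (res m) => [|[|[|[|//]]]] _;
  case: c kE => /= [kE _|kE /(_ erefl) /negbTE l1|kE _]; rewrite /swap ?l1;
  by case: kE => [->|] //; case=> -> //.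
Qed.

(** The same for the change eps_1 -> eps_1 + b in rank 2. *)
Lemma swap_table_BBv l p m n (k : int) c :
  match c with Sh => True | Md => k = 1 \/ k = -1 | Lg => k = 0 \/ k = 2 \/ k = -2 end ->
  pS0 p = pS1 p ->
  table_of BBv p c (res (m + k)) n = table_of BBv (swap l BBv p) c (res m) n.
Proof.
move=> kE s01; rewrite resD; have := res_lt m; case: (res m) => [|[|[|[|//]]]] _;
  case: c kE => /= [_|kE|kE]; rewrite /swap /= ?s01 ?if_same //;
  try (by case: kE => [->|] //; case=> -> //); by case: kE => ->.
Qed.

Lemma finite_relevant (K : realType) l c (y : 'rV[K]_l.+1) : finite_roots c y -> relevant l c.
Proof. by rewrite /relevant; case: c => // /middle_rank ->. Qed.

Section Rows.
Variables (K : realType) (F : vectType K) (I : {symmetric F}) (R : set F) (G : {vspace F}) (l :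
  nat).
Variables (a : F) (kappa : K).
Hypothesis rs : root_system I R.
Implicit Types (f : 'Hom('rV[K]_l.+1, F)).

Lemma adapted_admissible f X p : frame I R G f a kappa -> adapted R f a X ->
  (forall c m n, relevant l c -> (m < 4)%N -> (n < 4)%N ->
     fibre_table R f a c m n = table_of X p c m n) -> admissible X l p.
Proof.
move=> fr ad pE.
have TP c (m n : nat) : relevant l c -> (m < 4)%N -> (n < 4)%N ->
  table_of X p c m n <-> fibre R f a c m n.
  by move=> rc m4 n4; rewrite -pE //; split=> /asboolP.
have Tm c (m n : nat) : relevant l c -> table_of X p c (m %% 4)%N (n %% 4)%N <-> fibre R f a c m n.
  move=> rc; rewrite -pE ?ltn_mod //; exact: (fibre_table_mod rs fr).
have good (m : nat) : m = 0%N \/ X = CvC /\ m = 1%N -> tgood (table_of X p) m.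
  move=> mE; apply/implyP => /hasP[n]; rewrite !inE => n4 /andP[mn /negP Ln]; apply/negP => L0.
  have n4' : (n < 4)%N by lia.
  have m4 : (m < 4)%N by case: mE => [->|[_ ->]].
  apply: Ln; apply: (Tm Lg m.*2 n.*2 isT).2; have := ad_good ad (m := m%:Z).
  rewrite -!muln2 mulnC PoszM [(n * 2)%N]mulnC PoszM; apply.
  - by case: mE => [->|[-> ->]]; [left|right].
  - by have := (Tm Lg m.*2 0%N isT).1 L0; rewrite -muln2 mulnC PoszM; apply.
  - exact: (TP Sh m n isT m4 n4').1.
rewrite /admissible; case: ifP => [_|/negP[]]; last first.
  apply/and3P; split; first last.
  - by case XE : X good => // good; apply: good; right.
  - by apply: good; left.
  have [[m m1] _] := fibre_parity rs fr; apply/hasP; exists (res m).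
    by have := res_lt m; case: (res m) => [|[|[|[|]]]].
  apply: (TP Sh (res m) 1%N isT (res_lt m) isT).2; exact: (fibre_res rs fr Sh m 1).1.
apply: closed_tableP => c d k m n m' n' cdk m4 n4 m4' n4'.
have [rc rd] : relevant l c /\ relevant l d.
  have [y [z [yc zd _]]] := reflections_witness K (fr_rank fr) cdk.
  by split; [exact: finite_relevant yc|exact: finite_relevant zd].
move=> /(TP _ _ _ rc m4 n4) cmn /(TP _ _ _ rd m4' n4') dmn; apply: (Tm _ _ _ rd).2.
by have [_] := fibre_closed rs fr cdk cmn dmn; rewrite -!PoszM -!PoszD.
Qed.

Lemma tabulates_table f (T T' : table) : tabulates R f a T ->
  (forall c m n, relevant l c -> (m < 4)%N -> (n < 4)%N -> T c m n = T' c m n) ->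
  tabulates R f a T'.
Proof.
move=> Tf TT' c y m n yc; have rc := finite_relevant yc.
by rewrite -TT' ?res_lt //; apply: Tf.
Qed.

(** If the parameters are those of a row only after a symmetry of the diagram,
the symmetry is realized by moving the origin of the affine space: all eps_i are
replaced by eps_i + b for C^v C_l, and eps_1 by eps_1 + b for BB_2^v. *)
Lemma adapted_row f X : frame I R G f a kappa -> adapted R f a X ->
  exists j (f' : 'Hom('rV[K]_l.+1, F)), [/\ valid_row (RowLabel X l j), frame I R G f' a kappa
    & tabulates R f' a (row_table (RowLabel X l j))].
Proof.
move=> fr ad; have [p pb pE] := adapted_params rs fr ad.
have Tp := tabulates_table (frame_tabulates rs fr) pE.
have pa := adapted_admissible fr ad pE.
have [j [jv [pj|[sw pj]]]] := box_rowsP (fr_rank fr) (ad_rank ad) pb pa.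
  by exists j, f; split=> //; rewrite /row_table -pj.
exists j.
have [_ T1] : fibre R f a Sh 0 0 /\ fibre R f a Sh 1 0.
  by split; [exact: (fibre_short0 fr)|exact: (fibre_short rs fr (ad_simple ad))].
have S1 (k : int) : k = 1 \/ k = -1 -> fibre R f a Sh k 0.
  case=> -> //; apply/(fibre_res rs fr).
  by have := (fibre_period rs fr Sh (-1) 0 1 0).1; rewrite mulr0 addr0 => /(_ T1)/(fibre_res rs fr).
have M0 (k : int) : (2 <= l)%N -> k = 0 \/ k = 2 \/ k = -2 -> fibre R f a Md k 0.
  move=> l2 kE; have t0 := fibre_middle0 fr l2.
  have [q ->] : exists q : int, k = 0 + (period Md)%:Z * q.
    by case: kE => [->|[->|->]]; [exists 0|exists 1|exists (-1)].
  by have := (fibre_period rs fr Md 0 0 q 0).2; rewrite mulr0 addr0; apply.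
have finish (u : 'rV[K]_l.+1) : integral_vec u ->
   (forall c y (m : int), c != Lg -> finite_roots c y -> dot y u = m%:~R -> fibre R f a c m 0) ->
   (forall c y (k m n : int), finite_roots c y -> dot y u = k%:~R ->
      table_of X p c (res (m + k)) (res n) = table_of X (swap l X p) c (res m) (res n)) ->
   exists f' : 'Hom('rV[K]_l.+1, F), [/\ valid_row (RowLabel X l j), frame I R G f' a kappa
    & tabulates R f' a (row_table (RowLabel X l j))].
  move=> ui Ru ue; have [|f' [fr' f'E]] := change_frame fr 0 ui.
    by move=> c y m cL yc yu; apply/(fibreP rs fr m 0 yc); apply: Ru yc yu.
  exists f'; split=> // c y m n yc; have [[y0 _] _] := finite_rootsP yc.
  have /intrP[k yk] : dot y u \is a Num.int by apply: integral_dot => //; case: (finite_rootsP yc).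
  rewrite (f'E y k m n y0 yk) mul0r addr0 /row_table -pj -(ue _ _ _ _ _ yc yk).
  exact: Tp.
case: X sw ad pb pE Tp pa jv pj finish => // sw ad pb pE Tp pa jv pj finish.
- have l2 : l = 2%N by apply/eqP.
  have dotu c (y : 'rV[K]_l.+1) (k : int) : finite_roots c y -> dot y (unitv K l 1) = k%:~R ->
      match c with Sh => k = 1 \/ k = -1 \/ k = 0 | Md => k = 1 \/ k = -1
      | Lg => k = 0 \/ k = 2 \/ k = -2 end.
    have sgn (s : bool) : (-1) ^+ s = ((-1) ^+ s : int)%:~R :> K by rewrite rmorph_sign.
    have sh (z : 'rV[K]_l.+1) (q : int) : finite_roots Sh z -> dot z (unitv K l 1) = q%:~R ->
      q = 1 \/ q = -1 \/ q = 0.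
      move=> [i [s [il ->]]]; rewrite dotZl dot_eps // sgn pmulrn -intrM => /eqP;
        rewrite eqr_int => /eqP <-.
      by case: s; case: (i == 1%N); rewrite ?mulr0 ?mulr1; auto.
    case: c => [|[i [i' [s [t [i1 /andP[ii il] ->]]]]]|/longP[w ws ->]]; first exact: sh.
      have [-> ->] : i = 1%N /\ i' = 2%N by lia.
      rewrite !dotE !dot_eps ?l2 //= mulr1 mulr0 addr0 sgn => /eqP; rewrite eqr_int => /eqP <-.
      by case: s; auto.
    rewrite dotZl; have /intrP[q wq] : dot w (unitv K l 1) \is a Num.int.
      by apply: integral_dot; [case: (finite_rootsP ws)|exact: integral_eps].
    rewrite wq -(intrM _ 2 q) => /eqP; rewrite eqr_int => /eqP <-.
    by case: (sh _ _ ws wq) => [->|[->|->]]; auto.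
  have s01 : pS0 p = pS1 p.
    have : pS0 (swap l BBv p) = pS1 (swap l BBv p) by rewrite pj.
    by [].
  apply: (finish (unitv K l 1)); first exact: integral_eps.
    move=> c y m cL yc yu; have := dotu _ _ _ yc yu; case: c cL yc => // _ yc.
      case=> [->|[->|->]]; [apply: S1; by left|apply: S1; by right|exact: (fibre_short0 fr)].
    have M1 : fibre R f a Md 1 0 by exact: (ad_simple ad).
    case=> -> //; have := (fibre_period rs fr Md (-1) 0 1 0).1; rewrite mulr0 addr0; exact.
  move=> c y k m n yc yk; apply: swap_table_BBv => //.
  by have := dotu _ _ _ yc yk; case: (c).
- pose u : 'rV[K]_l.+1 := \row_j (j != ord0)%:R.
  have ui : integral_vec u by split=> [|k]; rewrite mxE // natr_int.
  have du i : (1 <= i <= l)%N -> dot (unitv K l i) u = 1.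
    by case: i => // i /andP[_ il]; rewrite dot_unitS // mxE -(inj_eq val_inj) /= inordK.
  have sgn (s : bool) : (-1) ^+ s = ((-1) ^+ s : int)%:~R :> K by rewrite rmorph_sign.
  have sh (z : 'rV[K]_l.+1) (q : int) : finite_roots Sh z -> dot z u = q%:~R -> q = 1 \/ q = -1.
    move=> [i [s [il ->]]]; rewrite dotZl du // mulr1 sgn => /eqP; rewrite eqr_int => /eqP <-.
    by case: s; auto.
  have dotu c (y : 'rV[K]_l.+1) (k : int) : finite_roots c y -> dot y u = k%:~R ->
      match c with Sh => k = 1 \/ k = -1 | Md => k = 0 \/ k = 2 \/ k = -2 | Lg => k = 2 \/ k = -2
        end.
    case: c => [|[i [i' [s [t [i1 /andP[ii il] ->]]]]]|/longP[w ws ->]]; first exact: sh.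
      rewrite !dotE !du; try lia; rewrite !mulr1 !sgn -intrD => /eqP; rewrite eqr_int => /eqP <-.
      by case: s; case: t; auto.
    rewrite dotZl; have /intrP[q wq] : dot w u \is a Num.int.
      by apply: integral_dot; [case: (finite_rootsP ws)|].
    rewrite wq -(intrM _ 2 q) => /eqP; rewrite eqr_int => /eqP <-.
    by case: (sh _ _ ws wq) => ->; auto.
  apply: (finish u ui).
    move=> c y m cL yc yu; have := dotu _ _ _ yc yu; case: c cL yc => // _ yc; first exact: S1.
    by apply: M0; exact: middle_rank yc.
  move=> c y k m n yc yk; apply: swap_table_CvC.
    by have := dotu _ _ _ yc yk; case: (c).
  by move=> cM; move: yc; rewrite cM => /middle_rank; case: (l) => [|[]].
Qed.

End Rows.

(** * Semidefinite forms and lattices *)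
Section Semidefinite.
Variables (K : realType) (F : vectType K) (I : {symmetric F}).
Implicit Types x y z : F.

Lemma form_suml (J : Type) (r : seq J) (P : pred J) (g : J -> F) y :
  I (\sum_(i <- r | P i) g i) y = \sum_(i <- r | P i) I (g i) y.
Proof. exact: linear_sumlz. Qed.

Lemma form_orthogonal_sum n (X : n.-tuple F) (c : 'I_n -> K) :
  pairwise (fun x y => I x y == 0) X ->
  I (\sum_i c i *: X`_i) (\sum_i c i *: X`_i) = \sum_i c i ^+ 2 * I X`_i X`_i.
Proof.
move=> /(pairwiseP 0) orth; rewrite form_suml; apply: eq_bigr => i _.
rewrite formC form_suml (bigD1 i) //= big1 ?addr0 => [|j ji]; rewrite formZl formZr; first by ring.
suff -> : I X`_j X`_i = 0 by rewrite !mulr0.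
have [iX jX] : (i < size X)%N /\ (j < size X)%N by rewrite size_tuple.
have := orth i j; have := orth j i; rewrite !inE iX jX.
case: (ltngtP i j) ji => [ij _ _|ij _|/val_inj -> /eqP//].
  by move=> /(_ isT isT isT)/eqP; rewrite formC.
by move=> /(_ isT isT isT)/eqP.
Qed.

(** Diagonalization in an orthogonal basis; the isotropic vectors are spanned by
the isotropic basis vectors. *)
Lemma signature_psd l : has_signature I l 2 0 ->
  (forall x, 0 <= I x x) /\ exists N : {vspace F}, \dim N = 2%N /\ forall x,
    (x \in N) <-> I x x = 0.
Proof.
case=> e [eb orth _ e0 en].
have e_ge0 x : x \in e -> 0 <= I x x.
  move=> xe; rewrite leNgt; apply/negP => x0.
  by have : has (fun x => I x x < 0) e; [apply/hasP; exists x|rewrite has_count en].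
pose X := in_tuple e.
have sumE x : I x x = \sum_i coord X i x ^+ 2 * I X`_i X`_i.
  by rewrite -form_orthogonal_sum // -(coord_basis (X := X) eb (memvf x)).
have X_ge0 (i : 'I_(size e)) : 0 <= I X`_i X`_i by apply/e_ge0/mem_nth.
split=> [x|]; first by rewrite sumE; apply: sumr_ge0 => i _; rewrite mulr_ge0 ?sqr_ge0.
pose e' := [seq x <- e | I x x == 0].
have fe' : free e' by apply/filter_free/(basis_free eb).
exists <<e'>>%VS; split; first by rewrite (eqP fe') size_filter.
move=> x; split=> [xe'|x0].
  have := coord_span (X := in_tuple e') xe' => ->.
  rewrite (form_orthogonal_sum (X := in_tuple e')).
    rewrite big1 // => i _; have : (in_tuple e')`_i \in e' by apply: mem_nth.
    by rewrite mem_filter => /andP[/eqP -> _]; rewrite mulr0.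
  exact: subseq_pairwise (filter_subseq _ _) orth.
rewrite (coord_basis (X := X) eb (memvf x)); apply: memv_suml => i _.
move/eqP: x0; rewrite sumE psumr_eq0 => [|j _]; last by rewrite mulr_ge0 ?sqr_ge0.
move=> /allP /(_ i (mem_index_enum _)) /implyP /(_ isT); rewrite mulf_eq0 sqrf_eq0.
case/orP => [/eqP ->|Xi]; first by rewrite scale0r mem0v.
by apply/memvZ/memv_span; rewrite mem_filter Xi mem_nth.
Qed.

Hypothesis psd : forall x, 0 <= I x x.

(** The form may be degenerate, so the case I x x = 0 needs an argument of its
own: there I(y - t x) is affine in t and would become negative. *)
Lemma form_CS x y : I x y * I x y <= I x x * I y y.
Proof.
have [x0|xn] := eqVneq (I x x) 0.
  rewrite x0 mul0r; have [->|xy] := eqVneq (I x y) 0; first by rewrite mulr0.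
  have := psd (y - (I y y + 1) / (2 * I x y) *: x).
  rewrite !formE x0 (formC I y x) !mulr0.
  have -> : (I y y + 1) / (2 * I x y) * I x y = (I y y + 1) / 2 by field.
  by have := psd y; lra.
have x0 : 0 < I x x by rewrite lt_def xn psd.
have := psd (I x x *: y - I x y *: x); rewrite !formE (formC I y x).
nra.
Qed.

Lemma form_null x y : I x x = 0 -> I x y = 0.
Proof. by move=> x0; apply/eqP; have := form_CS x y; rewrite x0 mul0r -expr2;
  rewrite le_eqVlt ltNge sqr_ge0 orbF sqrf_eq0. Qed.

End Semidefinite.

(** The generator is the least positive element. *)
Lemma int_subgroup (S : int -> Prop) : S 0 -> (forall m n, S m -> S n -> S (m - n)) ->
  (exists2 m, S m & m != 0) -> exists d : int, [/\ d != 0, S d & forall m, S m -> exists q,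
    m = q * d].
Proof.
move=> S0 SB [m0 Sm0 m00].
have SN m : S m -> S (- m) by move=> /(SB _ _ S0); rewrite sub0r.
have SM m (q : int) : S m -> S (q * m).
  move=> Sm; have nat_S (k : nat) : S (k%:Z * m).
    elim: k => [|k IH]; first by rewrite mul0r.
    by rewrite intS mulrDl mul1r addrC -[m in _ + m]opprK; apply: SB => //; apply: SN.
  by case: q => k; [exact: nat_S|rewrite NegzE mulNr; apply/SN/nat_S].
have ex : exists k : nat, (0 < k)%N && `[< S k%:Z >].
  exists (absz m0); rewrite absz_gt0 m00; apply/asboolP.
  by case: m0 Sm0 {m00} => // k; rewrite NegzE => /SN; rewrite opprK.
case: (ex_minnP ex) => d /andP[d0 /asboolP Sd] dmin.
exists d%:Z; split=> // [|m Sm]; first by lia.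
exists (m %/ d)%Z; have := divz_eq m d; have r0 : 0 <= (m %% d)%Z by rewrite modz_ge0 //; lia.
have rd : (m %% d)%Z < d%:Z by have := @ltz_pmod m d; lia.
have Sr : S (m %% d)%Z.
  have -> : (m %% d)%Z = m - (m %/ d)%Z * d by rewrite {2}(divz_eq m d) addrAC subrr add0r.
  by apply: SB => //; apply: SM.
have [->|rn] := eqVneq (m %% d)%Z 0; first by rewrite addr0.
have := dmin (absz (m %% d)%Z); rewrite absz_gt0 rn gez0_abs //.
by rewrite (_ : `[< _ >] = true); [lia|apply/asboolP].
Qed.

Section Lattice.
Variables (K : realType) (V : vectType K).
Implicit Types (g h : seq V) (x : V).

Lemma zspan_coords n (g : n.-tuple V) x : zspan [set` (g : seq V)]%classic x ->
  exists c : 'I_n -> int, x = \sum_i (c i)%:~R *: g`_i.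
Proof.
move: x; apply: zspan_ind => [|_ _ [c ->] [c' ->]|x].
- by exists (fun _ => 0); rewrite big1 // => i _; rewrite scale0r.
- exists (fun i => c i - c' i); rewrite -sumrB; apply: eq_bigr => i _.
  by rewrite intrB scalerBl.
- move=> /= xg; have ig : (index x g < n)%N by rewrite -[X in (_ < X)%N](size_tuple g) index_mem.
  exists (fun i => (i == Ordinal ig)%:Z); rewrite (bigD1 (Ordinal ig)) //= eqxx scale1r.
  by rewrite nth_index // big1 ?addr0 // => i /negPf ->; rewrite scale0r.
Qed.

(** A rational solution exists by rank; its denominators are cleared. *)
Lemma integral_relation m n (A : 'M[int]_(m, n)) : (n < m)%N ->
  exists2 z : 'I_m -> int, (exists i, z i != 0) & forall j, \sum_i z i * A i j = 0.
Proof.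
move=> nm; pose B : 'M[rat]_(m, n) := map_mx (fun k : int => k%:~R) A.
have kn : kermx B != 0.
  rewrite kermx_eq0 /row_free; apply/negP => /eqP rB.
  by have := rank_leq_col B; rewrite rB leqNgt nm.
have vn : nz_row (kermx B) != 0 by rewrite nz_row_eq0.
set v := nz_row _ in vn; have vB : v *m B = 0 by apply/sub_kermxP/nz_row_sub.
pose D : int := \prod_i denq (v 0 i).
have vi i : exists k : int, D%:~R * v 0 i = k%:~R.
  exists (\prod_(j | j != i) denq (v 0 j) * numq (v 0 i)).
  have d0 : (denq (v 0 i))%:~R != 0 :> rat by rewrite intr_eq0 denq_neq0.
  have e : (denq (v 0 i))%:~R * v 0 i = (numq (v 0 i))%:~R.
    by rewrite -[X in _ * X]divq_num_den mulrC divfK.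
  by rewrite /D (bigD1 i) //= !intrM mulrAC e mulrC.
have /fin_all_exists[z zE] := vi.
have D0 : D%:~R != 0 :> rat.
  by rewrite intr_eq0; apply/prodf_neq0 => i _; rewrite denq_neq0.
exists z.
  case/rV0Pn: vn => i vi0; exists i; rewrite -(intr_eq0 rat) -zE mulf_neq0 //.
move=> j; apply/eqP; rewrite -(intr_eq0 rat) rmorph_sum /=; apply/eqP.
have e : D%:~R * (v *m B) 0 j = 0 by rewrite vB mxE mulr0.
by rewrite -[RHS]e mxE mulr_sumr; apply: eq_bigr => i _; rewrite intrM -zE mxE mulrA.
Qed.

(** The lattice has rank n and the form tau kills n - 1 lattice vectors spanning
a hyperplane, so tau is proportional to a form with integral values on the
lattice, obtained from an integral relation. Without integrality of the
hyperplane the values could be dense. *)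
Lemma lattice_values n (g : n.-tuple V) (h : n.-1.-tuple V) (b' : V) (tau : 'Hom(V, K^o)) :
  basis_of fullv g -> (forall x, x \in (h : seq V) -> zspan [set` (g : seq V)]%classic x) ->
  (fullv <= <<h>> + <[b']>)%VS -> (forall x, x \in (h : seq V) -> tau x = 0) -> tau b' != 0 ->
  exists t : K, [/\ t != 0, exists2 x, zspan [set` (g : seq V)]%classic x & tau x = t &
     forall x, zspan [set` (g : seq V)]%classic x -> exists z : int, tau x = z%:~R * t].
Proof.
move=> gb hg hb tauh taub.
have n0 : (0 < n)%N.
  rewrite lt0n; apply/negP => /eqP n0; have := size_basis gb; rewrite n0 => /eqP.
  rewrite dimv_eq0 => /eqP V0; case/eqP: taub.
  by have := memvf b'; rewrite V0 memv0 => /eqP ->; rewrite linear0.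
have hA (j : 'I_n.-1) : exists c : 'I_n -> int, h`_j = \sum_i (c i)%:~R *: g`_i.
  by apply: zspan_coords; apply: hg; apply: mem_nth; rewrite size_tuple ltn_ord.
have /fin_all_exists[A AE] := hA.
have [|z [i0 zi0] zA] := @integral_relation n n.-1 (\matrix_(i, j) A j i).
  by rewrite prednK.
have lin : linear (fun x : V => \sum_i coord g i x * (z i)%:~R : K^o).
  move=> k x y; rewrite scaler_sumr -big_split; apply: eq_bigr => i _ /=.
  have -> : coord g i (k *: x + y) = k * coord g i x + coord g i y by rewrite linearP.
  by rewrite mulrDl -mulrA.
have [sigma sigmaE] := hom_of_linear lin.
have fg := basis_free gb.
have sg x (c : 'I_n -> int) : x = \sum_i (c i)%:~R *: g`_i -> sigma x = (\sum_i c i * z i)%:~R.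
  move=> ->; rewrite sigmaE rmorph_sum; apply: eq_bigr => i _ /=.
  by rewrite coord_sum_free // intrM.
have sh x : x \in (h : seq V) -> sigma x = 0.
  move=> /(nthP 0)[j]; rewrite size_tuple => jn <-; rewrite (sg _ _ (AE (Ordinal jn))).
  have := zA (Ordinal jn); under eq_bigr => i _ do rewrite mxE mulrC.
  by move=> ->.
have dec x : exists k, tau x = k * tau b' /\ sigma x = k * sigma b'.
  have /memv_addP[u uh [w /vlineP[k ->] ->]] := subvP hb x (memvf x).
  have zero (s : 'Hom(V, K^o)) : (forall x, x \in (h : seq V) -> s x = 0) -> s u = 0.
    move=> s0; have : (<<h>> <= lker s)%VS.
      by apply/span_subvP => y yh; rewrite memv_ker s0.
    by move/subvP/(_ _ uh); rewrite memv_ker => /eqP.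
  have zt := zero tau tauh; have zs := zero sigma sh.
  exists k; split; first by rewrite (linearD tau) /= zt add0r linearZ.
  by rewrite (linearD sigma) /= zs add0r linearZ.
have sb : sigma b' != 0.
  apply/eqP => sb0; case/eqP: zi0.
  have [k [_ e]] := dec g`_i0; move: e; rewrite sb0 mulr0.
  rewrite (sg _ (fun i => (i == i0)%:Z)).
    move=> /eqP; rewrite intr_eq0 (bigD1 i0) //= eqxx mul1r big1 ?addr0 => [/eqP //|i /negPf ->].
    by rewrite mul0r.
  by rewrite (bigD1 i0) //= eqxx scale1r big1 ?addr0 // => i /negPf ->; rewrite scale0r.
pose S (m : int) := exists2 x, zspan [set` (g : seq V)]%classic x & sigma x = m%:~R.
have Q := @zspan_coords n g.
have [||| d [d0 [x0 x0Q x0d] dS]] := @int_subgroup S.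
- by exists 0; [exact: zspan0|rewrite linear0].
- move=> m m' [x xQ xm] [y yQ ym]; exists (x - y); first exact: zspanB.
  by rewrite linearB /= xm ym intrB.
- exists (z i0) => //; exists g`_i0.
    by apply: zspan_gen => /=; apply: mem_nth; rewrite size_tuple.
  rewrite (sg _ (fun i => (i == i0)%:Z)).
    by rewrite (bigD1 i0) //= eqxx mul1r big1 ?addr0 // => i /negPf ->; rewrite mul0r.
  by rewrite (bigD1 i0) //= eqxx scale1r big1 ?addr0 // => i /negPf ->; rewrite scale0r.
have tE x : tau x = sigma x * (tau b' / sigma b').
  by have [k [-> ->]] := dec x; field.
exists (d%:~R * (tau b' / sigma b')); split.
- by rewrite mulf_neq0 ?intr_eq0 // mulf_neq0 ?invr_neq0.
- by exists x0 => //; rewrite tE x0d.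
- move=> x xQ; have [c xc] := Q _ xQ.
  have [|q qE] := dS (\sum_i c i * z i); first by exists x => //; exact: sg.
  by exists q; rewrite tE (sg _ _ xc) qE intrM -mulrA.
Qed.

End Lattice.

(** * Roots whose double is a root modulo the marking *)
Section DoubledRoots.
Variables (K : realType) (F : vectType K) (I : {symmetric F}) (R : set F).
Hypotheses (rs : root_system I R) (psd : forall x, 0 <= I x x).
Variables (g : F) (kappa : K).
Hypotheses (g0 : I g g = 0) (k0 : 0 < kappa).
Implicit Types (u v w x y z : F) (es : seq F).

Let gl y : I g y = 0. Proof. exact: form_null. Qed.
Let gr y : I y g = 0. Proof. by rewrite formC gl. Qed.

Lemma root_integral x y : R x -> R y -> exists k : int, 2 * I x y / I x x = k%:~R.
Proof.
move=> Rx Ry; have /intrP[k kE] := rs_integral rs Rx Ry.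
by exists k; rewrite -kE /coroot formZl mulrAC.
Qed.

Definition doubled_root u := [/\ R u, I u u = kappa & R (2 *: u + g)].

(** Put m = <(2u + g)^v, y> and n = <y^v, u>. Then I u y = m kappa, and
Cauchy-Schwarz leaves 0 < m n <= 2 unless m = 0. The solutions are (1, 1), (1,
2), (2, 1) up to a common sign. *)
Lemma doubled_root_cases u y : doubled_root u -> R y ->
  [\/ I u y = 0,
      exists s : bool, I y y = kappa /\ I (y - (-1) ^+ s *: u) (y - (-1) ^+ s *: u) = 0,
      exists s : bool, I y y = 4 * kappa /\ I (y - (-1) ^+ s *: (2 *: u)) (y - (-1) ^+ s *: (2 *:
        u)) = 0 |
      exists s : bool, I y y = 2 * kappa /\ I u y = (-1) ^+ s * kappa].
Proof.
move=> [Ru uk R2u] Ry; have kn := lt0r_neq0 k0.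
have [m mE] := root_integral R2u Ry; have [n nE] := root_integral Ry Ru.
have B0 : 0 < I y y by rewrite lt_def psd (rs_anisotropic rs Ry).
have uy : I u y = m%:~R * kappa.
  move: mE; rewrite !formE !gl !gr !addr0 uk => <-.
  by field.
have nB : n%:~R * I y y = 2 * m%:~R * kappa.
  by rewrite -nE formC uy; field; rewrite lt0r_neq0.
have CS : m%:~R * m%:~R * kappa <= I y y.
  have := form_CS psd u y; rewrite uy uk => h.
  rewrite -(ler_pM2l k0); apply: le_trans h; rewrite le_eqVlt; apply/orP; left; apply/eqP; ring.
have [m0|mn] := eqVneq m 0; first by constructor 1; rewrite uy m0 mul0r.
have mn2 : m * n <= 2.
  rewrite -(ler_int K) intrM; have : (m%:~R * n%:~R - 2) * I y y <= 0.
    have -> : (m%:~R * n%:~R - 2) * I y y = m%:~R * (n%:~R * I y y) - 2 * I y y by ring.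
    rewrite nB; nra.
  by rewrite pmulr_lle0 // subr_le0.
have mn0 : 0 < m * n.
  rewrite -(ltr_int K) intrM; have : 0 < (m%:~R * n%:~R) * I y y.
    rewrite -mulrA nB; have : 0 < m%:~R * m%:~R :> K.
      by rewrite -expr2 lt_def sqr_ge0 sqrf_eq0 intr_eq0 mn.
    move=> mm; have -> : m%:~R * (2 * m%:~R * kappa) = 2 * (m%:~R * m%:~R) * kappa by ring.
    by apply: mulr_gt0 => //; apply: mulr_gt0.
  by rewrite pmulr_lgt0.
have mn' : [\/ m = 1 /\ n = 1 \/ m = -1 /\ n = -1, m = 1 /\ n = 2 \/ m = -1 /\ n = -2 |
            m = 2 /\ n = 1 \/ m = -2 /\ n = -1].
  have n0 : n <> 0 by move=> n0; rewrite n0 mulr0 in mn0.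
  have : m = 1 \/ m = -1 \/ m = 2 \/ m = -2.
    have [n1|n1] : 1 <= n \/ n <= -1 by lia.
      have : m <= m * n by nia.
      have : 1 <= m by nia.
      lia.
    have : - m <= m * n by nia.
    have : m <= - 1 by nia.
    lia.
  case=> [mE'|[mE'|[mE'|mE']]]; rewrite mE' in mn0 mn2 *.
  - have : n = 1 \/ n = 2 by lia. by case=> ->; [constructor 1|constructor 2]; left.
  - have : n = -1 \/ n = -2 by lia. by case=> ->; [constructor 1|constructor 2]; right.
  - have -> : n = 1 by lia. by constructor 3; left.
  - have -> : n = -1 by lia. by constructor 3; right.
have yu := formC I y u.
case: mn' => -[] [mE' nE']; rewrite mE' nE' in uy nB.
- constructor 4; exists false; rewrite uy; split; [lra|rewrite expr0; lra].
- constructor 4; exists true; rewrite uy; split; [lra|rewrite expr1; lra].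
- constructor 2; exists false; rewrite expr0 !formE yu uy uk; split; lra.
- constructor 2; exists true; rewrite expr1 !formE yu uy uk; split; lra.
- constructor 3; exists false; rewrite expr0 !formE yu uy uk; split; lra.
- constructor 3; exists true; rewrite expr1 !formE yu uy uk; split; lra.
Qed.

(** Families that behave like part of eps_1, ..., eps_l. The differences must be
roots for the finite part to be a single BC_l. *)
Record doubled_family es : Prop := DoubledFamily {
  df_uniq : uniq es;
  df_doubled : forall u, u \in es -> doubled_root u;
  df_orth : forall u v, u \in es -> v \in es -> u != v -> I u v = 0;
  df_diff : forall u v, u \in es -> v \in es -> u != v -> R (u - v)
}.

Lemma doubled_family_free es : doubled_family es -> free es.
Proof.
move=> fam; apply/(freeP (X := in_tuple es)) => c c0 i.
have: I (\sum_(j < size es) c j *: es`_j) es`_i = 0 by rewrite [X in I X _]c0 form0l.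
rewrite form_suml (bigD1 i) //= big1 ?addr0 => [|j ji].
  have [_ uk _] := df_doubled fam (mem_nth 0 (ltn_ord i)).
  by move=> /eqP; rewrite formZl uk mulf_eq0 (gt_eqF k0) orbF => /eqP.
rewrite formZl (df_orth fam) ?mulr0 ?mem_nth //.
by rewrite nth_uniq // (df_uniq fam).
Qed.

Lemma doubled_family_max x : doubled_root x -> exists es,
  [/\ doubled_family es, x \in es & forall v, ~ doubled_family (v :: es)].
Proof.
move=> xd; have fam1 : doubled_family [:: x].
  split=> // [u|u v|u v]; rewrite !inE => /eqP -> //.
    by move=> /eqP ->; rewrite eqxx.
  by move=> /eqP ->; rewrite eqxx.
suff ind k es : doubled_family es -> x \in es -> (\dim {:F} - size es <= k)%N ->
    exists es, [/\ doubled_family es, x \in es & forall v, ~ doubled_family (v :: es)].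
  by apply: (ind _ [:: x] fam1 _ (leqnn _)); rewrite inE.
elim: k es => [|k IH] es fam xes sz.
  exists es; split=> // v /doubled_family_free; rewrite /free => /eqP vE.
  have : (\dim <<v :: es>> <= \dim {:F})%N by apply/dimvS/subvf.
  by rewrite vE /= => h; move: sz; rewrite leqn0 subn_eq0 leqNgt h.
have [[v vfam]|no] := EM (exists v, doubled_family (v :: es)); last first.
  by exists es; split=> // v vfam; apply: no; exists v.
apply: (IH (v :: es)) => //; first by rewrite inE xes orbT.
by rewrite /=; lia.
Qed.

Section Maximal.
Variable es : seq F.
Hypotheses (fam : doubled_family es) (esmax : forall v, ~ doubled_family (v :: es)).

(** Modulo the radical, a root that is not orthogonal to the family is +-u, +-2u
or +-u +- v with u, v in the family. In the last case the reflection in y sends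
u to a doubled root v with y = +-(u - v); were v orthogonal to the whole family,
it could be added to it. *)
Lemma maximal_family_cases y : R y -> (forall u, u \in es -> I u y = 0) \/
  [\/ exists2 u, u \in es & exists s : bool, I (y - (-1) ^+ s *: u) (y - (-1) ^+ s *: u) = 0,
      exists2 u, u \in es & exists s : bool, I (y - (-1) ^+ s *: (2 *: u)) (y - (-1) ^+ s *: (2
        *: u)) = 0 |
      exists u v (s t : bool), [/\ u \in es, v \in es, u != v &
        I (y - ((-1) ^+ s *: u + (-1) ^+ t *: v)) (y - ((-1) ^+ s *: u + (-1) ^+ t *: v)) = 0]].
Proof.
move=> Ry; have [no|] := EM (exists2 u, u \in es & I u y != 0); last first.
  move=> no; left=> u ues; apply/eqP; apply: contrapT => /negP uy; apply: no; by exists u.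
case: no => u ues uy; right; have ud := df_doubled fam ues.
case: (doubled_root_cases ud Ry) => [uy0|[s [_ sE]]|[s [_ sE]]|[s [yk uyk]]].
- by rewrite uy0 eqxx in uy.
- by constructor 1; exists u => //; exists s.
- by constructor 2; exists u => //; exists s.
constructor 3; have [Ru uk R2u] := ud.
have [z zy] : exists z, z = (-1) ^+ s *: y by exists ((-1) ^+ s *: y).
have ss : (-1) ^+ s * (-1) ^+ s = 1 :> K by rewrite -signr_addb addbb.
have Rz : R z by rewrite zy; case: (s); rewrite ?expr0 ?expr1 ?scale1r // scaleN1r;
  apply: (rootN rs).
have zk : I z z = 2 * kappa by rewrite zy !formE mulrA ss mul1r.
have uz : I u z = kappa by rewrite zy !formE uyk mulrA ss mul1r.
have [v vE] : exists v, v = u - z by exists (u - z).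
have Rv : R v.
  have := root_reflection rs Rz Ru; rewrite (formC I z u) uz zk divff ?scale1r -?vE //.
  by rewrite mulf_neq0 ?lt0r_neq0.
have vk : I v v = kappa by rewrite vE !formE (formC I z u) uz uk zk; lra.
have uv : I u v = 0 by rewrite vE !formE uk uz subrr.
have R2v : R (2 *: v + g).
  have := root_reflection rs Rz R2u; rewrite !formE gr addr0 (formC I z u) uz zk.
  have -> : 2 * (2 * kappa) / (2 * kappa) = 2 :> K by field; rewrite lt0r_neq0.
  by rewrite addrAC -scalerBr -vE.
have vd : doubled_root v by [].
have zE : z = u - v by rewrite vE subKr.
have [[w wes wv]|no] := EM (exists2 w, w \in es & I w v != 0).
  case: (doubled_root_cases (df_doubled fam wes) Rv) => [wv0|[t [_ tE]]|[t [tk _]]|[t [tk _]]].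
  - by rewrite wv0 eqxx in wv.
  - exists u, w, s, (s (+) ~~ t); split=> //.
      by apply: contraNneq wv => <-; rewrite uv.
    have -> : y = (-1) ^+ s *: z by rewrite zy scalerA ss scale1r.
    have -> : (-1) ^+ s *: z - ((-1) ^+ s *: u + (-1) ^+ (s (+) ~~ t) *: w)
        = - (-1) ^+ s *: (v - (-1) ^+ t *: w).
      rewrite zE signr_addb -scalerA -scalerDr -scalerBr scaleNr -scalerN; congr (_ *: _).
      rewrite opprD addrACA subrr add0r opprB addrC; congr (_ - _).
      by case: (t) => /=; rewrite ?expr0 ?expr1 ?scaleN1r ?scale1r ?opprK.
    by rewrite formZl formZr tE !mulr0.
  - by move: tk; rewrite vk => ?; have := k0; lra.
  - by move: tk; rewrite vk => ?; have := k0; lra.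
have orth w : w \in es -> I w v = 0.
  by move=> wes; apply/eqP; apply: contrapT => /negP wv; apply: no; exists w.
have diff w : w \in es -> R (w - v).
  move=> wes; have [<-|uw] := eqVneq u w; first by rewrite -zE.
  have Rwu : R (u - w) by apply: (df_diff fam).
  have [_ wk _] := df_doubled fam wes.
  have uw0 : I u w = 0 by apply: (df_orth fam).
  have := root_reflection rs Rwu Rz.
  have -> : 2 * I (u - w) z / I (u - w) (u - w) = 1.
    rewrite zE !formE (formC I w u) uw0 uv orth // uk wk; field.
    by have := k0; lra.
  by rewrite scale1r zE opprB addrC addrA addrNK.
case: (esmax (v := v)); split.
- rewrite /= (df_uniq fam) andbT; apply/negP => /orth /eqP.
  by rewrite vk (gt_eqF k0).
- by move=> w; rewrite inE => /orP[/eqP ->//|/(df_doubled fam)].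
- move=> w w'; rewrite !inE => /orP[/eqP ->|wes] /orP[/eqP ->|wes'].
  + by rewrite eqxx.
  + by rewrite formC orth.
  + by rewrite orth.
  + exact: (df_orth fam).
- move=> w w'; rewrite !inE => /orP[/eqP ->|wes] /orP[/eqP ->|wes'].
  + by rewrite eqxx.
  + by move=> _; rewrite -opprB; apply: (rootN rs); apply: diff.
  + by move=> _; apply: diff.
  + exact: (df_diff fam).
Qed.

End Maximal.
End DoubledRoots.

(** * Existence of a frame *)
Section Quotients.
Variables (K : realType) (F : vectType K) (G : {vspace F}).

Lemma mem_proj z : (z \in G) = (proj G z == 0).
Proof. by rewrite -memv_ker Defs.lker_proj. Qed.

Lemma proj_eq x y : proj G x = proj G y <-> x - y \in G.
Proof. by rewrite mem_proj linearB subr_eq0; split=> [e|/eqP //]; apply/eqP. Qed.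

Lemma proj_surj (u : quo G) : exists x, u = proj G x.
Proof. by have := memvf u; rewrite -Defs.limg_proj => /memv_imgP[x _ ->]; exists x. Qed.

(** A coordinate of the quotient F/G. *)
Lemma separating_form (b : F) : b \notin G ->
  exists tau : 'Hom(F, K^o), (forall x, x \in G -> tau x = 0) /\ tau b != 0.
Proof.
move=> bG; have pb : proj G b != 0 by rewrite -mem_proj.
have X := vbasisP {:quo G}; pose Y := vbasis {:quo G}.
have [i ib] : exists i, coord Y i (proj G b) != 0.
  apply/existsP; apply: contraNT pb => /existsPn c0.
  rewrite (coord_basis (X := Y) X (memvf (proj G b))) big1 // => i _.
  by have /negPn/eqP -> := c0 i; rewrite scale0r.
have lin : linear (fun x => coord Y i (proj G x) : K^o) by move=> k x y; rewrite !linearP.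
have [tau tauE] := hom_of_linear lin.
exists tau; split; last by rewrite tauE.
by move=> x; rewrite mem_proj tauE => /eqP ->; rewrite linear0.
Qed.
End Quotients.

Lemma middle_range i j l : (1 <= i)%N -> (i < j)%N -> (j <= l)%N ->
  [/\ (1 <= i <= l)%N, (1 <= j <= l)%N & i != j].
Proof. by move=> i1 ij jl; split; lia. Qed.

Section FrameExists.
Variables (K : realType) (F : vectType K) (I : {symmetric F}) (R : set F) (G : {vspace F}).
Hypotheses (me : marked_elliptic I R G).

Let rs : root_system I R. Proof. by case: me => -[]. Qed.

(** If x and y are roots with y = c x + g, the integers <x^v, y> = 2c and <y^v,
x> = 2/c have product 4, so c is +-1/2, +-1 or +-2. *)
Lemma nonreduced_pair : ~ reduced (quo_roots R G) -> exists x g, [/\ R x, g \in G & R (2 *: x + g)].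
Proof.
move=> nr; apply: contrapT => no; apply: nr => _ c [x Rx <-] [y Ry yx].
have Grad z : z \in G -> radical I z by case: me => _ + _ _ => /(_ z).
have gE : y - c *: x \in G by apply/proj_eq; rewrite linearZ.
have [g gd] : exists g, g = y - c *: x by exists (y - c *: x).
rewrite -gd in gE; have yE : y = c *: x + g by rewrite gd addrC subrK.
have gl z : I g z = 0 by have := Grad _ gE; apply.
have gr z : I z g = 0 by rewrite formC.
have xn := rs_anisotropic rs Rx; have yn := rs_anisotropic rs Ry.
have yy : I y y = c * c * I x x by rewrite yE !formE !gl !gr; ring.
have cn : c != 0 by apply: contraNneq yn => c0; rewrite yy c0 !mul0r.
have [p pE] := root_integral rs Rx Ry; have [q qE] := root_integral rs Ry Rx.
have {}pE : p%:~R = 2 * c.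
  by rewrite -pE yE !formE gr addr0; field.
have {}qE : q%:~R * c = 2.
  have Iyx : I y x = c * I x x by rewrite yE !formE gl addr0.
  by rewrite -qE Iyx yy; field; rewrite xn cn.
have pq : p * q = 4.
  apply/eqP; rewrite -(eqr_int K) intrM pE; apply/eqP.
  by rewrite -mulrA (mulrC c) qE -natrM.
have : p = 1 \/ p = -1 \/ p = 2 \/ p = -2 \/ p = 4 \/ p = -4.
  have p0 : p <> 0 by move=> p0; rewrite p0 mul0r in pq.
  have q0 : q <> 0 by move=> q0; rewrite q0 mulr0 in pq.
  have [q1|q1] : 1 <= q \/ q <= -1 by lia.
    have p1 : 1 <= p by nia.
    have p4 : p <= 4 by nia.
    have : p = 1 \/ p = 2 \/ p = 3 \/ p = 4 by lia.
    by case=> [->|[->|[p3|->]]]; auto 7; move: pq; rewrite p3; lia.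
  have p1 : p <= -1 by nia.
  have p4 : -4 <= p by nia.
  have : p = -1 \/ p = -2 \/ p = -3 \/ p = -4 by lia.
  by case=> [->|[->|[p3|->]]]; auto 7; move: pq; rewrite p3; lia.
case=> [p1|[p1|[p1|[p1|[p1|p1]]]]]; rewrite p1 in pE.
- case: no; exists y, (- 2 *: g); split=> //; first by apply: memvZ.
  rewrite yE scalerDr scalerA -pE scale1r scaleNr addrK //.
- case: no; exists (- y), (2 *: g); split; [exact: (rootN rs)|by apply: memvZ|].
  by rewrite yE opprD scalerDr !scalerN scalerA -pE mulrN1z scaleN1r opprK subrK.
- by left; lra.
- by right; lra.
- case: no; exists x, g; split=> //; have <- : c = 2 by lra.
  by rewrite -yE.
- case: no; exists x, (- g); split=> //; first by rewrite memvN.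
  have -> : 2 *: x - g = - y; last exact: (rootN rs).
  by rewrite yE opprD -scaleNr; congr (_ *: _ + _); lra.
Qed.

(** If 2x is a root but some root y in x + G has no double, y is used in place
of x: this is the third condition of a paired simple system. *)
Lemma good_pair : ~ reduced (quo_roots R G) -> exists x g, [/\ R x, g \in G, R (2 *: x + g) &
  R (2 *: x) -> forall y, R y -> y - x \in G -> R (2 *: y)].
Proof.
move=> /nonreduced_pair[x [g [Rx gG R2]]].
have [[y [Ry yx Ny]]|no] := EM (exists y, [/\ R y, y - x \in G & ~ R (2 *: y)]); last first.
  by exists x, g; split=> // _ y Ry yx; apply: contrapT => h; apply: no; exists y.
exists y, (g - 2 *: (y - x)); split=> //; first by apply: rpredB => //; apply: memvZ.
by rewrite scalerBr opprB addrCA [2 *: y + _]addrC subrK addrC.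
Qed.

(** A maximal doubled family through the root of [good_pair] gives f on eps_1,
..., eps_l. By irreducibility every root meets the family, so R lies in the sum
of its span and the radical. The vector b is chosen in the radical so that, by
[lattice_values], every root has an integral b-coordinate; the remaining
coordinate along a is then integral because it lies in Q(R) and G. *)
Lemma frame_exists : ~ reduced (quo_roots R G) ->
  exists l (f : 'Hom('rV[K]_l.+1, F)) a kappa, [/\ frame I R G f a kappa,
    exists n, fibre R f a Lg 0 n &
    fibre R f a Lg 0 0 -> forall n, fibre R f a Sh 0 n -> fibre R f a Lg 0 (2 * n)].
Proof.
move=> /good_pair[x [g [Rx gG R2x xgood]]].
case: (me) => -[_ [l1 _ sig]] Grad dimG [a an agen].
have [psd [N [dimN NE]]] := signature_psd sig.
have xn := rs_anisotropic rs Rx.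
set kappa := I x x in xn; have k0 : 0 < kappa by rewrite lt_def xn psd.
have g0 : I g g = 0 by apply: Grad.
have aQG : (zspan R `&` [set` G])%classic a by rewrite agen; apply: zspan_gen.
have [aQ /= aG] := aQG.
have GE : G = <[a]>%VS.
  apply/esym/eqP; rewrite eqEdim dimG dim_vline an leqnn andbT.
  by rewrite -memvE.
have N0 z y : z \in N -> I z y = 0 by move=> /NE z0; apply: form_null.
have N0r z y : z \in N -> I y z = 0 by move=> zN; rewrite formC N0.
have GN z : z \in G -> z \in N by move=> zG; apply/NE; apply: Grad.
have aN := GN _ aG.
have xd : doubled_root I R g kappa x by [].
have [es [fam xes esmax]] := doubled_family_max k0 xd.
have ued u : u \in es -> doubled_root I R g kappa u by exact: (df_doubled fam).
have ee u : u \in es -> I u u = kappa by move=> /ued[].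
have uv0 u v : u \in es -> v \in es -> u != v -> I u v = 0 by exact: (df_orth fam).
set l := size es.
have l0 : (0 < l)%N by rewrite /l; case: (es) xes.
have lin0 : linear (fun v : 'rV[K]_l.+1 => \sum_(i < l) v 0 (lift ord0 i) *: es`_i).
  move=> k v w; rewrite scaler_sumr -big_split; apply: eq_bigr => i _ /=.
  by rewrite !mxE scalerDl scalerA.
have [f0 f0E] := hom_of_linear lin0.
have f0Z k v : f0 (k *: v) = k *: f0 v by rewrite linearZ.
have f0D v w : f0 (v + w) = f0 v + f0 w by rewrite linearD.
have f0eps i : (i < l)%N -> f0 (unitv K l i.+1) = es`_i.
  move=> il; rewrite f0E (bigD1 (Ordinal il)) //= unitvE lift0 eqxx scale1r big1 ?addr0 // => j ji.
  by rewrite unitvE lift0 eqSS (_ : (j : nat) == i = false) ?scale0r //; apply/negbTE.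
have esE u : u \in es -> exists2 i, (1 <= i <= l)%N & u = f0 (unitv K l i).
  move=> ues; exists (index u es).+1; first by rewrite index_mem.
  by rewrite f0eps ?nth_index // index_mem.
have form0 v w : I (f0 v) (f0 w) = kappa * dot v w.
  rewrite !f0E form_suml mulr_sumr; apply: eq_bigr => i _.
  rewrite formC form_suml (bigD1 i) //= big1 ?addr0 => [|j ji]; rewrite formZl formZr.
    by rewrite ee ?mem_nth //; ring.
  by rewrite uv0 ?mem_nth ?mulr0 // nth_uniq // (df_uniq fam).
have shortE (s : bool) i : (1 <= i <= l)%N -> finite_roots Sh ((-1) ^+ s *: unitv K l i).
  by move=> il; exists i, s.
(* The roots that meet the family and those that are orthogonal to it are
   orthogonal to each other, so by irreducibility the latter do not exist. *)
have cover0 y : R y -> exists c z, finite_roots c z /\ y - f0 z \in N.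
  have caseN z : (exists u, [/\ u \in es, R z & I u z != 0]) -> exists c v,
    finite_roots c v /\ z - f0 v \in N.
    case=> u [ues Rz uz].
    case: (maximal_family_cases rs psd g0 k0 fam esmax Rz) => [h|h].
      by rewrite h ?eqxx in uz.
    case: h => [[v ves [s h]]|[v ves [s h]]|[v [w [s [t [ves wes vw h]]]]]].
    - have [i il vE] := esE v ves; exists Sh, ((-1) ^+ s *: unitv K l i); split;
      first exact: shortE.
      by apply/NE; rewrite f0Z -vE.
    - have [i il vE] := esE v ves; exists Lg, (2 *: ((-1) ^+ s *: unitv K l i)); split.
        by apply/longP; exists ((-1) ^+ s *: unitv K l i) => //; apply: shortE.
      by apply/NE; rewrite !f0Z -vE scalerA (mulrC 2) -scalerA.
    - have [i il vE] := esE v ves; have [j jl wE] := esE w wes.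
      exists Md, ((-1) ^+ s *: unitv K l i + (-1) ^+ t *: unitv K l j); split; last first.
        by apply/NE; rewrite f0D !f0Z -vE -wE.
      apply: middleD; [exact: shortE|exact: shortE|].
      rewrite dotZl dotZr dot_eps //; case: eqP => [ij|_]; last by rewrite !mulr0.
      by rewrite vE wE ij eqxx in vw.
  move=> Ry; apply: (caseN); apply: contrapT => noy.
  pose R1 := [set z | R z /\ exists2 u, u \in es & I u z != 0]%classic.
  pose R2 := [set z | R z /\ forall u, u \in es -> I u z = 0]%classic.
  have [|||R10|R20] := rs_irreducible rs (R1 := R1) (R2 := R2).
  - apply/seteqP; split=> z; last by case=> -[].
    move=> Rz; have [h|h] := EM (exists2 u, u \in es & I u z != 0); [by left|right].
    split=> // u ues; apply/eqP; apply: contrapT => /negP uz; apply: h; by exists u.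
  - apply/seteqP; split=> z // [[_ [u ues uz]] [_ h]].
    by rewrite h ?eqxx in uz.
  - move=> z w [Rz [u ues uz]] [_ wo].
    have [c [v [_ zv]]] : exists c v, finite_roots c v /\ z - f0 v \in N by apply: caseN; exists u.
    rewrite -[z](subrK (f0 v)) formDl (N0 _ _ zv) add0r f0E form_suml big1 // => i _.
    by rewrite formZl wo ?mulr0 ?mem_nth.
  - have : R1 x by split=> //; exists x; rewrite // ee // gt_eqF.
    by rewrite R10.
  - have : R2 y.
      split=> // u ues; apply/eqP; apply: contrapT => /negP uy; apply: noy; by exists u.
    by rewrite R20.
have [e eb Qe] := rs_lattice rs.
have f0span v : f0 v \in <<es>>%VS.
  by rewrite f0E; apply: memv_suml => i _; apply/memvZ/memv_span/mem_nth.
have Qspan z : zspan R z -> exists v, integral_vec v /\ z - f0 v \in N.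
  move: z; apply: zspan_ind => [|z w [v [vi zv]] [v' [vi' wv]]|z Rz].
  - exists 0; rewrite linear0 subr0 mem0v; split=> //; split=> [|j]; rewrite mxE //.
  - exists (v - v'); split; first exact: integral_vecD vi (integral_vecN vi').
    rewrite linearB /=; suff -> : z - w - (f0 v - f0 v') = (z - f0 v) - (w - f0 v') by apply:
      rpredB.
    by rewrite !opprB [LHS]addrACA [RHS]addrACA [- w - f0 v]addrC.
  - by have [c [v [/finite_rootsP[vi _] zv]]] := cover0 z Rz; exists v.
have FE : fullv = (<<es>> + N)%VS.
  apply/eqP; rewrite eqEsubv subvf andbT -(span_basis eb); apply/span_subvP => z ze.
  have [v [_ zv]] : exists v, integral_vec v /\ z - f0 v \in N.
    by apply: Qspan; rewrite Qe; apply: zspan_gen.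
  by rewrite -[z](subrK (f0 v)) addrC memv_add.
have esN : (<<es>> :&: N = 0)%VS.
  apply/eqP; rewrite -subv0; apply/subvP => z; rewrite memv_cap => /andP[zes zN].
  rewrite memv0 (coord_span (X := in_tuple es) zes); apply/eqP/big1 => i _.
  have := N0 z es`_i zN; rewrite {1}(coord_span (X := in_tuple es) zes) form_suml (bigD1 i) //=.
  rewrite big1 ?addr0 => [|j ji]; rewrite formZl.
    rewrite ee ?mem_nth // => /eqP; rewrite mulf_eq0 (gt_eqF k0) orbF => /eqP ->.
    by rewrite scale0r.
  by rewrite uv0 ?mem_nth ?mulr0 // nth_uniq // (df_uniq fam).
have fes := doubled_family_free k0 fam.
have dimF : \dim {:F} = l.+2.
  by rewrite FE dimv_disjoint_sum // dimN (eqP fes) -/l addn2.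
have NaE b : b \in N -> b \notin <[a]>%VS -> N = (<[a]> + <[b]>)%VS.
  move=> bN ba; apply/eqP; rewrite eq_sym eqEdim dimN.
  have bn : b != 0 by apply: contraNneq ba => ->; rewrite mem0v.
  rewrite subv_add -!memvE aN bN dimv_disjoint_sum ?dim_vline ?an ?bn //.
  apply/eqP; rewrite -subv0; apply/subvP => z; rewrite memv_cap => /andP[za /vlineP[k zE]].
  rewrite memv0 zE scaler_eq0; apply: contraT; rewrite negb_or => /andP[kn _].
  by case/negP: ba; rewrite -(scalerK kn b) memvZ // -zE.
have [b' b'N b'a] : exists2 b', b' \in N & b' \notin <[a]>%VS.
  apply: contrapT => no; have : (N <= <[a]>)%VS.
    by apply/subvP => z zN; apply: contrapT => /negP za; apply: no; exists z.
  by move/dimvS; rewrite dimN dim_vline an.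
(* tau is the b-coordinate up to a factor: it vanishes on the family and on a. *)
have [tau [tau0 taub']] : exists tau : 'Hom(F, K^o),
    (forall z, z \in (<<es>> + <[a]>)%VS -> tau z = 0) /\ tau b' != 0.
  apply: separating_form; apply/negP => /memv_addP[z zes [w /vlineP[k ->] b'E]].
  case/negP: b'a; rewrite b'E; suff -> : z = 0 by rewrite add0r memvZ ?memv_line.
  apply/eqP; rewrite -memv0 -esN memv_cap zes.
  by rewrite -[z](addrK (k *: a)) -b'E rpredB // memvZ.
have esQ u : u \in es -> zspan R u by move=> /ued[Ru _ _]; apply: zspan_gen.
have f0Q v : integral_vec v -> zspan R (f0 v).
  move=> [_ vi]; rewrite f0E; apply: zspan_sum => i _; have /intrP[k ->] := vi (lift ord0 i).
  by rewrite scaler_int; apply: zspanMz; apply: esQ; apply: mem_nth.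
have tauZ k v : tau (k *: v) = k * tau v by rewrite linearZ.
have tauD v w : tau (v + w) = tau v + tau w by rewrite linearD.
have tauB v w : tau (v - w) = tau v - tau w by rewrite linearB.
have tauf0 v : tau (f0 v) = 0 by apply: tau0; rewrite -[f0 v]addr0 memv_add ?mem0v.
have se : size e = l.+2 by rewrite -dimF (size_basis (X := in_tuple e) eb).
have taua : tau a = 0.
  by apply: tau0; apply: (subvP (addvSr _ _)); rewrite memv_line.
have hsize : size (es ++ [:: a]) == (size e).-1 by rewrite se size_cat addn1.
have [t [tn [x1 x1Q x1t] tQ]] : exists t : K, [/\ t != 0, exists2 x, zspan R x & tau x = t &
    forall x, zspan R x -> exists z : int, tau x = z%:~R * t].
  rewrite Qe; apply: (@lattice_values K F (size e) (in_tuple e) (Tuple hsize) b' tau eb).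
  - move=> z; rewrite mem_cat inE -Qe => /orP[/esQ //|/eqP -> //].
  - by rewrite FE (NaE _ b'N b'a) span_cat span_seq1 addvA.
  - move=> z; rewrite mem_cat inE => /orP[zes|/eqP ->] //.
    by apply: tau0; rewrite -[z]addr0 memv_add ?mem0v ?memv_span.
  - exact: taub'.
(* A lattice vector with the smallest value of tau, moved into the radical. *)
have [z1 [z1i bN]] := Qspan _ x1Q.
have [b bE] : exists b, b = x1 - f0 z1 by exists (x1 - f0 z1).
rewrite -bE in bN.
have bQ : zspan R b by rewrite bE; apply: zspanB => //; apply: f0Q.
have taub : tau b = t by rewrite bE tauB tauf0 x1t subr0.
have ba : b \notin <[a]>%VS.
  by apply/negP => /vlineP[k bk]; case/eqP: tn; rewrite -taub bk tauZ taua mulr0.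
have NE' := NaE _ bN ba.
have lin : linear (fun v : 'rV[K]_l.+1 => v 0 0 *: b + f0 v).
  move=> k v w; have -> : f0 (k *: v + w) = k *: f0 v + f0 w by rewrite linearP.
  by rewrite !mxE scalerDl -scalerA scalerDr addrACA.
have [f fE] := hom_of_linear lin.
have fZ k v : f (k *: v) = k *: f v by rewrite linearZ.
have fD v w : f (v + w) = f v + f w by rewrite linearD.
have f0b : f0 (unitv K l 0) = 0 by rewrite f0E big1 // => i _; rewrite unitvE lift0 scale0r.
have fb : f (unitv K l 0) = b by rewrite fE unitvE f0b addr0 scale1r.
have f_f0 (v : 'rV[K]_l.+1) : v 0 0 = 0 -> f v = f0 v by move=> v0; rewrite fE v0 scale0r add0r.
have finE c (y : 'rV[K]_l.+1) : finite_roots c y ->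
  f y = f0 y by move=> /finite_rootsP[[y0 _] _]; apply: f_f0.
have f0_eps i : (1 <= i <= l)%N -> f0 (unitv K l i) \in es.
  by case: i => // i /andP[_ il]; rewrite f0eps // mem_nth.
have Rs (s : bool) z : R z -> R ((-1) ^+ s *: z).
  by case: s; rewrite ?expr0 ?expr1 ?scale1r // scaleN1r; apply: (rootN rs).
have Rshort (y : 'rV[K]_l.+1) : finite_roots Sh y -> R (f0 y).
  move=> [i [s [il ->]]]; rewrite f0Z; apply: Rs.
  by have [] := ued _ (f0_eps i il).
have f0n i j : (1 <= i <= l)%N -> (1 <= j <= l)%N -> i != j -> f0 (unitv K l i) != f0 (unitv K l j).
  case: i j => // i [//|j] /andP[_ il] /andP[_ jl] ij.
  by rewrite !f0eps // nth_uniq // (df_uniq fam).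
have Rmiddle (y : 'rV[K]_l.+1) : finite_roots Md y -> R (f0 y).
  move=> [i [j [s [t' [i1 /andP[ij jl] ->]]]]].
  have [il jl' nij0] := middle_range i1 ij jl.
  have ui := f0_eps i il; have uj := f0_eps j jl'.
  have nij : f0 (unitv K l i) != f0 (unitv K l j) by apply: f0n.
  have Rd := df_diff fam ui uj nij.
  have [Rj jk _] := ued _ uj.
  have Rp : R (f0 (unitv K l i) + f0 (unitv K l j)).
    have := root_reflection rs Rj Rd; rewrite !formE (uv0 _ _ uj ui) 1?eq_sym // jk sub0r mulrN
      mulNr.
    rewrite mulfK ?gt_eqF // scaleNr opprK scaler_nat mulr2n addrA subrK; exact.
  have -> : f0 ((-1) ^+ s *: unitv K l i + (-1) ^+ t' *: unitv K l j) =
      (-1) ^+ s *: (f0 (unitv K l i) + (-1) ^+ (s (+) t') *: f0 (unitv K l j)).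
    rewrite f0D !f0Z scalerDr scalerA; congr (_ + _ *: _).
    by rewrite -signr_addb addbA addbb.
  apply: Rs; case: (s (+) t'); rewrite ?expr0 ?expr1 ?scale1r ?scaleN1r //.
have GQ z : zspan R z -> z \in G -> exists n : int, z = a *~ n.
  move=> zQ zG; apply/zspan1P; rewrite -agen; split=> //.
have aPos k : k *: a = 0 -> k = 0.
  by move=> /eqP; rewrite scaler_eq0 (negPf an) orbF => /eqP.
have fr : frame I R G f a kappa.
  split=> //.
- move=> v q e0.
  have vj (j : 'I_l) : v 0 (lift ord0 j) = 0.
    have ej := f0eps j (ltn_ord j).
    have := congr1 (fun z => I z (f0 (unitv K l j.+1))) e0; rewrite form0l fE.
    rewrite !formE (N0 b) // (N0 a) // form0 dotC dot_unit !mulr0 addr0 add0r => /eqP.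
    by rewrite mulf_eq0 (gt_eqF k0) => /eqP.
  have f0v : f0 v = 0 by rewrite f0E big1 // => j _; rewrite vj scale0r.
  move: e0; rewrite fE f0v addr0 => e0.
  have v0 : v 0 0 = 0.
    have := congr1 tau e0; rewrite tauD !tauZ taua taub mulr0 addr0 linear0 => /eqP.
    by rewrite mulf_eq0 (negPf tn) orbF => /eqP.
  split; last by apply: aPos; rewrite -e0 v0 scale0r add0r.
  by apply/rowP => j; rewrite mxE; case: (unliftP ord0 j) => [i ->|->].
- move=> z; have := memvf z; rewrite FE NE' => /memv_addP[u ues [w]].
  move=> /memv_addP[w1 /vlineP[k1 ->] [w2 /vlineP[k2 ->] ->] ->].
  exists (k2 *: unitv K l 0 + \sum_(i < l) coord (in_tuple es) i u *: unitv K l i.+1), k1.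
  have fu : f (\sum_(i < l) coord (in_tuple es) i u *: unitv K l i.+1) = u.
    rewrite linear_sum [RHS](coord_span (X := in_tuple es) ues); apply: eq_bigr => i _ /=.
    by rewrite fZ fE unitvE scale0r add0r f0eps.
  by rewrite fD fZ fb fu [LHS](AC (1*2) ((3*1)*2)).
- have red v q z : I (f v + q *: a) z = I (f0 v) z.
    have fN : f v + q *: a - f0 v \in N by rewrite fE addrAC addrK rpredD ?memvZ.
    by rewrite -{1}[f v + q *: a](subrK (f0 v)) formDl (N0 _ _ fN) add0r.
  by move=> v q w r; rewrite red formC red formC form0.
- move=> y Ry; have [c [z [zc zN]]] := cover0 y Ry; exists c, z.
  have [zi _] := finite_rootsP zc.
  have nQ : zspan R (y - f0 z) by apply: zspanB; [exact: zspan_gen|exact: f0Q].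
  have [m mE] := tQ _ nQ.
  have : y - f0 z - b *~ m \in N by rewrite rpredB // -scaler_int memvZ.
  rewrite NE' => /memv_addP[w1 /vlineP[k1 ->] [w2 /vlineP[k2 ->] wE]].
  have k20 : k2 = 0.
    have := congr1 tau wE; rewrite -scaler_int tauB mE tauD !tauZ taua taub.
    rewrite subrr mulr0 add0r => /esym/eqP; by rewrite mulf_eq0 (negPf tn) orbF => /eqP.
  rewrite k20 scale0r addr0 in wE.
  have [n nE] : exists n : int, k1 *: a = a *~ n.
    apply: GQ; last by rewrite GE memvZ ?memv_line.
    by rewrite -wE; apply: zspanB => //; apply: zspanMz.
  exists m, n; split=> //; rewrite (finE c) // fb -nE -wE.
  by rewrite addrACA -addrA addrA subrr addr0 addrC subrK.
- by move=> y yS; rewrite (finE Sh) //; apply: Rshort.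
- by move=> y yM; rewrite (finE Md) //; apply: Rmiddle.
- by rewrite fb.
have [i il xE] := esE x xes; pose y := unitv K l i.
have yS : finite_roots Sh y by have := shortE false i il; rewrite expr0 scale1r.
have yL : finite_roots Lg (2 *: y) by apply/longP; exists y.
have fy : f y = x by rewrite (finE Sh) // xE.
have ptS n : point f a y 0 n = x + a *~ n by rewrite /point fy mulr0z addr0.
have ptL n : point f a (2 *: y) 0 n = 2 *: x + a *~ n by rewrite /point fZ fy mulr0z addr0.
exists l, f, a, kappa; split=> //.
  have [n gn] : exists n : int, g = a *~ n.
    apply: GQ => //; rewrite -[g](addKr (2 *: x)); apply: zspanD; last exact: zspan_gen.
    by rewrite scaler_nat; apply: zspanN; apply: zspanMn; apply: zspan_gen.
  by exists n, (2 *: y) => //; rewrite ptL -gn.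
move=> /(fibreP rs fr 0 0 yL); rewrite ptL mulr0z addr0 => R2 n.
move=> /(fibreP rs fr 0 n yS); rewrite ptS => Rn.
exists (2 *: y) => //; rewrite ptL.
have := xgood R2 (x + a *~ n) Rn; rewrite addrAC subrr add0r scalerDr.
have -> : 2 *: (a *~ n) = a *~ (2 * n) by rewrite -!scaler_int scalerA -(intrM _ 2 n).
apply.
by rewrite GE -scaler_int memvZ // memv_line.
Qed.
End FrameExists.

(** * Node data computed in a frame *)
Lemma kind_markE X l i : (min_rank X <= l)%N -> (i <= l)%N -> (0 < l)%N ->
  kind_mark X (node_kind_of X l i) = node_mark X i.
Proof.
by case: X => /= lX il l0; rewrite /node_kind_of /node_mark; case: i il => [|[|i]] //= il;
  case: ltnP => //= h; lia.
Qed.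

Definition kind_eqb u v :=
  match u, v with N0, N0 | N1, N1 | Nm, Nm | Nl, Nl => true | _, _ => false end.
Lemma kind_eqP : Equality.axiom kind_eqb.
Proof. by case=> -[]; constructor. Qed.
HB.instance Definition _ := hasDecEq.Build node_kind kind_eqP.

Lemma kindsP X l u : (0 < l)%N -> (min_rank X <= l)%N ->
  (exists2 i, (i <= l)%N & node_kind_of X l i = u) <-> u \in kinds X l.
Proof.
move=> l0 lX; split.
  case=> i il <-; rewrite /node_kind_of /kinds; case: eqP => [_|i0]; first by case: (X).
  case: ltnP => il'; last by case: (X); rewrite /= !inE ?orbT.
  have l2 : (2 <= l)%N by lia.
  case: (X) => /=; rewrite ?l2 //.
  by case: (i =P 1%N) => [_|i1] //=; have -> : (3 <= l)%N by lia.
have [i0 i1] : (0 <= l)%N /\ (1 <= l)%N by [].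
case: u; rewrite /kinds => h.
- by exists 0%N.
- exists 1%N => //; rewrite /node_kind_of /=.
  case: (X) lX h => //= l2; first by case: ifP.
  + by case: ifP.
  + by rewrite l2.
  + by case: ifP.
- have [l2|l2] := leqP 2 l; last first.
    have l1 : l = 1%N by lia.
    by clear l2; subst l; case: X lX h.
  rewrite /node_kind_of; case XE : X h => /=.
  + by exists 1%N => //; rewrite l2.
  + by exists 1%N => //; rewrite l2.
  + by case: ifP => // l3 _; exists 2%N => //; rewrite l3.
  + by exists 1%N => //; rewrite l2.
- exists l => //; rewrite /node_kind_of ltnn; case: eqP => // l0'; lia.
Qed.

Section Realize.
Variables (K : realType) (F : vectType K) (I : {symmetric F}) (R : set F) (G : {vspace F}).

Section Coordinates.
Variables (l : nat) (f : 'Hom('rV[K]_l.+1, F)) (a : F) (kappa : K).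
Hypotheses (fr : frame I R G f a kappa).

Lemma memG_frame x : x \in G <-> exists k, x = k *: a.
Proof. by rewrite (fr_marking fr); split=> [/vlineP|[k ->]] //; rewrite memvZ ?memv_line. Qed.

Lemma frame_a_neq0 : a != 0.
Proof.
apply/eqP => a0; have [|_ /eqP] := fr_inj fr (v := 0) (q := 1); last by rewrite oner_eq0.
by rewrite linear0 a0 scaler0 addr0.
Qed.

Lemma frame_quotient : exists phi : 'Hom(quo G, 'rV[K]_l.+1),
  (forall v q, phi (proj G (f v + q *: a)) = v) /\ bijective phi.
Proof.
have [h hP] := boolp.choice (fr_surj fr).
have hE v q : h (f v + q *: a) = v.
  have [q' e] := hP (f v + q *: a).
  have /(fr_inj fr)[] : f (h (f v + q *: a) - v) + (q' - q) *: a = 0.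
    rewrite linearB scalerBl addrACA -opprD -e subrr //.
  by move=> /eqP; rewrite subr_eq0 => /eqP.
have lin : linear (fun u : quo G => h (vsval u)).
  move=> k u w; have [p up] := hP (vsval u); have [q wq] := hP (vsval w).
  have -> : vsval (k *: u + w) = f (k *: h (vsval u) + h (vsval w)) + (k * p + q) *: a.
    by rewrite !linearP /= {1}up {1}wq scalerDr scalerDl scalerA addrACA.
  exact: hE.
have [phi phiE] := hom_of_linear lin.
have phiP v q : phi (proj G (f v + q *: a)) = v.
  rewrite phiE; have := proj_sub G (f v + q *: a) => /memG_frame[k e].
  have -> : vsval (proj G (f v + q *: a)) = f v + (q - k) *: a.
    by rewrite scalerBl -e addrA opprB addrCA subrr addr0.
  exact: hE.
exists phi; split=> //; exists (fun v => proj G (f v)); last first.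
  by move=> v; rewrite -[f v]addr0 -(scale0r a) phiP.
move=> u; have [x ->] := proj_surj u; have [v [q ->]] := fr_surj fr x.
rewrite phiP; apply/proj_eq; apply/memG_frame; exists (- q).
by rewrite opprD addrA subrr add0r scaleNr.
Qed.

Lemma proj_inj v w q r : proj G (f v + q *: a) = proj G (f w + r *: a) -> v = w.
Proof.
have [phi [phiE _]] := frame_quotient.
by move=> e; rewrite -(phiE v q) e phiE.
Qed.

Lemma proj_frame v q : proj G (f v + q *: a) = proj G (f v).
Proof. by apply/proj_eq/memG_frame; exists q; rewrite addrAC subrr add0r. Qed.

End Coordinates.

(** Split into finite part and multiple of b, the simple roots become points of
the frame. *)
Lemma affine_simple_decomp l X i : (0 < l)%N -> (min_rank X <= l)%N -> (i <= l)%N ->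
  exists2 y, finite_roots (kind_len X (node_kind_of X l i)) y &
    affine_simple K l X i = y + unitv K l 0 *~ kind_b (node_kind_of X l i).
Proof.
move=> l0 lX il; rewrite /node_kind_of /affine_simple.
have diff k : (1 <= k)%N -> (k < l)%N -> finite_roots Md (unitv K l k - unitv K l k.+1).
  move=> k1 kl; exists k, k.+1, false, true; rewrite expr0 expr1 scale1r scaleN1r; split=> //.
  by rewrite ltnS leqnn.
have sh k : (1 <= k)%N -> (k <= l)%N -> finite_roots Sh (unitv K l k).
  by move=> k1 kl; exists k, false; rewrite expr0 scale1r k1.
have shN k : (1 <= k)%N -> (k <= l)%N -> finite_roots Sh (- unitv K l k).
  by move=> k1 kl; apply/finite_rootsN/sh.
case: eqP => [_|i0].
  case: X lX => lX /=.
  - exists (- (2 *: unitv K l 1)); last by rewrite addrC.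
    by apply: (@finite_rootsN _ _ Lg); apply/longP; exists (unitv K l 1) => //; apply: sh.
  - by exists (- unitv K l 1); [apply: shN|rewrite addrC].
  - exists (- unitv K l 1 - unitv K l 2); last by rewrite [RHS]addrC addrA.
    by exists 1%N, 2%N, true, true; rewrite !expr1 !scaleN1r.
  - by exists (- unitv K l 1); [apply: shN|rewrite addrC].
case: ltnP => il'.
  exists (unitv K l i - unitv K l i.+1).
    by case: X lX => lX; try case: eqP => _; apply: diff => //; lia.
  by case: X lX => lX; try case: eqP => _; rewrite /= mulr0z addr0.
exists (unitv K l l); last by rewrite mulr0z addr0.
by apply: sh.
Qed.

Section Table.
Variables (l : nat) (T : table).
Variables (f : 'Hom('rV[K]_l.+1, F)) (a : F) (kappa : K).
Hypotheses (rs : root_system I R) (fr : frame I R G f a kappa) (Tf : tabulates R f a T).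
Local Notation pt := (point f a).
Local Notation eps0 := (unitv K l 0).

Lemma point_add y m n j : pt y m n + a *+ j = pt y m (n + j%:Z).
Proof. by rewrite /point mulrzDr addrA. Qed.

Lemma point_proj y m n : proj G (pt y m n) = proj G (f (y + eps0 *~ m)).
Proof. by rewrite pointE (proj_frame fr). Qed.

Lemma proj_fZ k v : k *: proj G (f v) = proj G (f (k *: v)).
Proof. by rewrite !linearZ. Qed.

Lemma tableP c y m n : finite_roots c y -> R (pt y m n) <-> T c (res m) (res n).
Proof. by move=> yc; apply: Tf. Qed.

Lemma root_double c y m n : finite_roots c y ->
  R (2 *: pt y m n) <-> c = Sh /\ T Lg (res (2 * m)) (res (2 * n)).
Proof.
move=> yc; have E : 2 *: pt y m n = pt (2 *: y) (2 * m) (2 * n).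
  rewrite /point !scalerDr linearZ -!scaler_int !scalerA.
  by rewrite -!(intrM _ 2).
rewrite E; split=> [Rx|[cS Tx]].
  have [d [z [p [q [zd xE]]]]] := fr_cover fr Rx; rewrite -/(point f a z p q) in xE.
  have [[y0 _] yn] := finite_rootsP yc; have [[z0 _] zn] := finite_rootsP zd.
  have y20 : (2 *: y) 0 0 = 0 by rewrite mxE y0 mulr0.
  have [yz mp nq] := point_inj fr y20 z0 xE.
  have cS : c = Sh.
    have := congr1 (fun v => dot v v) yz; rewrite !dotE yn zn -!natrM => /eqP; rewrite eqr_nat.
    by case: (c) (d) => [] [].
  split=> //; apply/(tableP _ _ (_ : finite_roots Lg (2 *: y))) => //.
  by apply/longP; exists y => //; rewrite -cS.
apply/(tableP _ _ (_ : finite_roots Lg (2 *: y))) => //.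
by apply/longP; exists y => //; rewrite -cS.
Qed.

Lemma root_half c y m n : finite_roots c y ->
  R (2^-1 *: pt y m n) -> c = Lg /\ exists m' n' : int, [/\ m = 2 * m',
    n = 2 * n' & T Sh (res m') (res n')].
Proof.
move=> yc Rx; have [d [z [p [q [zd xE]]]]] := fr_cover fr Rx; rewrite -/(point f a z p q) in xE.
have E : pt y m n = pt (2 *: z) (2 * p) (2 * q).
  rewrite -[LHS](scalerK (_ : (2^-1 : K) != 0)) ?invr_neq0 ?pnatr_eq0 // invrK xE.
  rewrite /point !scalerDr linearZ -!scaler_int !scalerA.
  by rewrite -!(intrM _ 2).
have [[y0 _] yn] := finite_rootsP yc; have [[z0 _] zn] := finite_rootsP zd.
have z20 : (2 *: z) 0 0 = 0 by rewrite mxE z0 mulr0.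
have [yz mp nq] := point_inj fr y0 z20 E.
have [cL dS] : c = Lg /\ d = Sh.
  have := congr1 (fun v => dot v v) yz; rewrite !dotE yn zn -!natrM => /eqP; rewrite eqr_nat.
  by case: (c) (d) => [] [].
split=> //; exists p, q; split=> //; rewrite dS in zd.
by apply/(tableP p q zd); rewrite -xE.
Qed.

End Table.

Lemma step_res X c (m : int) : (step X c %| m)%Z = (step X c %| res m)%N.
Proof. by rewrite /res; case: c X => [] [] /=; apply/idP/idP; lia. Qed.

Section Row.
Variable t : row_label.
Hypothesis tv : valid_row t.
Local Notation X := (row_type t).
Local Notation l := (row_rank t).
Local Notation T := (row_table t).
Variables (f : 'Hom('rV[K]_l.+1, F)) (a : F) (kappa : K).
Hypotheses (rs : root_system I R) (fr : frame I R G f a kappa) (Tf : tabulates R f a T).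
Local Notation pt := (point f a).
Local Notation eps0 := (unitv K l 0).

Lemma row_rank_ge : (min_rank X <= l)%N. Proof. by case/andP: tv. Qed.

Lemma row_step c m : (m < 4)%N -> has (T c m) residues = (step X c %| m)%N.
Proof.
move=> m4; have /and5P[_ _ /allP h _ _] := row_fact_valid tv.
have cin : c \in [:: Sh; Md; Lg] by case: (c).
have /allP/(_ m) := h _ cin; rewrite !inE; case: m m4 => [|[|[|[|//]]]] _ /(_ isT)/eqP //.
Qed.

(** The quotient of R is the affine root system because the table projects to
it. *)
Lemma quo_rootsP v : quo_roots R G (proj G (f v)) <-> affine_roots X v.
Proof.
split=> [[x Rx e]|/affine_rootsP[c [y [m [yc sm ->]]]]].
  have [c [y [m [n [yc xE]]]]] := fr_cover fr Rx; rewrite -/(point f a y m n) in xE.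
  have /proj_inj : proj G (f (y + eps0 *~ m) + n%:~R *: a) = proj G (f v + 0 *: a).
    by rewrite -pointE -xE e scale0r addr0.
  move=> /(_ kappa fr) <-; apply/affine_rootsP; exists c, y, m; split=> //.
  rewrite step_res -row_step ?res_lt //; apply/hasP; exists (res n); last first.
    by apply/(Tf m n yc); rewrite -xE.
  by have := res_lt n; case: (res n) => [|[|[|[|]]]].
move: sm; rewrite step_res -row_step ?res_lt // => /hasP[n n4 Tn].
exists (pt y m n); last by rewrite (point_proj fr).
apply/(Tf m n yc); suff -> : res n = n by [].
by rewrite res_nat modn_small //; move: n4; rewrite !inE; lia.
Qed.

End Row.
End Realize.

Lemma tcountP (T : table) c m n : (n < 4)%N -> T c m n ->
  [/\ (0 < tcount T c m n)%N, T c m ((n + tcount T c m n) %% 4)%N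
    & forall j, (0 < j)%N -> T c m ((n + j) %% 4)%N -> (tcount T c m n <= j)%N].
Proof.
move=> n4 Tn; rewrite /tcount.
case E1: (T c m ((n + 1) %% 4)%N); first by split.
case E2: (T c m ((n + 2) %% 4)%N).
  by split=> // -[|[|j]] // _; rewrite E1.
case E3: (T c m ((n + 3) %% 4)%N).
  by split=> // -[|[|[|j]]] // _; rewrite ?E1 ?E2.
split=> //; first by rewrite modnDr modn_small.
by case=> [|[|[|[|j]]]] // _; rewrite ?E1 ?E2 ?E3.
Qed.

(** Among the roots at or below 2 alpha the nearest one is the one whose
successor lies strictly above 2 alpha, as the definition of alpha' asks. *)
Lemma tprimeP (T : table) m : tdouble T m ->
  [/\ (tprime T m < 4)%N, T Lg (m.*2 %% 4)%N (tprime_res T m),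
      forall n, (n < tprime T m)%N -> T Lg (m.*2 %% 4)%N ((4 - n) %% 4)%N = false
    & (tprime T m < tprime_count T m)%N].
Proof.
rewrite /tdouble /tprime_count /tprime_res /tprime /= orbF.
case E0: (T Lg (m.*2 %% 4)%N 0).
  by move=> _; split=> //; have [] := @tcountP T Lg (m.*2 %% 4)%N 0%N isT E0.
case E3: (T Lg (m.*2 %% 4)%N 3).
  move=> _; split=> //; first by case.
  by rewrite /tcount /= E0; case: ifP => //; case: ifP.
case E2: (T Lg (m.*2 %% 4)%N 2).
  move=> _; split=> //; first by case=> [|[]].
  by rewrite /tcount /= E0 E3; case: ifP.
rewrite !orbF /= => E1; split=> //; first by case=> [|[|[]]].
by rewrite /tcount /= E0 E2 E3.
Qed.

Section Realize.
Variables (K : realType) (F : vectType K) (I : {symmetric F}) (R : set F) (G : {vspace F}).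
Variables (l : nat) (T : table).
Variables (f : 'Hom('rV[K]_l.+1, F)) (a : F) (kappa : K).
Hypotheses (rs : root_system I R) (fr : frame I R G f a kappa) (Tf : tabulates R f a T).
Local Notation pt := (point f a).
Local Notation eps0 := (unitv K l 0).
Implicit Types (y z : 'rV[K]_l.+1).

Let an : a != 0 := frame_a_neq0 fr.

Lemma point_inj_a y m n n' : pt y m n = pt y m n' -> n = n'.
Proof.
move=> /addrI /eqP; rewrite -subr_eq0 -mulrzBr -scaler_int scaler_eq0 (negPf an) orbF intr_eq0.
by rewrite subr_eq0 => /eqP.
Qed.

Lemma table_nat c y (m n : nat) : finite_roots c y -> R (pt y m n) <-> T c (m %% 4)%N (n %% 4)%N.
Proof. by move=> yc; rewrite (Tf _ _ yc) !res_nat. Qed.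

Lemma counting_point c y m n : finite_roots c y -> R (pt y m n) ->
  counting R a (pt y m n) = tcount T c (res m) (res n).
Proof.
move=> yc Ry; have Tmn := (Tf m n yc).1 Ry.
have [k0 kT kmin] := tcountP (res_lt n) Tmn; set k := tcount _ _ _ _ in k0 kT kmin *.
have RT j : R (pt y m n + a *+ j) <-> T c (res m) ((res n + j) %% 4)%N.
  by rewrite point_add (Tf _ _ yc) resD res_nat modnDmr.
apply: xget_unique.
  by split=> //; [apply/RT|move=> j j0 /RT; apply: kmin].
move=> k' [k'0 /RT k'T k'min]; apply/eqP; rewrite eqn_leq kmin // andbT.
by apply: k'min => //; apply/RT.
Qed.

Lemma counting_spec c y m n : finite_roots c y -> R (pt y m n) ->
  [/\ (0 < counting R a (pt y m n))%N, R (pt y m n + a *+ counting R a (pt y m n)) &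
    forall j, (0 < j)%N -> R (pt y m n + a *+ j) -> (counting R a (pt y m n) <= j)%N].
Proof.
move=> yc Ry; have Tmn := (Tf m n yc).1 Ry; rewrite (counting_point yc Ry).
have [k0 kT kmin] := tcountP (res_lt n) Tmn.
have RT j : R (pt y m n + a *+ j) <-> T c (res m) ((res n + j) %% 4)%N.
  by rewrite point_add (Tf _ _ yc) resD res_nat modnDmr.
by split=> //; [apply/RT|move=> j j0 /RT; apply: kmin].
Qed.

Lemma proj_double y m n n' : 2 *: proj G (pt y m n) = proj G (pt (2 *: y) (2 * m) n').
Proof.
rewrite !(point_proj fr) proj_fZ scalerDr -scaler_int scalerA -scaler_int.
by rewrite -(intrM _ 2).
Qed.

Lemma quo_double c y m n : finite_roots c y ->
  quo_roots R G (2 *: proj G (pt y m n)) <-> c = Sh /\ has (T Lg (res (2 * m))) residues.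
Proof.
move=> yc; have [[y0 _] yn] := finite_rootsP yc.
have E n' := proj_double y m n n'.
split=> [[x Rx]|[cS /hasP[n' n4 Tn]]].
  have [d [z [p [q [zd xE]]]]] := fr_cover fr Rx; rewrite -/(point f a z p q) in xE.
  rewrite (E 0) xE !pointE => /(proj_inj fr) zE.
  have [[z0 _] zn] := finite_rootsP zd.
  have y20 : (2 *: y) 0 0 = 0 by rewrite mxE y0 mulr0.
  have [zy pm _] : [/\ z = 2 *: y, p = 2 * m & q = q].
    by apply: (point_inj fr) => //; rewrite !pointE zE.
  have [cS dL] : c = Sh /\ d = Lg.
    have := congr1 (fun v => dot v v) zy; rewrite !dotE yn zn -!natrM => /eqP; rewrite eqr_nat.
    by case: (c) (d) => [] [].
  split=> //; apply/hasP; exists (res q).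
    by have := res_lt q; case: (res q) => [|[|[|[|]]]].
  by rewrite -pm -dL; apply/(Tf p q zd); rewrite -xE.
have y2 : finite_roots Lg (2 *: y) by apply/longP; exists y; rewrite -?cS.
rewrite (E n'); exists (pt (2 *: y) (2 * m) n') => //.
apply/(Tf _ _ y2); rewrite res_nat modn_small //; move: n4; rewrite !inE; lia.
Qed.

Lemma quo_half c y m n : finite_roots c y ->
  quo_roots R G (2^-1 *: proj G (pt y m n)) -> c = Lg /\ exists m', m = 2 * m'.
Proof.
move=> yc [x Rx xE]; have [d [z [p [q [zd xpt]]]]] := fr_cover fr Rx.
rewrite -/(point f a z p q) in xpt; have [[y0 _] yn] := finite_rootsP yc.
have [[z0 _] zn] := finite_rootsP zd.
have : proj G (pt y m n) = proj G (pt (2 *: z) (2 * p) 0).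
  have -> : proj G (pt y m n) = 2 *: proj G x.
    by rewrite xE scalerA divff ?pnatr_eq0 // scale1r.
  by rewrite xpt (proj_double z p q 0).
rewrite !pointE => /(proj_inj fr) E.
have z20 : (2 *: z) 0 0 = 0 by rewrite mxE z0 mulr0.
have [yz mp _] : [/\ y = 2 *: z, m = 2 * p & 0 = 0 :> int].
  by apply: (point_inj fr) => //; rewrite !pointE E.
split; last by exists p.
have := congr1 (fun v => dot v v) yz; rewrite !dotE yn zn -!natrM => /eqP; rewrite eqr_nat.
by case: (c) (d) => [] [].
Qed.

Section Node.
Variables (c : len) (y : 'rV[K]_l.+1) (m : nat).
Hypotheses (yc : finite_roots c y) (Ry : R (pt y m 0)).
Let alpha := pt y m 0.

Lemma res_double : res (2 * m%:Z) = (m.*2 %% 4)%N.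
Proof. by rewrite -(PoszM 2 m) res_nat mul2n. Qed.

Let nodedoubled := (c == Sh) && tdouble T m.

Lemma node_doubledP : quo_roots R G (2 *: proj G alpha) <-> nodedoubled.
Proof.
rewrite /alpha (quo_double m%:Z 0 yc) res_double /nodedoubled /tdouble.
by split=> [[cS ->]|/andP[/eqP cS ->]]; rewrite ?cS ?eqxx.
Qed.

Lemma point_sub2 n : 2 *: alpha - a *+ n = pt (2 *: y) (2 * m%:Z) (- n%:Z).
Proof.
rewrite /alpha /point !scalerDr linearZ mulr0z scaler0 !addr0 mulrNz -!scaler_int scalerA.
by rewrite -(intrM _ 2) !scaler_int.
Qed.
Lemma point_add2 n : 2 *: alpha + a *+ n = pt (2 *: y) (2 * m%:Z) n%:Z.
Proof.
rewrite /alpha /point !scalerDr linearZ mulr0z scaler0 !addr0 -!scaler_int scalerA.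
by rewrite -(intrM _ 2) !scaler_int.
Qed.

Lemma res_opp n : (n < 4)%N -> res (- n%:Z) = ((4 - n) %% 4)%N.
Proof. by move=> n4; rewrite /res; lia. Qed.

Let y2 : nodedoubled -> finite_roots Lg (2 *: y).
Proof. by case/andP => /eqP cS _; apply/longP; exists y; rewrite -?cS. Qed.

(** The choices in the definition of alpha' are unique: of two candidates the
smaller one would have its successor at or below 2 alpha. *)
Lemma prime_root_doubled : nodedoubled ->
  prime_root R G a alpha = pt (2 *: y) (2 * m%:Z) (- (tprime T m)%:Z) /\
  R (pt (2 *: y) (2 * m%:Z) (- (tprime T m)%:Z)) /\
  star R a (prime_root R G a alpha) = pt (2 *: y) (2 * m%:Z) (tprime_count T m - tprime T m)%N%:Z.
Proof.
move=> nd; have /andP[_ dT] := nd; have [n4 Tn nmin ncnt] := tprimeP dT.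
set n0 := tprime T m in n4 Tn nmin ncnt *; set k0 := tprime_count T m in ncnt *.
have R0 : R (pt (2 *: y) (2 * m%:Z) (- n0%:Z)).
  by apply/(Tf _ _ (y2 nd)); rewrite res_double res_opp.
have cnt0 : counting R a (pt (2 *: y) (2 * m%:Z) (- n0%:Z)) = k0.
  by rewrite (counting_point (y2 nd) R0) res_double res_opp.
have star0 : star R a (pt (2 *: y) (2 * m%:Z) (- n0%:Z)) = pt (2 *: y) (2 * m%:Z) (k0 - n0)%N%:Z.
  rewrite /star cnt0 point_add; congr point; rewrite -subzn ?(ltnW ncnt) //; lia.
suff prE : prime_root R G a alpha = pt (2 *: y) (2 * m%:Z) (- n0%:Z) by rewrite prE.
rewrite /prime_root; have -> : `[< quo_roots R G (2 *: proj G alpha) >] = true.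
  by apply/asboolP/node_doubledP.
apply: xget_unique.
  split=> //.
  - by rewrite /alpha (proj_double y m 0 (- n0%:Z)).
  - by exists n0; rewrite point_sub2.
  - exists (k0 - n0).-1; rewrite star0 prednK ?subn_gt0 // -point_add2 //.
move=> z [Rz _ [n zE] [n' zS]]; rewrite zE point_sub2; congr point; congr (- _%:Z).
rewrite zE point_sub2 in Rz zS.
have [k1 k2 k3] := counting_spec (y2 nd) Rz.
have kE : counting R a (pt (2 *: y) (2 * m%:Z) (- n%:Z)) = (n + n'.+1)%N.
  move: zS; rewrite /star point_add point_add2 => /point_inj_a; lia.
have [nn0|nn0|//] := ltngtP n n0.
  have n_4 : (n < 4)%N by lia.
  have := nmin n nn0; have := (Tf _ _ (y2 nd)).1 Rz.
  by rewrite res_double res_opp // => ->.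
have := k3 (n - n0)%N; rewrite subn_gt0 nn0 => /(_ isT).
rewrite point_add kE (_ : - n%:Z + (n - n0)%N%:Z = - n0%:Z);
  last by rewrite -subzn ?(ltnW nn0) //; lia.
by move=> /(_ R0); lia.
Qed.

Lemma prime_root_single : ~~ nodedoubled ->
  prime_root R G a alpha = alpha /\
  star R a (prime_root R G a alpha) = pt y m (tcount T c (m %% 4)%N 0)%:Z.
Proof.
move=> nd; have prE : prime_root R G a alpha = alpha.
  rewrite /prime_root; case: asboolP => // /node_doubledP h.
  by rewrite h in nd.
rewrite prE; split=> //; rewrite /star /alpha (counting_point yc Ry) point_add add0r.
by rewrite res_nat.
Qed.

Let proj_neq0 : proj G alpha != 0.
Proof.
apply/eqP; rewrite /alpha pointE => e.
have := @proj_inj _ _ _ _ _ _ _ _ _ fr (y + eps0 *~ m) 0 (0%:~R) 0.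
rewrite e linear0 scale0r addr0 linear0 => /(_ erefl) v0.
have := congr1 (fun v => dot v v) v0; rewrite -scaler_int !dotE !dotb !dotbr !mulr0 !addr0.
have [_ ->] := finite_rootsP yc; have -> : dot (0 : 'rV[K]_l.+1) 0 = 0 by rewrite -(scale0r (0 :
  'rV[K]_l.+1)) dotZl mul0r.
by move=> /eqP; rewrite pnatr_eq0; case: (c).
Qed.

(** Both cases are written over the denominator 2: over a doubled root, 2 alpha
= alpha'^* - (2 k^nr) a. *)
Lemma knrE : knr R G a alpha =
  (if nodedoubled then tprime_count T m - tprime T m else (tcount T c (m %% 4) 0).*2)%N%:R / 2.
Proof.
have ratioE (x : F) (r : K) : proj G alpha = r *: proj G x -> proj G x != 0 ->
  Defs.ratio G alpha x = r.
  move=> xr xn; apply: xget_unique => // s /=; rewrite xr => /eqP.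
  by rewrite -subr_eq0 -scalerBl scaler_eq0 (negPf xn) orbF subr_eq0 => /eqP.
have akE (k k' : K) : k *: a = k' *: a -> k = k'.
  by move=> /eqP; rewrite -subr_eq0 -scalerBl scaler_eq0 (negPf an) orbF subr_eq0 => /eqP.
rewrite /knr; case: ifP => nd.
  have [_ [_ ->]] := prime_root_doubled nd; set s := (_ - _)%N.
  have pE : proj G (pt (2 *: y) (2 * m%:Z) s) = 2 *: proj G alpha.
    by rewrite /alpha (proj_double y m 0 s).
  rewrite (@ratioE _ 2^-1); last first.
  - by rewrite pE scaler_eq0 pnatr_eq0.
  - by rewrite pE scalerA mulVf ?pnatr_eq0 // scale1r.
  have E : 2^-1 *: pt (2 *: y) (2 * m%:Z) s = alpha + (s%:R / 2) *: a.
    rewrite -point_add2 scalerDr scalerA mulVf ?pnatr_eq0 // scale1r; congr (_ + _).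
    by rewrite -scaler_nat scalerA mulrC.
  apply: xget_unique => [|k /=]; first by rewrite /= E addrK.
  by rewrite E -addrA => /eqP; rewrite -subr_eq0 opprD addrA subrr add0r opprB subr_eq0 => /eqP/akE.
have [_ ->] := prime_root_single (negbT nd); set s := tcount _ _ _ _.
have pE : proj G (pt y m s) = proj G alpha by rewrite !(point_proj fr).
rewrite (@ratioE _ 1) ?pE ?scale1r //.
have E : pt y m s = alpha + s%:R *: a.
  by rewrite /alpha -[s%:Z]add0r -point_add scaler_nat.
have -> : s.*2%:R / 2 = s%:R :> K by rewrite -muln2 natrM mulfK ?pnatr_eq0.
apply: xget_unique => [|k /=]; first by rewrite /= E addrK.
by rewrite E -addrA => /eqP; rewrite -subr_eq0 opprD addrA subrr add0r opprB subr_eq0 => /eqP/akE.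
Qed.

Lemma node_colorE : (c = Lg -> odd m) -> node_color R G alpha =
  if nodedoubled then if T Lg (m.*2 %% 4)%N 0 then Black else Gray else White.
Proof.
move=> cm; have nhalf : ~ R (2^-1 *: alpha).
  move=> /(root_half fr Tf yc)[cL [m' [_ [mm _ _]]]].
  by have := cm cL; lia.
have nqhalf : ~ quo_roots R G (2^-1 *: proj G alpha).
  by move=> /(quo_half yc)[cL [m' mm]]; have := cm cL; lia.
have R2 : R (2 *: alpha) <-> c = Sh /\ T Lg (m.*2 %% 4)%N 0.
  by rewrite /alpha (root_double fr Tf m 0 yc) res_double mulr0.
rewrite /node_color; case nd: nodedoubled.
  have /andP[/eqP cS _] := nd.
  case T0: (T Lg (m.*2 %% 4)%N 0); first by rewrite asboolT //; left; apply/R2.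
  rewrite asboolF; last by case=> // /R2[_]; rewrite T0.
  by rewrite asboolT //; left; apply/node_doubledP.
rewrite asboolF; last first.
  case=> // /R2[cS T0]; move: nd; rewrite /nodedoubled cS eqxx /= => /hasP[].
  by exists 0%N.
by rewrite asboolF // => -[/node_doubledP|//]; rewrite nd.
Qed.

Lemma star_colorE : (c = Lg -> odd m) -> node_color R G (star R a (prime_root R G a alpha)) =
  if nodedoubled then
    let s := (tprime_count T m - tprime T m)%N in
    if ~~ odd s && T Sh (m %% 4)%N (s./2 %% 4)%N then Black else Gray
  else White.
Proof.
move=> cm; case: ifP => nd.
  have /andP[/eqP cS dT] := nd; have [_ [R0 sE]] := prime_root_doubled nd.
  rewrite sE; set s := (_ - _)%N => /=.
  have L2 := y2 nd; have yS : finite_roots Sh y by rewrite -cS.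
  have half : R (2^-1 *: pt (2 *: y) (2 * m%:Z) s) <-> ~~ odd s && T Sh (m %% 4)%N (s./2 %% 4)%N.
    split.
      move=> /(root_half fr Tf L2)[_ [m' [n' [mm nn Tn]]]].
      have -> : odd s = false by lia.
      have e1 : m' = m by lia.
      have e2 : n' = s./2 by lia.
      by move: Tn; rewrite e1 e2 !res_nat.
    move=> /andP[so Ts]; have -> : 2^-1 *: pt (2 *: y) (2 * m%:Z) s = pt y m (s./2)%:Z.
      have -> : (s : int) = 2 * (s./2)%:Z by lia.
      rewrite /point linearZ -!scaler_int !intrM !scalerDr !scalerA !mulrA.
      by rewrite mulVf ?pnatr_eq0 // !mul1r scale1r.
    by apply/(table_nat _ _ yS).
  have dbl : ~ R (2 *: pt (2 *: y) (2 * m%:Z) s).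
    by move=> /(root_double fr Tf _ _ L2)[].
  rewrite /node_color; case h: (~~ odd s && _); first by rewrite asboolT //; right; apply/half.
  rewrite asboolF; last by case=> // /half; rewrite h.
  rewrite asboolT //; right; exists alpha => //.
  rewrite !(point_proj fr) proj_fZ scalerDr scalerA mulVf ?pnatr_eq0 // scale1r.
  by rewrite -!scaler_int scalerA intrM mulrA mulVf ?pnatr_eq0 // mul1r.
have [_ ->] := prime_root_single (negbT nd); set s := tcount _ _ _ _.
have nhalf : ~ R (2^-1 *: pt y m s).
  move=> /(root_half fr Tf yc)[cL [m' [_ [mm _ _]]]].
  by have := cm cL; lia.
have nqhalf : ~ quo_roots R G (2^-1 *: proj G (pt y m s)).
  by move=> /(quo_half yc)[cL [m' mm]]; have := cm cL; lia.
have nq : ~ quo_roots R G (2 *: proj G (pt y m s)).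
  by rewrite !(point_proj fr) -(point_proj fr y m 0) => /node_doubledP; rewrite nd.
have n2 : ~ R (2 *: pt y m s).
  by move=> h; apply: nq; exists (2 *: pt y m s) => //; rewrite linearZ.
by rewrite /node_color asboolF ?asboolF //; case.
Qed.

Lemma star_countingE : counting R a (star R a (prime_root R G a alpha)) =
  if nodedoubled then tcount T Lg (m.*2 %% 4)%N ((tprime_res T m + tprime_count T m) %% 4)%N
  else tcount T c (m %% 4)%N (tcount T c (m %% 4)%N 0 %% 4)%N.
Proof.
case: ifP => nd.
  have [_ [R0 sE]] := prime_root_doubled nd; rewrite sE; have L2 := y2 nd.
  have /andP[_ /tprimeP[n4 Tn _ ncnt]] := nd.
  have rE : res (tprime_count T m - tprime T m)%N%:Z = ((tprime_res T m + tprime_count T m) %% 4)%N.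
    by rewrite res_nat /tprime_res; lia.
  rewrite (counting_point L2) ?res_double ?rE //.
  apply/(Tf _ _ L2); rewrite res_double rE.
  by have [] := tcountP (@ltn_pmod _ 4 isT) Tn.
have [_ ->] := prime_root_single (negbT nd).
rewrite (counting_point yc) ?res_nat //.
have T0 : T c (m %% 4)%N 0 by have := (Tf m 0 yc).1 Ry; rewrite res_nat.
apply/(Tf _ _ yc); rewrite !res_nat.
by have [] := @tcountP T c (m %% 4)%N 0%N isT T0.
Qed.

End Node.
End Realize.

(** * A frame realizes the row of its table *)
Section Nodes.
Variables (K : realType) (F : vectType K) (I : {symmetric F}) (R : set F) (G : {vspace F}).
Variables (l : nat) (T : table) (X : affine_type).
Variables (f : 'Hom('rV[K]_l.+1, F)) (a : F) (kappa : K).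
Hypotheses (fr : frame I R G f a kappa) (Tf : tabulates R f a T).
Hypothesis lX : (min_rank X <= l)%N.
Local Notation pt := (point f a).
Local Notation eps0 := (unitv K l 0).
Let l0 : (0 < l)%N := fr_rank fr.

Lemma simple_point i : (i <= l)%N ->
  exists2 y, finite_roots (kind_len X (node_kind_of X l i)) y &
    f (affine_simple K l X i) = pt y (kind_b (node_kind_of X l i)) 0.
Proof.
move=> il; have [y yc e] := affine_simple_decomp K l0 lX il.
by exists y => //; rewrite e pointE scale0r addr0.
Qed.

Lemma kind_odd u : kind_len X u = Lg -> odd (kind_b u).
Proof. by case: u => //; case: (X). Qed.

Lemma node_dataP i (u := node_kind_of X l i) (x := f (affine_simple K l X i)) :
  (i <= l)%N -> R x ->
  [/\ node_color R G x = tcolor X T u,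
      node_color R G (star R a (prime_root R G a x)) = tstar_color X T u,
      counting R a x = tcount T (kind_len X u) (kind_b u) 0,
      counting R a (star R a (prime_root R G a x)) = tstar_k X T u
    & knr R G a x = (tknr2 X T u)%:R / 2].
Proof.
move=> il; rewrite /x /u; have [y yc ->] := simple_point il.
move: yc; set v := node_kind_of X l i => yc Ry.
have co := @kind_odd v.
have b4 : (kind_b v %% 4 = kind_b v)%N by case: (v).
have dE : (kind_len X v == Sh) && tdouble T (kind_b v) = doubled X T v.
  by rewrite /doubled; case: (kind_len X v).
rewrite (node_colorE fr Tf yc co) (star_colorE fr Tf yc Ry co) (star_countingE fr Tf yc Ry).
rewrite (counting_point Tf yc Ry) (knrE fr Tf yc Ry) !dE !res_nat !b4.
by rewrite /tcolor /tstar_color /tstar_k /tknr2; split.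
Qed.

End Nodes.

Section FrameRealizes.
Variables (K : realType) (F : vectType K) (I : {symmetric F}) (R : set F) (G : {vspace F}).
Section Scale.
Variables (l : nat).
Variables (f : 'Hom('rV[K]_l.+1, F)) (a : F) (kappa : K).
Hypotheses (fr : frame I R G f a kappa).
Local Notation pt := (point f a).
Local Notation eps0 := (unitv K l 0).

Lemma unit_short : finite_roots Sh (unitv K l 1).
Proof. by exists 1%N, false; rewrite expr0 scale1r (fr_rank fr). Qed.

(** The norms of the roots are kappa times 1, 2, 4, and 1 occurs, so the
greatest common divisor is that of the short norm. *)
Lemma form_scaleE : form_scale I R = 2 / kappa.
Proof.
have k0 := fr_pos fr; have kn := lt0r_neq0 k0; have e1 := unit_short.
have normE x : R x -> exists2 n : nat, I x x = kappa * n%:R & (n \in [:: 1; 2; 4])%N.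
  move=> /(fr_cover fr)[c [y [m [n [yc ->]]]]]; exists (sqlen c); last by case: (c).
  by rewrite -/(point f a y m n) (form_point fr); have [_ ->] := finite_rootsP yc.
have R1 := fr_short fr e1; have I1 : I (f (unitv K l 1)) (f (unitv K l 1)) = kappa.
  by rewrite -(point0 f a) (form_point fr) dot_eps ?(fr_rank fr) // eqxx mulr1.
apply: xget_unique.
  split=> [|x /normE[n -> _]|d]; first by rewrite divr_gt0.
    by rewrite mulrA divfK // -natrM natr_int.
  split=> [d2 m [x /normE[n -> _]]|dS]; last first.
    by apply: dS; exists (f (unitv K l 1)) => //; rewrite I1 divfK.
  rewrite mulrA divfK // -natrM => /eqP; rewrite [_%:R](_ : _ = (Posz (2 * n))%:~R) // eqr_int.
  by move=> /eqP ->; rewrite PoszM dvdz_mulr.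
move=> c [c0 cint cgcd]; have /cint := R1; rewrite I1 => /intrP[n nE].
suff n2 : n = 2 by rewrite -[c](mulfK kn) nE n2.
have n0 : 0 < n by rewrite -(ltr_int K) -nE mulr_gt0.
have n_2 : (n %| 2)%Z.
  apply/cgcd => m [x /normE[k -> _]]; rewrite mulrA nE => /eqP.
  rewrite [k%:R](_ : _ = (Posz k)%:~R) // -intrM eqr_int => /eqP ->.
  exact: dvdz_mulr.
have two_n : (2 %| n)%Z.
  by have /cgcd := dvdzz 2; apply; exists (f (unitv K l 1)) => //; rewrite I1 nE.
move: n_2 two_n n0 {nE}; case: n => // n; rewrite !dvdzE /= => h1 h2 _.
by congr Posz; apply/eqP; rewrite eqn_dvd h1 h2.
Qed.

Lemma quo_form_frame x y : quo_form I G (proj G x) (proj G y) = I x y.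
Proof.
apply: quo_form_proj => z; rewrite /= => /(memG_frame fr)[k ->] w.
have [v [q ->]] := fr_surj fr w.
rewrite -[k *: a]add0r -(linear0 f) (fr_form fr) -(scale0r 0) dotZl mul0r mulr0 //.
Qed.

(** An element of Q(R/G) has integral coordinates, and its finite part vanishes
when it lies in the radical. *)
Lemma radical_generator :
  (zspan (quo_roots R G) `&` radical (quo_form I G))%classic = zspan [set proj G (f eps0)]%classic.
Proof.
apply/seteqP; split=> x.
  move=> [xs xr].
  have [v [m [vi xE]]] : exists v (m : int), integral_vec v /\ x = proj G (f (v + eps0 *~ m)).
    move: x xs {xr}; apply: zspan_ind => [|x y [v [m [vi ->]]] [w [n [wi ->]]]|x [z Rz <-]].
    - exists 0, 0; rewrite mulr0z addr0 !linear0; split=> //.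
      by split=> [|j]; rewrite mxE.
    - exists (v - w), (m - n); split; last by rewrite mulrzBr -!linearB opprD addrACA.
      exact: (integral_vecD vi (integral_vecN wi)).
    - have [c [y [m [n [yc zE]]]]] := fr_cover fr Rz; exists y, m.
      by have [yi _] := finite_rootsP yc; rewrite zE -/(point f a y m n) (point_proj fr).
  have v0 : v = 0.
    apply: dot0_eq0 => //; have := xr x; rewrite xE quo_form_frame.
    rewrite -[f _]addr0 -(scale0r a) (fr_form fr) -scaler_int !dotE !dotb !dotbr !mulr0 !addr0.
    by move=> /eqP; rewrite mulf_eq0 (gt_eqF (fr_pos fr)) => /eqP.
  rewrite xE v0 add0r; apply/zspan1P; exists m.
  by rewrite !raddfMz.
move=> /zspan1P[n ->]; split.
  apply: zspanMz; move: (fr_b fr); move: (f eps0).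
  apply: zspan_ind => [|y z Py Pz|y Ry]; rewrite ?linear0 ?linearB.
  - exact: zspan0.
  - exact: zspanB.
  - by apply: zspan_gen; exists y.
move=> z; have [y ->] := proj_surj z; rewrite -raddfMz quo_form_frame.
have [v [q ->]] := fr_surj fr y.
have -> : f eps0 *~ n = f (eps0 *~ n) + 0 *: a by rewrite scale0r addr0 raddfMz.
by rewrite (fr_form fr) -scaler_int dotZl dotb mulr0 mulr0.
Qed.

(** A generator is +-b, and positivity of the coefficients excludes -b. *)
Lemma marksE X (adc := fun i : 'I_l.+1 => f (affine_simple K l X i)) : (min_rank X <= l)%N ->
  marks I R G adc = [ffun i : 'I_l.+1 => node_mark X i].
Proof.
move=> lX; have [phi [phiE phib]] := frame_quotient fr.
have phif v : phi (proj G (f v)) = v by have := phiE v 0; rewrite scale0r addr0.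
have sumE (c : 'I_l.+1 -> nat) : \sum_(i < l.+1) proj G (adc i) *+ c i =
    proj G (f (\sum_(i < l.+1) affine_simple K l X i *+ c i)).
  by rewrite !raddf_sum; apply: eq_bigr => i _; rewrite !raddfMn.
apply: xget_unique.
  split=> [i|]; first by rewrite ffunE /node_mark; case: (X) => //; case: ifP.
  rewrite /zgenerator radical_generator sumE; congr (zspan [set proj G (f _)]%classic).
  by rewrite -(sum_marks _ lX); apply: eq_bigr => i _; rewrite ffunE.
move=> c [c0]; rewrite /zgenerator radical_generator sumE => zE.
have [w wE] : exists w : 'rV[K]_l.+1, w = \sum_(i < l.+1) affine_simple K l X i *+ c i by eexists.
rewrite -wE in zE.
have /zspan1P[m mE] : zspan [set proj G (f w)]%classic (proj G (f eps0)).
  by rewrite -zE; apply: zspan_gen.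
have /zspan1P[n nE] : zspan [set proj G (f eps0)]%classic (proj G (f w)).
  by rewrite zE; apply: zspan_gen.
have {}mE : eps0 = w *~ m by have := congr1 phi mE; rewrite raddfMz /= !phif.
have {}nE : w = eps0 *~ n by have := congr1 phi nE; rewrite raddfMz /= !phif.
have cE i : (c i)%:R = (node_mark X i)%:R * n%:~R :> K.
  rewrite (@simple_coef_eq K l X w (fun i => (c i)%:R) lX); last first.
    by rewrite wE; apply: eq_bigr => j _; rewrite scaler_nat.
  by rewrite /simple_coef nE -scaler_int psumZ psum_eps0 mulr0 addr0 mxE unitvE mulr1.
have n1 : n = 1.
  have nm : n * m = 1.
    have := congr1 (fun v : 'rV[K]_l.+1 => v 0 0) mE.
    rewrite nE -mulrzA -scaler_int !mxE /= mulr1 => /esym/eqP.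
    by rewrite -[1]/(1%:~R) eqr_int => /eqP.
  have n0 : 0 < n.
    rewrite -(ltr_int K); have := cE ord0; have : 0 < (c ord0)%:R :> K by rewrite ltr0n.
    by move=> + e; rewrite e pmulr_rgt0 // ltr0n /node_mark; case: (X).
  have : (n %| 1)%Z by apply/dvdzP; exists m; rewrite mulrC nm.
  by rewrite dvdz1 => /eqP; move: n0; clear; lia.
apply/ffunP => i; rewrite ffunE; apply/eqP; rewrite -(eqr_nat K) cE n1 mulr1 //.
Qed.

End Scale.
End FrameRealizes.

Section FrameRealizes.
Variables (K : realType) (F : vectType K) (I : {symmetric F}) (R : set F) (G : {vspace F}).
Variable t : row_label.
Hypothesis tv : valid_row t.
Local Notation X := (row_type t).
Local Notation l := (row_rank t).
Local Notation T := (row_table t).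
Variables (f : 'Hom('rV[K]_l.+1, F)) (a : F) (kappa : K).
Hypotheses (rs : root_system I R) (fr : frame I R G f a kappa) (Tf : tabulates R f a T).
Local Notation pt := (point f a).
Local Notation eps0 := (unitv K l 0).
Local Notation kind i := (node_kind_of X l i).
Let adc := fun i : 'I_l.+1 => f (affine_simple K l X i).
Let amc := fun i => prime_root R G a (adc i).
Let lX := row_rank_ge tv.
Let l0 : (0 < l)%N := fr_rank fr.

Let ord_le (i : 'I_l.+1) : (i <= l)%N. Proof. by rewrite -ltnS. Qed.

Lemma row_table_kind u : T (kind_len X u) (kind_b u) 0.
Proof.
have /and5P[_ /and3P[h1 h2 h3] _ _ _] := row_fact_valid tv.
by case: u.
Qed.

Lemma simple_root i : R (adc i).
Proof.
have [y yc e] := simple_point fr lX (ord_le i).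
rewrite /adc e; apply/(table_nat Tf _ _ yc).
by rewrite modn_small ?row_table_kind //; case: (kind i).
Qed.

Lemma exponentE i : exponent I R G a adc i =
  2 * (sqlen (kind_len X (kind i)) * kind_mark X (kind i))%:R / (tknr2 X T (kind i))%:R.
Proof.
have [_ _ _ _ kE] := node_dataP fr Tf lX (ord_le i) (simple_root i).
rewrite /exponent (marksE fr lX) ffunE (form_scaleE fr) /adc kE.
have [y yc ->] := simple_point fr lX (ord_le i).
rewrite (form_point fr); have [_ ->] := finite_rootsP yc.
rewrite -(kind_markE lX (ord_le i) l0) natrM -mulr_natr.
have := lt0r_neq0 (fr_pos fr); move: (kappa) (sqlen _)%:R (kind_mark _ _)%:R => k s m k0.
rewrite [2 * (_ / 2)]mulrC divfK ?pnatr_eq0 //.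
by rewrite -[2 / k * _]mulrA mulKf // mulrA; ring.
Qed.

Lemma tknr2_gt0 i : (0 < tknr2 X T (kind i))%N.
Proof.
have Ti := row_table_kind (kind i).
rewrite /tknr2 /doubled; case: ifP => d.
  move: d; case: (kind_len _ _) => // dT; have [_ _ _] := tprimeP dT.
  by rewrite subn_gt0.
by have [h _ _] := tcountP (isT : (0 < 4)%N) Ti; rewrite double_gt0.
Qed.

Lemma exponent_lt i j : (exponent I R G a adc i < exponent I R G a adc j) =
  texp_lt X T (kind i) (kind j).
Proof.
rewrite !exponentE /texp_lt ltr_pdivrMr ?ltr0n ?tknr2_gt0 //.
rewrite mulrAC ltr_pdivlMr ?ltr0n ?tknr2_gt0 //.
by rewrite -!mulrA ltr_pM2l // -!natrM ltr_nat.
Qed.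

Lemma collapsedE i : collapsed I R G a adc i = tcollapsed X T l (kind i).
Proof.
rewrite /collapsed /tcollapsed real_ltNge ?num_real //.
apply/idP/idP.
  move=> /negP h; have [/existsP[j]|/existsPn no] := boolP [exists j,
    exponent I R G a adc i < exponent I R G a adc j].
    rewrite exponent_lt => ij; apply/hasP; exists (kind j) => //.
    by apply/(kindsP _ l0 lX); exists j.
  case: h; apply/bigmax_leP; split=> [|j _]; rewrite leNgt; exact: no.
move=> /hasP[u uin ij]; have [k kl ku] : exists2 k, (k <= l)%N & kind k = u.
  exact/(kindsP _ l0 lX).
apply/negP => /bigmax_leP[_ /(_ (inord k) isT)]; rewrite leNgt exponent_lt inordK ?ltnS // ku.
by rewrite ij.
Qed.

Lemma simple_system_frame : simple_system (proj G @` dc_roots R)%classic (fun i => proj G (adc i)).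
Proof.
split.
- have psiE v : (proj G \o f)%VF v = proj G (f v) by rewrite comp_lfunE.
  have ker0 : lker (proj G \o f)%VF = 0%VS.
    apply/eqP/lker0P => v w; rewrite !psiE => e.
    by apply: (@proj_inj _ _ _ _ _ _ _ _ _ fr v w 0 0); rewrite !scale0r !addr0.
  have img : limg (proj G \o f)%VF = fullv.
    apply/vspaceP => u; rewrite memvf; apply/memv_imgP; have [x ->] := proj_surj u.
    have [v [q ->]] := fr_surj fr x; exists v; rewrite ?memvf //.
    by rewrite psiE (proj_frame fr).
  have := limg_basis_of (f := (proj G \o f)%VF) (U := fullv) _ (simple_basis K lX).
  rewrite ker0 capv0 img => /(_ erefl); congr basis_of.
  by rewrite -map_comp; apply: eq_map => i; rewrite /= psiE.
- move=> i; exists (adc i) => //; split; first exact: simple_root.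
  have [y yc e] := simple_point fr lX (ord_le i); rewrite /adc e.
  move=> /(root_half fr Tf yc)[cL [m' [_ [mm _ _]]]].
  by have := kind_odd cL; lia.
- move=> _ [x [Rx _] <-].
  have [v [q xE]] := fr_surj fr x.
  have /(quo_rootsP tv fr Tf) : quo_roots R G (proj G (f v)).
    by exists x => //; rewrite xE (proj_frame fr).
  move=> /(simple_combination lX)[c cE]; exists c; rewrite xE (proj_frame fr).
  have sE : \sum_i proj G (adc i) *+ c i = proj G (f (\sum_(i < l.+1) affine_simple K l X i *+ c
    i)).
    by rewrite !raddf_sum; apply: eq_bigr => i _; rewrite !raddfMn.
  rewrite sE; case: cE => ->; [by left|right; by rewrite !linearN].
Qed.

Lemma simple_good i : (exists y, [/\ R y, proj G y = proj G (adc i) & ~ R (2 *: y)]) ->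
  ~ R (2 *: adc i).
Proof.
have [y yc e] := simple_point fr lX (ord_le i).
move=> [z [Rz zi Nz]]; rewrite /adc e in zi *.
have [v [q zE]] := fr_surj fr z.
move=> /(root_double fr Tf _ _ yc)[cS TL].
have [c [w [m [n [wc zpt]]]]] := fr_cover fr Rz; rewrite -/(point f a w m n) in zpt.
have [[y0 _] _] := finite_rootsP yc; have [[w0 _] _] := finite_rootsP wc.
move: zi; rewrite zpt !pointE => /(proj_inj fr) vE.
have [wy mk _] : [/\ w = y, m = kind_b (kind i) & 0 = 0 :> int].
  by apply: (point_inj fr) => //; rewrite !pointE vE.
rewrite zpt wy mk in Rz Nz.
have TS := (Tf _ _ yc).1 Rz; rewrite cS in TS.
have NL : ~ T Lg (res (2 * (kind_b (kind i))%:Z)) (res (2 * n)).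
  by move=> h; apply: Nz; apply/(root_double fr Tf _ _ yc).
have /and5P[_ _ _ /andP[g0 g1] _] := row_fact_valid tv.
have good : tgood T (kind_b (kind i)) -> False.
  move=> /implyP g; have := g; rewrite res_double mulr0 in TL.
  rewrite TL => /(_ _)/negP; apply=> //; apply/hasP; exists (res n).
    by have := res_lt n; case: (res n) => [|[|[|[|]]]].
  rewrite res_nat modn_small in TS; last by case: (kind i).
  rewrite TS /=; apply/negP; move: NL; rewrite res_double.
  by rewrite (_ : res (2 * n) = ((res n).*2 %% 4)%N) // /res; lia.
apply: good; move: cS TL; case: (kind i) => // + TL.
have TL2 : has (T Lg 2) residues by apply/hasP; exists 0%N.
have [h1 h2] := (row_step tv Lg (isT : (2 < 4)%N), g1).
by move: h1 h2; rewrite TL2; case: (X).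
Qed.

(** With alpha_i = f(beta_i): everything in the definition of a realization has
been computed from the table, and for the table of a row the results are the
entries of the row ([row_node_tnode]). *)
Theorem frame_realizes : realizes I R G t.
Proof.
exists a, adc, amc; split.
- exact: fr_gen fr.
- split=> //; first 1 last.
  + exact: simple_system_frame.
  + exact: simple_good.
  + move=> i; split; first exact: simple_root.
    have [y yc e] := simple_point fr lX (ord_le i); rewrite /adc e.
    move=> /(root_half fr Tf yc)[cL [m' [_ [mm _ _]]]].
    by have := kind_odd cL; lia.
- have [phi [phiE phib]] := frame_quotient fr.
  have phif v : phi (proj G (f v)) = v by have := phiE v 0; rewrite scale0r addr0.
  exists phi; split=> // [|i]; last exact: phif.
  apply/seteqP; split=> [_ [_ [x Rx <-] <-]|v vX].
    have [v [q xE]] := fr_surj fr x; rewrite xE phiE.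
    apply/(quo_rootsP tv fr Tf); exists x => //; by rewrite xE (proj_frame fr).
  by exists (proj G (f v)) => //; apply/(quo_rootsP tv fr Tf).
move=> i; have := node_dataP fr Tf lX (ord_le i) (simple_root i).
rewrite (row_node_tnode tv (ord_le i)) -/(adc i) -/(amc i) => -[h1 h2 h3 h4 _].
split=> //=; have := collapsedE i; case: tcollapsed => /= cE //.
by split=> //; rewrite cE.
Qed.

End FrameRealizes.

(** * A realization gives a frame *)
Lemma coord_expand (K : realType) l (v : 'rV[K]_l.+1) :
  v = v 0 0 *: unitv K l 0 + \sum_(i < l) v 0 (lift ord0 i) *: unitv K l i.+1.
Proof.
apply/rowP => k; rewrite !mxE summxE /=.
case: (unliftP ord0 k) => [j ->|->]; last first.
  by rewrite big1 ?addr0 ?mulr1 // => i _; rewrite !mxE /= mulr0.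
rewrite (bigD1 j) //= big1 => [|i ij]; first by rewrite !mxE lift0 eqxx !mulr1 mulr0 add0r addr0.
by rewrite !mxE lift0 eqSS eq_sym (inj_eq val_inj) (negPf ij) mulr0.
Qed.

Section Realized.
Variables (K : realType) (F : vectType K) (I : {symmetric F}) (R : set F) (G : {vspace F}).
Hypothesis me : marked_elliptic I R G.
Variables (X : affine_type) (l : nat).
Hypotheses (lX : (min_rank X <= l)%N).
Variables (a : F) (adc : 'I_l.+1 -> F) (phi : 'Hom(quo G, 'rV[K]_l.+1)).
Hypothesis agen : zgenerator a (zspan R `&` [set` G])%classic.
Hypothesis adcR : forall i, R (adc i).
Hypothesis phib : bijective phi.
Hypothesis phiR : (phi @` quo_roots R G = affine_roots X)%classic.
Hypothesis phiS : forall i, phi (proj G (adc i)) = affine_simple K l X i.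
Local Notation eps := (unitv K l).
Let rs : root_system I R. Proof. by case: me => -[]. Qed.
Let l0 : (0 < l)%N. Proof. by apply: leq_trans lX; case: (X). Qed.

Lemma marking_gen : zspan R a /\ a \in G.
Proof.
have : zspan [set a]%classic a by apply: zspan_gen.
by rewrite -agen => -[].
Qed.

Lemma marking_neq0 : a != 0.
Proof.
have [_ _ _ [a' a'n a'gen]] := me.
have : zspan [set a']%classic a' by apply: zspan_gen.
rewrite -a'gen agen => /zspan1P[n e]; apply: contraNneq a'n => a0.
by rewrite e a0 mul0rz.
Qed.

Lemma marking_line : G = <[a]>%VS.
Proof.
have [_ _ dG _] := me; apply/eqP; rewrite eq_sym eqEdim -memvE (marking_gen).2 dG dim_vline.
by rewrite marking_neq0.
Qed.

Lemma marking_radical x y : x \in G -> I x y = 0.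
Proof. by case: me => _ Grad _ _ xG; apply: Grad. Qed.

(** f sends the simple root beta_i to alpha_i. It is determined by this, and it
splits the projection to the quotient. *)
Variable f : 'Hom('rV[K]_l.+1, F).
Hypothesis fE : forall v, f v = \sum_(i < l.+1) simple_coef X v i *: adc i.

Lemma phi_f v : phi (proj G (f v)) = v.
Proof.
rewrite fE !linear_sum [RHS](simple_expand v lX); apply: eq_bigr => i _.
by rewrite !linearZ /= phiS.
Qed.

Lemma phi_inj x y : phi (proj G x) = phi (proj G y) -> x - y \in G.
Proof. by move=> /(bij_inj phib)/proj_eq. Qed.

Lemma phi_memG x y : y \in G -> phi (proj G (x + y)) = phi (proj G x).
Proof. by move=> yG; congr (phi _); apply/proj_eq; rewrite addrAC subrr add0r. Qed.

Lemma lift_root v : affine_roots X v -> exists2 g, g \in G & R (f v + g).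
Proof.
rewrite -phiR => -[_ [x Rx <-] xv]; exists (x - f v); last by rewrite addrC subrK.
by apply: phi_inj; rewrite phi_f.
Qed.

Lemma root_lift x : R x -> exists v g, [/\ affine_roots X v, g \in G & x = f v + g].
Proof.
move=> Rx; exists (phi (proj G x)), (x - f (phi (proj G x))); split.
- by rewrite -phiR; exists (proj G x) => //; exists x.
- by apply: phi_inj; rewrite phi_f.
- by rewrite addrC subrK.
Qed.

Lemma root_affine v g : g \in G -> R (f v + g) -> affine_roots X v.
Proof.
move=> gG Rx; rewrite -phiR; exists (proj G (f v + g)); first by exists (f v + g).
by rewrite phi_memG // phi_f.
Qed.

Local Notation J v w := (I (f v) (f w)).

Lemma form_lift v w g h : g \in G -> h \in G -> I (f v + g) (f w + h) = J v w.
Proof.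
move=> gG hG; rewrite formDl !formDr (formC _ (f v) h) (marking_radical _ hG).
by rewrite !(marking_radical _ gG) !addr0.
Qed.

Lemma affine_anisotropic v : affine_roots X v -> J v v != 0.
Proof.
by move=> /lift_root[g gG /(rs_anisotropic rs)]; rewrite form_lift.
Qed.

(** The form is not yet known to be the standard one, but its Cartan numbers are
integers and its reflections preserve the known set of affine roots. This
determines it. *)
Lemma affine_closed v w : affine_roots X v -> affine_roots X w ->
  exists k : int, 2 * J v w / J v v = k%:~R /\ affine_roots X (w - k%:~R *: v).
Proof.
move=> /lift_root[g gG Rv] /lift_root[h hG Rw].
have [k kE] := root_integral rs Rv Rw; have := root_reflection rs Rv Rw; rewrite kE.
move: kE; rewrite !form_lift // => kE Rk; exists k; split=> //.
apply: (@root_affine _ (h - k%:~R *: g)); first by rewrite rpredB ?rpredZ.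
have -> : f (w - k%:~R *: v) = f w - k%:~R *: f v by rewrite linearB linearZ.
by rewrite scalerDr opprD addrACA in Rk.
Qed.

Lemma affine_norm (v : 'rV[K]_l.+1) : affine_roots X v -> [\/ dot v v = 1,
  dot v v = 2 | dot v v = 4].
Proof.
move=> /affine_rootsP[c [y [m [yc _ ->]]]]; rewrite -scaler_int !dotE !dotb !dotbr !mulr0 !addr0.
by have [_ ->] := finite_rootsP yc; case: (c); [constructor 1|constructor 2|constructor 3].
Qed.

Lemma affine_short i (m : int) : (1 <= i <= l)%N -> affine_roots X (eps i + eps 0 *~ m).
Proof.
move=> il; apply/affine_rootsP; exists Sh, (eps i), m; split; [by exists i, false;
  rewrite expr0 scale1r|exact: dvd1n|by []].
Qed.

Lemma affine_short0 i : (1 <= i <= l)%N -> affine_roots X (eps i).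
Proof. by move=> il; have := affine_short 0 il; rewrite mulr0z addr0. Qed.

Lemma affine_middle (s : bool) i j : (1 <= i <= l)%N -> (1 <= j <= l)%N -> i != j ->
  affine_roots X (eps i + (-1) ^+ s *: eps j).
Proof.
move=> il jl ij; apply/affine_rootsP; exists Md, (eps i + (-1) ^+ s *: eps j), 0.
split; [|by rewrite dvdz0|by rewrite mulr0z addr0].
have [i1 j1] : (1 <= i)%N /\ (1 <= j)%N by split; lia.
apply/middleP; split.
  exact: (integral_vecD (integral_eps _ _ i1) (integral_vecZ (sign_int _ s) (integral_eps _ _ j1))).
have ji : j != i by rewrite eq_sym.
rewrite !dotE !dot_eps // !eqxx (negPf ij) (negPf ji) !mulr0 addr0 add0r mulr1 ?mulr1n.
by case: s; rewrite ?expr0 ?expr1 ?mulr1n; lra.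
Qed.

(** The eps_i-string through eps_j consists of eps_j and eps_j +- eps_i; the
reflection reverses it, so it fixes the middle. *)
Lemma eps_orthogonal i j : (1 <= i <= l)%N -> (1 <= j <= l)%N -> i != j -> J (eps i) (eps j) = 0.
Proof.
move=> il jl ij; have Ai := affine_short0 il; have ji : j != i by rewrite eq_sym.
have Jn := affine_anisotropic Ai.
have norm_le (r : K) : affine_roots X (eps j + r *: eps i) -> 1 + r * r <= 4.
  move=> /affine_norm; rewrite !dotE !dot_eps // !eqxx (negPf ij) (negPf ji) !mulr0 addr0 add0r
    mulr1 ?mulr1n.
  by case=> ->; rewrite ?ler_nat // -[1]/(1%:R) ler_nat.
have [k [kE _]] := affine_closed Ai (affine_short0 jl).
have [k1 [k1E /norm_le]] : exists k1 : int, k1%:~R = k%:~R + 2 :> K /\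
    affine_roots X (eps j + (1 - k1%:~R) *: eps i).
  have [k1 [k1E A1]] := affine_closed Ai (affine_middle false jl il ji).
  exists k1; split.
    rewrite -k1E -kE expr0 scale1r linearD formDr mulrDr mulrDl; congr (_ + _).
    by rewrite mulfK.
  by move: A1; rewrite expr0 -addrA -scalerBl.
have [k2 [k2E /norm_le]] : exists k2 : int, k2%:~R = k%:~R - 2 :> K /\
    affine_roots X (eps j + (- 1 - k2%:~R) *: eps i).
  have [k2 [k2E A1]] := affine_closed Ai (affine_middle true jl il ji).
  exists k2; split.
    rewrite -k2E -kE expr1 scaleN1r linearB formDr formNr mulrDr mulrDl; congr (_ + _).
    by rewrite mulrN mulNr mulfK.
  by move: A1; rewrite expr1 -addrA -scalerBl.
rewrite k1E k2E => h2 h1; have k0 : k%:~R = 0 :> K.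
  have {h1} h1 : (k + 1) * (k + 1) <= 3 :> int.
    by rewrite -(ler_int K) !(rmorphM, rmorphD) /=; lra.
  have {h2} h2 : (k - 1) * (k - 1) <= 3 :> int.
    by rewrite -(ler_int K) !(rmorphM, rmorphD, rmorphN) /=; lra.
  by have -> : k = 0 by nia.
by move: kE; rewrite k0 => /eqP; rewrite !mulf_eq0 invr_eq0 (negPf Jn) pnatr_eq0 /= orbF => /eqP.
Qed.

(** The reflection in eps_i - eps_j sends eps_i to a root of the form (1 - k)
eps_i + k eps_j with k <> 0, hence to eps_j. *)
Lemma eps_norm i j : (1 <= i <= l)%N -> (1 <= j <= l)%N -> J (eps i) (eps i) = J (eps j) (eps j).
Proof.
move=> il jl; have [->//|ij] := eqVneq i j; have ji : j != i by rewrite eq_sym.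
have Av := affine_middle true il jl ij; rewrite expr1 scaleN1r in Av.
have [k [kE /affine_norm]] := affine_closed Av (affine_short0 il).
have -> : eps i - k%:~R *: (eps i - eps j) = (1 - k%:~R) *: eps i + k%:~R *: eps j.
  by rewrite scalerBr scalerBl scale1r opprB addrA addrAC.
have Jn := affine_anisotropic Av; have Jn' := affine_anisotropic (affine_short0 il).
move: kE Jn; rewrite linearB !formE (eps_orthogonal il jl ij) (eps_orthogonal jl il ji).
rewrite !dotE !dot_eps // !eqxx (negPf ij) (negPf ji).
move: (J (eps i) (eps i)) (J (eps j) (eps j)) Jn' => u w un kE un' nk.
have {}nk : (1 - k) * (1 - k) + k * k <= 4.
  rewrite -(ler_int K) !(rmorphM, rmorphD, rmorphN) /=.
  by case: nk; rewrite ?mulr1n ?mulr0n; lra.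
have uw : u + w != 0 by apply: contraNneq un' => h; apply/eqP; lra.
have {}kE : 2 * u = k%:~R * (u + w).
  rewrite -kE (_ : u - 0 + (- 0 - - w) = u + w); last by ring.
  by rewrite divfK // subr0.
have [k0|k1] : k = 0 \/ k = 1 by nia.
  by move: kE; rewrite k0 mul0r => /eqP; rewrite mulf_eq0 pnatr_eq0 (negPf un).
by move: kE; rewrite k1; lra.
Qed.

(** Otherwise the reflection in eps_i would send eps_i + m b to roots with
arbitrarily large finite part; m = 4 is large enough. *)
Lemma eps_b i : (1 <= i <= l)%N -> J (eps i) (eps 0) = 0.
Proof.
move=> il; have Ai := affine_short0 il; have Jn := affine_anisotropic Ai.
have [k [kE _]] := affine_closed Ai (affine_short 1 il).
have kE' : 2 * J (eps i) (eps 0) / J (eps i) (eps i) = (k - 2)%:~R.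
  by rewrite intrB -kE linearD /= formDr mulrDr mulrDl mulfK // addrAC subrr add0r.
have [k4 [k4E /affine_norm]] := affine_closed Ai (affine_short 4 il).
have {k4E} -> : k4 = 2 + 4 * (k - 2).
  apply/eqP; rewrite -(eqr_int K) -k4E intrD intrM -kE' linearD raddfMz /=.
  rewrite formDr mulrDr mulrDl mulfK // -scaler_int formZr; apply/eqP; congr (_ + _).
  by rewrite !mulrA (mulrC 2).
rewrite -scaler_int !dotE !dotb !dotbr !dot_eps // !eqxx.
move=> nk; have {}nk : (1 + 4 * (k - 2)) * (1 + 4 * (k - 2)) <= 4.
  rewrite -(ler_int K) !(rmorphM, rmorphD, rmorphN) /=.
  by case: nk; rewrite !(rmorphM, rmorphD, rmorphN) /=; lra.
have k2 : k - 2 = 0 by nia.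
by move: kE'; rewrite k2 => /eqP; rewrite !mulf_eq0 invr_eq0 (negPf Jn) pnatr_eq0 /= orbF => /eqP.
Qed.

Let psd : forall x, 0 <= I x x.
Proof. by case: me => -[_ [l' _ /signature_psd[psd _]]]. Qed.

Let i1 : (1 <= 1 <= l)%N. Proof. by rewrite l0. Qed.

Lemma eps_norm_gt0 : 0 < J (eps 1) (eps 1).
Proof. by rewrite lt_neqAle eq_sym affine_anisotropic ?psd //; apply: affine_short0. Qed.

(** Otherwise 0 < <(eps_1 + b)^v, eps_1> < 2 since the form is semidefinite, and
eps_1 would be reflected to -b, which is no root. *)
Lemma b_null : J (eps 0) (eps 0) = 0.
Proof.
have Av := affine_short 1 i1; rewrite mulr1z in Av;
  have [k [kE /affine_norm]] := affine_closed Av (affine_short0 i1).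
move: kE; rewrite linearD /= !formE (formC _ (f (eps 0)) (f (eps 1))) (eps_b i1).
move=> kE; have := psd (f (eps 0)); have := eps_norm_gt0; move: kE.
move: (J (eps 1) (eps 1)) (J (eps 0) (eps 0)) => u w kE u0 w0 nk.
apply/eqP; apply: contraT => wn; have {wn} w0' : 0 < w by rewrite lt_neqAle eq_sym wn.
have {}kE : 2 * u = k%:~R * (u + w) by rewrite -kE; field; lra.
have [k1 k2] : (0 < k /\ k < 2)%R.
  split; first by rewrite -(ltr_int K); nra.
  by rewrite -(ltr_int K); nra.
have k11 : k = 1 by lia.
move: nk; rewrite k11 scale1r opprD addNKr.
by rewrite !dotE !dotb oppr0; case; lra.
Qed.

Lemma form_f v w : J v w = J (eps 1) (eps 1) * dot v w.
Proof.
have J0 u : I (f (eps 0)) (f u) = 0.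
  by apply: form_null => //; exact: b_null.
have Je i u : (1 <= i <= l)%N -> J (eps i) u = J (eps 1) (eps 1) * dot (eps i) u.
  move=> il; rewrite [in LHS](coord_expand u) linearD linearZ linear_sum /= formDr formZr.
  rewrite (eps_b il) mulr0 add0r formC form_suml.
  case: i il => // i /andP[_ il]; rewrite (bigD1 (Ordinal il)) //= big1 => [|j ji].
    rewrite linearZ /= formZl addr0 (dot_unit u (Ordinal il)) mulrC.
    by rewrite (@eps_norm i.+1 1).
  rewrite linearZ /= formZl eps_orthogonal ?mulr0 ?eqSS ?(inj_eq val_inj) //;
    last by rewrite ltn_ord.
rewrite [in LHS](coord_expand v) linearD linearZ linear_sum /= formDl formZl J0 mulr0 add0r.
rewrite form_suml /dot mulr_sumr; apply: eq_bigr => i _.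
by rewrite linearZ /= formZl Je ?ltn_ord // dot_unit mulrCA.
Qed.

Lemma f_simple (i : 'I_l.+1) : f (affine_simple K l X i) = adc i.
Proof.
rewrite fE (bigD1 i) //= big1 => [|j ji].
  rewrite -(@simple_coef_eq K l X _ (fun j => (j == i)%:R) lX) ?eqxx ?scale1r ?addr0 //.
  by rewrite (bigD1 i) //= eqxx scale1r big1 ?addr0 // => j /negPf ->; rewrite scale0r.
rewrite -(@simple_coef_eq K l X _ (fun j => (j == i)%:R) lX) ?(negPf ji) ?scale0r //.
by rewrite (bigD1 i) //= eqxx scale1r big1 ?addr0 // => k /negPf ->; rewrite scale0r.
Qed.

Lemma f_simple_root i : (i <= l)%N -> R (f (affine_simple K l X i)).
Proof. by move=> il; rewrite -(inordK (_ : i < l.+1)%N) // f_simple. Qed.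

Lemma f_reflection v w (k : int) : R (f v) -> R (f w) -> 2 * dot v w = k%:~R * dot v v ->
  R (f (w - k%:~R *: v)).
Proof.
move=> Rv Rw kE; have := root_reflection rs Rv Rw.
have Jn := rs_anisotropic rs Rv; rewrite (form_f v v) in Jn.
rewrite (form_f v w) (form_f v v) mulrCA kE (mulrCA _ k%:~R) mulfK //.
by have -> : f (w - k%:~R *: v) = f w - k%:~R *: f v by rewrite linearB linearZ.
Qed.

Lemma simple_middle i : (1 <= i)%N -> (i < l)%N -> affine_simple K l X i = eps i - eps i.+1.
Proof. by case: i => // i _ il; rewrite affine_simpleS // ltnW. Qed.

(** The root alpha_l is f(eps_l), and reflection in f(eps_i - eps_(i+1)) leads
from eps_(i+1) to eps_i. *)
Lemma f_eps n : (n < l)%N -> R (f (eps (l - n))).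
Proof.
elim: n => [|n IH] nl.
  rewrite subn0; have := f_simple_root (leqnn l).
  by rewrite /affine_simple ltnn; case: eqP => [e|//]; rewrite e in nl.
have {}IH := IH (ltnW nl); set i := (l - n.+1)%N; have ii : (l - n)%N = i.+1 by rewrite /i; lia.
have [ig il] : (1 <= i)%N /\ (i < l)%N by rewrite /i; lia.
rewrite ii in IH; have Rb := f_simple_root (ltnW il); rewrite simple_middle // in Rb.
have := @f_reflection (eps i - eps i.+1) (eps i.+1) (-1) Rb IH.
rewrite mulrN1z scaleN1r opprK (addrC (eps i.+1)) subrK; apply.
have [h1 h2] : (1 <= i <= l)%N /\ (1 <= i.+1 <= l)%N by lia.
by rewrite !dotE !dot_eps // !eqxx (ltn_eqF (ltnSn i)) (gtn_eqF (ltnSn i)) ?mulr1n ?mulr0n; lra.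
Qed.

Lemma f_short_root i : (1 <= i <= l)%N -> R (f (eps i)).
Proof. by move=> /andP[i0 il]; rewrite -(subKn il); apply: f_eps; lia. Qed.

Lemma f_middleB i j : (1 <= i)%N -> (i < j <= l)%N -> R (f (eps i - eps j)).
Proof.
move=> i0 /andP[]; elim: j => // j IH; rewrite ltnS leq_eqVlt => /orP[/eqP <-|ij] jl.
  by rewrite -simple_middle //; apply: f_simple_root; rewrite ltnW.
have {}IH := IH ij (ltnW jl); have j1 : (1 <= j)%N by lia.
have Rb := f_simple_root (ltnW jl); rewrite simple_middle // in Rb.
have := @f_reflection (eps j - eps j.+1) (eps i - eps j) (-1) Rb IH.
rewrite mulrN1z scaleN1r opprK addrA subrK; apply.
have [h1 [h2 h3]] : (1 <= i <= l)%N /\ (1 <= j.+1 <= l)%N /\ (1 <= j <= l)%N by lia.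
rewrite !dotE !dot_eps // !eqxx (ltn_eqF (ltnSn j)) (gtn_eqF (ltnSn j)) (gtn_eqF ij).
by rewrite (gtn_eqF (leqW ij)) ?mulr1n ?mulr0n; lra.
Qed.

Lemma f_middleD i j : (1 <= i)%N -> (i < j <= l)%N -> R (f (eps i + eps j)).
Proof.
move=> i0 ijl; have jl : (1 <= j <= l)%N by lia.
have := @f_reflection (eps j) (eps i - eps j) (-2) (f_short_root jl) (f_middleB i0 ijl).
rewrite mulrNz scaleNr opprK (_ : 2%:~R = 2) // scaler_nat mulr2n addrA subrK; apply.
have ij : (j == i) = false by apply/eqP; lia.
rewrite !dotE !dot_eps // eqxx ij ?mulr1n ?mulr0n; lra.
Qed.

Lemma f_finite c y : c != Lg -> finite_roots c y -> R (f y).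
Proof.
case: c => // _ [i]; first by case=> s [il ->]; case: s; rewrite ?expr0 ?expr1 ?scaleN1r ?scale1r
  ?linearN; [apply: (rootN rs)|]; apply: f_short_root.
case=> j [s [t [i0 ij ->]]]; have RB := f_middleB i0 ij; have RD := f_middleD i0 ij.
case: s; case: t; rewrite ?expr0 ?expr1 ?scaleN1r ?scale1r //.
  by rewrite -opprD linearN; apply: (rootN rs).
by rewrite addrC -opprB linearN; apply: (rootN rs).
Qed.

Lemma memG_multiple z : z \in G -> exists q, z = q *: a.
Proof. by rewrite {1}marking_line => /vlineP. Qed.

Lemma realized_form v q w r : I (f v + q *: a) (f w + r *: a) = J (eps 1) (eps 1) * dot v w.
Proof. by rewrite -form_f form_lift // memvZ // (marking_gen).2. Qed.

(** Coordinates with respect to the alpha_i are integral, so the component along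
a lies in Q(R) and G. *)
Lemma realized_integral v (q : K) : affine_roots X v -> R (f v + q *: a) -> exists n : int,
  q = n%:~R.
Proof.
move=> vA Rx; have [c cE] := simple_combination lX vA.
have fc : f (\sum_(i < l.+1) affine_simple K l X i *+ c i) = \sum_(i < l.+1) adc i *+ c i.
  by rewrite raddf_sum; apply: eq_bigr => i _; rewrite raddfMn /= f_simple.
have zc : zspan R (\sum_(i < l.+1) adc i *+ c i).
  by apply: zspan_sum => i _; apply: zspanMn; apply: zspan_gen.
have zv : zspan R (f v).
  by case: cE => ->; [rewrite fc|rewrite linearN /= fc; apply: zspanN].
have : (zspan R `&` [set` G])%classic (q *: a).
  split; last by rewrite /= memvZ // (marking_gen).2.
  by rewrite -[q *: a](addKr (f v)) addrC; apply: zspanB => //; apply: zspan_gen.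
rewrite agen => /zspan1P[n e]; exists n; apply/eqP; rewrite -subr_eq0.
have /eqP : (q - n%:~R) *: a = 0 by rewrite scalerBl e scaler_int subrr.
by rewrite scaler_eq0 (negPf marking_neq0) orbF.
Qed.

Lemma realized_frame : frame I R G f a (J (eps 1) (eps 1)).
Proof.
have aG := (marking_gen).2.
split.
- exact: l0.
- exact: marking_line.
- move=> v q e; have v0 : v = 0.
    by rewrite -(phi_f v) -(phi_memG (f v) (memvZ q aG)) e !linear0.
  split=> //; move/eqP: e; rewrite v0 linear0 add0r scaler_eq0 (negPf marking_neq0) orbF.
  by move=> /eqP.
- move=> x; have : x - f (phi (proj G x)) \in G by apply: phi_inj; rewrite phi_f.
  move=> /memG_multiple[q e]; exists (phi (proj G x)), q.
  by rewrite -e addrC subrK.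
- exact: eps_norm_gt0.
- exact: realized_form.
- exact: agen.
- move=> x Rx; have [v [g [vA gG xE]]] := root_lift Rx.
  have [q gE] := memG_multiple gG.
  have [|n nE] := @realized_integral v q vA; first by rewrite -gE -xE.
  have /affine_rootsP[c [y [m [yc _ vE]]]] := vA; exists c, y, m, n; split=> //.
  by rewrite xE gE vE nE scaler_int linearD raddfMz.
- by move=> y; apply: f_finite.
- by move=> y; apply: f_finite.
- rewrite -(sum_marks K lX) linear_sum; apply: zspan_sum => i _.
  by rewrite raddfMn /= f_simple; apply: zspanMn; apply: zspan_gen.
Qed.

Let fr := realized_frame.

Lemma relevant_root c : relevant l c -> exists y : 'rV[K]_l.+1, finite_roots c y.
Proof.
have e1 : finite_roots Sh (eps 1) by exists 1%N, false; rewrite expr0 scale1r l0.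
case: c => [_|l2|_]; first by exists (eps 1).
  exists (eps 1 + eps 2), 1%N, 2%N, false, false; rewrite expr0 !scale1r; split=> //.
by exists (2 *: eps 1); apply/longP; exists (eps 1).
Qed.

Lemma realized_proj c (m : int) : relevant l c ->
  (exists n, fibre R f a c m n) <-> (step X c %| m)%Z.
Proof.
move=> rc; split=> [[n [y yc Ry]]|sm].
  move: Ry; rewrite pointE => /(root_affine (memvZ _ (marking_gen).2)).
  move=> /affine_rootsP[d [z [k [zd sk e]]]].
  have [[y0 _] yn] := finite_rootsP yc; have [[z0 _] zn] := finite_rootsP zd.
  have [yz mk _] : [/\ y = z, m = k & 0 = 0 :> int].
    by apply: (point_inj fr) => //; rewrite !pointE e.
  have -> : c = d; last by rewrite mk.
  move: yn; rewrite yz zn => /eqP; rewrite eqr_nat.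
  by case: (c) (d) => [] [].
have [y yc] := relevant_root rc.
have vA : affine_roots X (y + eps 0 *~ m) by apply/affine_rootsP; exists c, y, m.
have [g /memG_multiple[q gE] Rg] := lift_root vA; rewrite gE in Rg.
have [n nE] := realized_integral vA Rg; exists n; exists y => //.
by rewrite pointE -nE.
Qed.

Hypothesis adcG : forall i, (exists y, [/\ R y, proj G y = proj G (adc i) & ~ R (2 *: y)]) ->
  ~ R (2 *: adc i).

(** The short simple roots are alpha_l, over m = 0, and for C^v C_l also
alpha_0, over m = 1. *)
Lemma realized_good (m : int) : m = 0 \/ X = CvC /\ m = 1 -> fibre R f a Lg (2 * m) 0 ->
  forall n, fibre R f a Sh m n -> fibre R f a Lg (2 * m) (2 * n).
Proof.
move=> mX fL n fS.
have [i [y [yS iE]]] : exists (i : 'I_l.+1) y, finite_roots Sh y /\ adc i = point f a y m 0.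
  have [i il [iS iB]] : exists2 i, (i <= l)%N &
     kind_len X (node_kind_of X l i) = Sh /\ (kind_b (node_kind_of X l i))%:Z = m.
    case: mX => [->|[XE ->]]; last by exists 0%N => //; rewrite XE.
    by exists l => //; rewrite /node_kind_of ltnn; case: eqP => // e; move: l0; rewrite e.
  have [y yS e] := simple_point fr lX il; exists (inord i), y.
  by rewrite -f_simple inordK ?ltnS // e iB; split=> //; rewrite -iS.
have Ri := adcR i; have tf := frame_tabulates rs fr.
have y2 : finite_roots Lg (2 *: y) by apply/longP; exists y.
have dblE (k : int) : 2 *: point f a y m k = point f a (2 *: y) (2 * m) (2 * k).
  rewrite /point !scalerDr linearZ -!scaler_int !scalerA.
  by rewrite -!(intrM _ 2).
have R2 : R (2 *: adc i) by rewrite iE dblE mulr0; apply/(fibreP rs fr _ _ y2).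
apply: contrapT => no; apply: (adcG _ R2); exists (point f a y m n); split.
- exact/(fibreP rs fr _ _ yS).
- by rewrite iE !(point_proj fr).
- by rewrite dblE => /(fibreP rs fr _ _ y2).
Qed.

Lemma realized_adapted : adapted R f a X.
Proof.
split=> //; [exact: realized_proj| |exact: realized_good].
have [y yc e] := simple_point fr lX (leq0n l); exists y => //.
by rewrite -e; apply: f_simple_root.
Qed.

End Realized.

Section RealizesFrame.
Variables (K : realType) (F : vectType K) (I : {symmetric F}) (R : set F) (G : {vspace F}).

(** The parameters do not depend on which nodes are collapsed. *)
Lemma read_params_data X d0 d1 dl e0 e1 el :
  let same d e := [/\ nd_color d = nd_color e, nd_k d = nd_k e & nd_star_k d = nd_star_k e] in
  same d0 e0 -> same d1 e1 -> same dl el -> read_params X d0 d1 dl = read_params X e0 e1 el.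
Proof.
move=> same [c0 k0 s0] [c1 k1 s1] [cl kl sl].
by rewrite /read_params /node_fib c0 cl k0 k1 kl s0 sl.
Qed.

(** The frame is adapted, so its table has parameters in the box. By [box_readP]
these are read off from the node data of the table, which are the node data of R
and therefore those of the row. *)
Theorem realizes_frame t : marked_elliptic I R G -> valid_row t -> realizes I R G t ->
  exists (f : 'Hom('rV[K]_(row_rank t).+1, F)) a kappa,
    frame I R G f a kappa /\ tabulates R f a (row_table t).
Proof.
move=> me tv [a [adc [amc [agen [dcR simple good amcE] [phi [phib phiR phiS]] match_]]]].
have lX := row_rank_ge tv; have rs : root_system I R by case: me => -[].
set X := row_type t in lX phiR phiS *; set l := row_rank t in lX adc amc dcR simple good amcE phi
  phib phiR phiS match_ *.
have adcR i : R (adc i) by have [] := dcR i.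
have lin : linear (fun v : 'rV[K]_l.+1 => \sum_(i < l.+1) simple_coef X v i *: adc i).
  move=> k v w /=; rewrite scaler_sumr -big_split /=; apply: eq_bigr => i _.
  by rewrite /simple_coef psumD psumZ !mxE scalerA -scalerDl; congr (_ *: _); ring.
have [f fE] := hom_of_linear lin.
have fr := realized_frame me lX agen adcR phib phiR phiS fE.
have ad := realized_adapted me lX agen adcR phib phiR phiS fE good.
have adE := f_simple lX fE.
exists f, a, (I (f (unitv K l 1)) (f (unitv K l 1))); split=> //.
have [p pb pE] := adapted_params rs fr ad.
have pa := adapted_admissible rs fr ad pE.
have Tf : tabulates R f a (table_of X p) by apply: (tabulates_table (frame_tabulates rs fr)).
suff -> : row_table t = table_of X p by [].
have l0 := fr_rank fr; rewrite /row_table (box_readP l0 lX pb pa); congr table_of.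
have data i : (i <= l)%N -> let d := row_node t i in let e :=
  tnode X (table_of X p) l (node_kind_of X l i) in
    [/\ nd_color d = nd_color e, nd_k d = nd_k e & nd_star_k d = nd_star_k e].
  move=> il; have := match_ (inord i); have Ri := adcR (inord i).
  rewrite /node_matches amcE; rewrite -adE inordK ?ltnS // in Ri *; move=> [<- _ <- <-].
  by have [-> _ -> -> _] := node_dataP fr Tf lX il Ri.
by apply: read_params_data; apply: data.
Qed.

End RealizesFrame.

(** * A model for every row *)
Section Model.
Variables (K : realType) (l : nat).

(** The last component is the coordinate along a. *)
Definition model_space : vectType K := ('rV[K]_l.+1 * K^o)%type.

Definition model_dot (x y : model_space) : K := dot x.1 y.1.

Lemma model_dot_bilinear : bilinear_for
  (GRing.Scale.Law.clone _ _ ( *%R ) _ : GRing.Scale.law K K)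
  (GRing.Scale.Law.clone _ _ (idfun \; *%R ) _) model_dot.
Proof.
split=> [z k x y|z k x y]; rewrite /model_dot /=.
  by rewrite dotDl dotZl.
by rewrite dotDr dotZr.
Qed.

HB.instance Definition _ := bilinear_isBilinear.Build K model_space model_space K
  _ _ model_dot model_dot_bilinear.

Lemma model_dot_hermitian x y : model_dot x y = (-1) ^+ false * idfun (model_dot y x).
Proof. by rewrite expr0 mul1r /model_dot dotC. Qed.

HB.instance Definition _ := isHermitianSesquilinear.Build K model_space false idfun model_dot
  model_dot_hermitian.

Definition model_form : {symmetric model_space} := model_dot.

Lemma model_embed_linear : linear (fun v : 'rV[K]_l.+1 => (v, 0) : model_space).
Proof. by move=> k v w; congr pair; rewrite /= ?scaler0 ?addr0. Qed.

End Model.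

Section ModelRoots.
Variables (K : realType) (l : nat) (T : table).
Local Notation F := (model_space K l).
Local Notation I := (model_form K l).
Local Notation eps := (unitv K l).
Variable f : 'Hom('rV[K]_l.+1, F).
Hypothesis fE : forall v, f v = (v, 0).
Let a : F := (0, 1).
Let G : {vspace F} := <[a]>%VS.
Local Notation pt := (point f a).

Definition model_roots : set F := fun x => exists c y (m n : int),
  [/\ finite_roots c y, T c (res m) (res n) & x = pt y m n].

Hypothesis l0 : (0 < l)%N.
Hypothesis Tclosed : closed_table l T.
Hypothesis TS : T Sh 0 0.
Hypothesis TM : T Md 0 0.
Hypothesis Ta : exists2 m, (m < 4)%N & T Sh m 1.
Hypothesis Tb : exists c (y : 'rV[K]_l.+1), finite_roots c y /\ T c 1 0.

Lemma model_expand (x : F) : x = f x.1 + x.2 *: a.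
Proof.
rewrite fE; case: x => v q; rewrite /a.
by congr pair; rewrite /= ?scaler0 ?addr0 // add0r -[q *: 1]/(q * 1) mulr1.
Qed.

Lemma model_formE v q w r : I (f v + q *: a) (f w + r *: a) = dot v w.
Proof. by rewrite !fE /= /model_dot /= !scaler0 !addr0. Qed.

Lemma model_inj v q : f v + q *: a = 0 -> v = 0 /\ q = 0.
Proof.
rewrite fE => e; have := congr1 fst e; have := congr1 snd e.
by rewrite /= scaler0 addr0 add0r -[q *: 1]/(q * 1) mulr1.
Qed.

Lemma model_pointE y m n : pt y m n = f (y + eps 0 *~ m) + n%:~R *: a.
Proof. by rewrite /point linearD raddfMz scaler_int. Qed.

Lemma model_pointB y m n z m' n' : pt y m n - pt z m' n' = pt (y - z) (m - m') (n - n').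
Proof. by rewrite /point linearB !mulrzBr !opprD addrACA (addrACA (f y)). Qed.

Lemma model_span x : zspan model_roots x -> exists v m n, integral_vec v /\ x = pt v m n.
Proof.
move: x; apply: zspan_ind => [|_ _ [v [m [n [vi ->]]]] [w [m' [n' [wi ->]]]]|_ [c [y [m [n [yc _
  ->]]]]]].
- exists 0, 0, 0; split; first by split=> [|j]; rewrite mxE.
  by rewrite /point linear0 !mulr0z !addr0.
- exists (v - w), (m - m'), (n - n'); rewrite model_pointB; split=> //.
  exact: (integral_vecD vi (integral_vecN wi)).
- by exists y, m, n; have [yi _] := finite_rootsP yc.
Qed.

Lemma model_finite c y : finite_roots c y -> T c 0 0 -> model_roots (f y).
Proof. by move=> yc Tc; exists c, y, 0, 0; split=> //; rewrite /point !mulr0z !addr0. Qed.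

Lemma model_span_finite c y : finite_roots c y -> zspan model_roots (f y).
Proof.
case: c => [yS|yM|/longP[z zS ->]].
- by apply: zspan_gen; apply: (model_finite yS).
- by apply: zspan_gen; apply: (model_finite yM).
- rewrite scaler_nat raddfMn; apply: zspanMn; apply: zspan_gen; exact: (model_finite zS).
Qed.

(** alpha_0 is a root with b-coefficient 1. *)
Lemma model_span_b : zspan model_roots (f (eps 0)).
Proof.
have [c [y [yc T1]]] := Tb; have -> : f (eps 0) = pt y 1 0 - f y.
  by rewrite /point mulr1z mulr0z addr0 addrAC subrr add0r.
by apply: zspanB; [apply: zspan_gen; exists c, y, 1, 0|apply: (model_span_finite yc)].
Qed.

Lemma model_eps i : (1 <= i <= l)%N -> finite_roots Sh (eps i).
Proof. by move=> il; exists i, false; rewrite expr0 scale1r. Qed.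

Lemma model_span_a : zspan model_roots a.
Proof.
have [m m4 T1] := Ta; have e1 : finite_roots Sh (eps 1) by apply: model_eps; rewrite l0.
have -> : a = pt (eps 1) m 1 - (f (eps 1) + f (eps 0) *~ m).
  by rewrite /point mulr1z addrAC subrr add0r.
apply: zspanB; first by apply: zspan_gen; exists Sh, (eps 1), m, 1; rewrite !res_nat !modn_small.
by apply: zspanD; [apply: (model_span_finite e1)|apply: zspanMz; exact: model_span_b].
Qed.

Lemma model_frame : frame I model_roots G f a 1.
Proof.
split=> //.
- by move=> v q; apply: model_inj.
- by move=> x; exists x.1, x.2; apply: model_expand.
- by move=> v q w r; rewrite model_formE mul1r.
- apply/seteqP; split=> x.
    move=> [/model_span[v [m [n [vi ->]]]] /= /vlineP[q e]].
    have /model_inj[v0 _] : f (v + eps 0 *~ m) + (n%:~R - q) *: a = 0.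
      by rewrite scalerBl addrA -model_pointE e subrr.
    by apply/zspan1P; exists n; rewrite model_pointE v0 linear0 add0r scaler_int.
  move=> /zspan1P[n ->]; split; first exact: zspanMz model_span_a.
  by rewrite /= -scaler_int memvZ // memv_line.
- by move=> x [c [y [m [n [yc _ xE]]]]]; exists c, y, m, n.
- by move=> y yS; apply: (model_finite yS).
- by move=> y yM; apply: (model_finite yM).
- exact: model_span_b.
Qed.

Let fr := model_frame.

Lemma model_tabulates : tabulates model_roots f a T.
Proof.
move=> c y m n yc; split=> [[d [z [m' [n' [zd Tz e]]]]]|Ty]; last by exists c, y, m, n.
have [[y0 _] yn] := finite_rootsP yc; have [[z0 _] zn] := finite_rootsP zd.
have [yz mm nn] := point_inj fr y0 z0 e.
have -> : c = d; last by rewrite mm nn.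
move: yn; rewrite yz zn => /eqP; rewrite eqr_nat.
by case: (c) (d) => [] [].
Qed.

(** The table is known to be closed under adding k (m, n); modulo 4 subtracting
it is the same as adding it three times. *)
Lemma model_shift c d (k m n m' n' : nat) : (c, d, k) \in reflections l ->
  (m < 4)%N -> (n < 4)%N -> (m' < 4)%N -> (n' < 4)%N ->
  T c m n -> T d m' n' -> forall j, T d ((m' + j * k * m) %% 4)%N ((n' + j * k * n) %% 4)%N.
Proof.
move=> cdk m4 n4 m'4 n'4 Tc Td; elim=> [|j IH]; first by rewrite !mul0n !addn0 !modn_small.
have := closed_table_shift Tclosed cdk m4 n4 (@ltn_pmod _ 4 isT) (@ltn_pmod _ 4 isT) Tc IH.
have e x y : (x + j * k * y + k * y = x + j.+1 * k * y)%N.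
  by rewrite mulSn mulnDl -addnA (addnC (k * y)%N).
by rewrite !modnDml !e.
Qed.

Lemma model_reflection x y : model_roots x -> model_roots y ->
  model_roots (y - (2 * I x y / I x x) *: x).
Proof.
move=> [c [u [m [n [uc Tu ->]]]]] [d [w [m' [n' [wd Tw ->]]]]].
rewrite !(form_point fr) !mul1r -/(cartan u w).
have /intrP[k kE] := cartan_int uc wd; rewrite kE pointB -kE.
exists d, (w - cartan u w *: u), (m' - k * m), (n' - k * n); split=> //.
  exact: finite_reflection uc wd.
have [k0|[k0 k0in kk]] := cartan_reflections uc wd.
  have -> : k = 0 by apply/eqP; rewrite -(eqr_int K) -kE k0.
  by rewrite !mul0r !subr0.
have shift := model_shift k0in (res_lt m) (res_lt n) (res_lt m') (res_lt n') Tu Tw.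
have resE (j : nat) (p p' : int) : (4 %| j%:Z * k0%:Z + k)%Z ->
    res (p' - k * p) = ((res p' + j * k0 * res p) %% 4)%N.
  move=> /dvdzP[q qE]; have -> : p' - k * p = p' + (j * k0)%N%:Z * p - 4 * (q * p).
    have -> : k = q * 4 - j%:Z * k0%:Z by rewrite -qE addrAC subrr add0r.
    by rewrite PoszM; ring.
  by rewrite /res; nia.
case: kk => kk.
  have k_k : k = k0 by apply/eqP; rewrite -(eqr_int K) -kE kk.
  have d4 : (4 %| 3%:Z * k0%:Z + k)%Z by apply/dvdzP; exists k0%:Z; rewrite k_k; ring.
  by rewrite !(resE 3) //; apply: shift.
have k_k : k = - k0%:Z by apply/eqP; rewrite -(eqr_int K) -kE kk rmorphN.
have d4 : (4 %| 1%:Z * k0%:Z + k)%Z by rewrite k_k mul1r subrr dvdz0.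
by rewrite !(resE 1%N) //; apply: shift.
Qed.

Lemma model_norm x : model_roots x -> I x x != 0.
Proof.
move=> [c [y [m [n [yc _ ->]]]]]; rewrite (form_point fr) mul1r.
by have [_ ->] := finite_rootsP yc; rewrite pnatr_eq0; case: (c).
Qed.

(** Every root has a nonzero product with some eps_i, and eps_i is connected to
eps_1 by eps_1 + eps_i. *)
Lemma model_irreducible R1 R2 : model_roots = (R1 `|` R2)%classic -> (R1 `&` R2)%classic = set0 ->
  (forall x y, R1 x -> R2 y -> I x y = 0) -> R1 = set0 \/ R2 = set0.
Proof.
move=> RE dis orth.
have same x y : model_roots x -> model_roots y -> I x y != 0 -> R1 x <-> R1 y.
  move=> Rx Ry xy; move: Rx Ry; rewrite RE => -[x1|x2] [y1|y2]; split=> //.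
  - by move: xy; rewrite (orth _ _ x1 y2) eqxx.
  - by move: xy; rewrite formC (orth _ _ y1 x2) eqxx.
  - by move=> x1; move: xy; rewrite (orth _ _ x1 y2) eqxx.
  - by move=> y1; move: xy; rewrite formC (orth _ _ y1 x2) eqxx.
have l1 : (1 <= 1 <= l)%N by rewrite l0.
have shortR i : (1 <= i <= l)%N -> model_roots (f (eps i)).
  by move=> il; apply: model_finite (model_eps il) TS.
have form0 v w : I (f v) (f w) = dot v w by rewrite -(point0 f a v) -(point0 f a w) (form_point
  fr) mul1r.
have chain i : (1 <= i <= l)%N -> R1 (f (eps i)) <-> R1 (f (eps 1)).
  move=> il; have [->//|i1] := eqVneq i 1%N; have i1' : 1%N != i by rewrite eq_sym.
  have m1i : finite_roots Md (eps 1 + eps i).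
    by exists 1%N, i, false, false; rewrite expr0 !scale1r; split=> //; lia.
  apply: (@iff_trans _ (R1 (f (eps 1 + eps i)))); apply: same; rewrite ?form0.
  - exact: shortR.
  - exact: (model_finite m1i).
  - by rewrite dotDr !dot_eps // eqxx (negPf i1) add0r oner_eq0.
  - exact: (model_finite m1i).
  - exact: shortR.
  - by rewrite dotDl !dot_eps // eqxx (negPf i1) addr0 oner_eq0.
have all1 x : model_roots x -> R1 x <-> R1 (f (eps 1)).
  move=> Rx; have [c [y [m [n [yc _ xE]]]]] := Rx.
  have [|i yi] := @nonzero_coord _ _ y.
    by have [_ ->] := finite_rootsP yc; rewrite pnatr_eq0; case: (c).
  have il : (1 <= i.+1 <= l)%N by rewrite ltn_ord.
  apply: iff_trans (chain _ il); apply: same => //; first exact: shortR.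
  by rewrite xE -(point0 f a (eps i.+1)) (form_point fr) mul1r dotC dot_unit.
have [r1|r2] := EM (R1 (f (eps 1))); [right|left]; apply/seteqP; split=> // x xR.
  have R1x : R1 x by apply/all1; rewrite ?RE; [right|].
  by have : (R1 `&` R2)%classic x by []; rewrite dis.
by case: r2; apply/(all1 x) => //; rewrite RE; left.
Qed.

Definition model_basis : seq F := [:: a, f (eps 0) & [seq f (eps i) | i <- iota 1 l]].

Lemma model_basisP : basis_of fullv model_basis.
Proof.
rewrite basisEdim; apply/andP; split; last first.
rewrite dimvf /= size_map size_iota; have -> : dim F = (1 * l.+1 + 1)%N by []. by rewrite mul1n
  addn1.
apply/subvP => x _; rewrite (model_expand x) (coord_expand x.1) linearD linear_sum linearZ.
have ina : a \in <<model_basis>>%VS by apply: memv_span; rewrite inE eqxx.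
have in0 : f (eps 0) \in <<model_basis>>%VS by apply: memv_span; rewrite !inE eqxx orbT.
rewrite memvD ?memvZ // memvD ?memvZ //; apply: memv_suml => i _; rewrite linearZ /=.
apply/memvZ/memv_span; rewrite !inE; apply/orP; right; apply/orP; right.
by apply/mapP; exists i.+1 => //; rewrite mem_iota; have := ltn_ord i; lia.
Qed.

Lemma model_root_system : root_system I model_roots.
Proof.
split.
- by move=> /model_norm; rewrite form0l eqxx.
- exists model_basis; first exact: model_basisP.
  apply/seteqP; split=> x.
    move=> /model_span[v [m [n [vi ->]]]].
    have gen y : y \in model_basis -> zspan [set` model_basis]%classic y by move=> h;
      apply: zspan_gen.
    have ga : zspan [set` model_basis]%classic a by apply: gen; rewrite inE eqxx.
    have g0 : zspan [set` model_basis]%classic (f (eps 0)) by apply: gen; rewrite !inE eqxx orbT.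
    rewrite /point; apply: zspanD; last exact: zspanMz.
    apply: zspanD; last exact: zspanMz.
    have [v0 vint] := vi; rewrite (coord_expand v) v0 scale0r add0r linear_sum.
    apply: zspan_sum => i _; rewrite linearZ /=.
    have /intrP[k ->] := vint (lift ord0 i); rewrite scaler_int; apply: zspanMz; apply: gen.
    by rewrite !inE; apply/orP; right; apply/orP; right; apply/mapP; exists i.+1 => //;
      rewrite mem_iota; have := ltn_ord i; lia.
  move: x; apply: zspan_ind; [exact: zspan0|exact: zspanB|move=> x].
  rewrite /= !inE => /orP[/eqP ->|/orP[/eqP ->|/mapP[i]]];
    [exact: model_span_a|exact: model_span_b|].
  by rewrite mem_iota add1n ltnS => il ->; apply: (model_span_finite (model_eps il)).
- exact: model_norm.
- move=> x Rx; have reflE y : reflection I x y = y - (2 * I x y / I x x) *: x.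
    by rewrite /reflection /coroot formZl mulrAC.
  have Rr y : model_roots y -> model_roots (reflection I x y).
    by rewrite reflE; apply: model_reflection.
  apply/seteqP; split=> [_ [y Ry <-]|y Ry]; first exact: Rr.
  exists (reflection I x y); first exact: Rr.
  rewrite !reflE formDr formNr formZr divfK ?model_norm //.
  have -> : I x y - 2 * I x y = - I x y by ring.
  by rewrite mulrN mulNr scaleNr opprK subrK.
- move=> _ _ [c [y [m [n [yc _ ->]]]]] [d [z [m' [n' [zd _ ->]]]]].
  rewrite /coroot formZl !(form_point fr) !mul1r mulrAC; exact: cartan_int yc zd.
- exact: model_irreducible.
Qed.

Lemma model_signature : has_signature I l 2 0.
Proof.
have form0 v q w r : I (f v + q *: a) (f w + r *: a) = dot v w by rewrite (fr_form fr) mul1r.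
have formf v w : I (f v) (f w) = dot v w.
  by rewrite -[f v]addr0 -[f w]addr0 -(scale0r a) form0.
have forma x : I a x = 0.
  have ae : a = f 0 + 1 *: a by rewrite linear0 add0r scale1r.
  by rewrite (model_expand x) {1}ae form0 -(scale0r 0) dotZl mul0r.
have formb x : I (f (eps 0)) x = 0.
  by rewrite (model_expand x) -[f (eps 0)]addr0 -{1}(scale0r a) form0 dotb.
have eps1 i : i \in iota 1 l -> (1 <= i <= l)%N by rewrite mem_iota add1n ltnS.
exists model_basis; split; first exact: model_basisP.
- rewrite /model_basis /= forma eqxx /=; apply/and3P; split.
  + by apply/allP => x _; rewrite forma.
  + by apply/allP => x _; rewrite formb.
  rewrite pairwise_map; have := iota_uniq 1 l; rewrite uniq_pairwise.
  apply: (@sub_in_pairwise _ (mem (iota 1 l))) => // i j /eps1 il _ /= ij.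
  by rewrite formf dot_eps // (negPf ij).
- rewrite /= forma formb ltxx /= !add0n count_map.
  rewrite (@eq_in_count _ _ predT) ?count_predT ?size_iota // => i /eps1 il /=.
  by rewrite formf dot_eps // eqxx ltr01.
- rewrite /= forma formb eqxx /= count_map (@eq_in_count _ _ pred0) ?count_pred0 // => i /eps1 il
  /=.
  by rewrite formf dot_eps // eqxx oner_eq0.
- rewrite /= forma formb ltxx /= count_map (@eq_in_count _ _ pred0) ?count_pred0 // => i /eps1 il
  /=.
  by rewrite formf dot_eps // eqxx ltr10.
Qed.

Lemma model_marked : marked_elliptic I model_roots G.
Proof.
have an := frame_a_neq0 fr; split.
- by split; [exact: model_root_system|exists l => //; exact: model_signature].
- move=> x /vlineP[q ->] y; rewrite (model_expand y) -[q *: a]add0r -(linear0 f).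
  by rewrite model_formE -(scale0r 0) dotZl mul0r.
- by rewrite dim_vline an.
- by exists a => //; exact: fr_gen fr.
Qed.

End ModelRoots.

Theorem row_model (K : realType) t : valid_row t ->
  exists (F : vectType K) (I : {symmetric F}) (R : set F) (G : {vspace F}),
    marked_elliptic I R G /\ realizes I R G t.
Proof.
move=> tv; set l := row_rank t; have lX := row_rank_ge tv.
have l0 : (0 < l)%N by apply: leq_trans lX; case: (row_type t).
have [f fE] := hom_of_linear (@model_embed_linear K l).
have /and5P[Tcl /and3P[TS TM Tb] _ _ /and3P[/hasP[m m4 Ta] _ _]] := row_fact_valid tv.
have {}Ta : exists2 m, (m < 4)%N & row_table t Sh m 1.
  by exists m => //; move: m4; rewrite !inE; lia.
have {}Tb : exists c (y : 'rV[K]_l.+1), finite_roots c y /\ row_table t c 1 0.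
  have [y yc _] := @affine_simple_decomp K l (row_type t) 0 l0 lX (leq0n l).
  by exists (kind_len (row_type t) N0), y.
exists (model_space K l), (model_form K l), (model_roots (row_table t) f), <[((0,
  1)%R : model_space K l)]>%VS.
split; first exact: model_marked.
apply: (frame_realizes tv (model_frame fE l0 TS TM Ta Tb)); exact: model_tabulates.
Qed.

(** * Isomorphisms between frames *)
Section FrameMaps.
Variables (K : realType) (l : nat).
Variables (F1 F2 : vectType K) (I1 : {symmetric F1}) (R1 : set F1) (G1 : {vspace F1}).
Variables (f1 : 'Hom('rV[K]_l.+1, F1)) (f2 : 'Hom('rV[K]_l.+1, F2)) (a1 : F1) (a2 : F2) (k1 : K).
Hypotheses (fr1 : frame I1 R1 G1 f1 a1 k1).

Lemma frame_map : exists psi : 'Hom(F1, F2), forall v q, psi (f1 v + q *: a1) = f2 v + q *: a2.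
Proof.
have [h hP] := boolp.choice (fun x => let: ex_intro v (ex_intro q e) := fr_surj fr1 x in
  ex_intro (fun p : 'rV[K]_l.+1 * K => x = f1 p.1 + p.2 *: a1) (v, q) e).
have hE v q : h (f1 v + q *: a1) = (v, q).
  have e := hP (f1 v + q *: a1).
  have /(fr_inj fr1)[] : f1 ((h (f1 v + q *: a1)).1 - v) + ((h (f1 v + q *: a1)).2 - q) *: a1 = 0.
    by rewrite linearB scalerBl addrACA -opprD -e subrr.
  case: (h _) => v' q' /= /eqP; rewrite subr_eq0 => /eqP -> /eqP.
  by rewrite subr_eq0 => /eqP ->.
have lin : linear (fun x => f2 (h x).1 + (h x).2 *: a2).
  move=> k x y; have xE := hP x; have yE := hP y.
  have -> : h (k *: x + y) = (k *: (h x).1 + (h y).1, k * (h x).2 + (h y).2).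
    by rewrite -hE linearP /= scalerDl addrACA -scalerA -scalerDr -xE -yE.
  by rewrite /= linearP /= scalerDl addrACA -scalerA -scalerDr.
have [psi psiE] := hom_of_linear lin.
by exists psi => v q; rewrite psiE hE.
Qed.

End FrameMaps.

Lemma frames_iso (K : realType) (l : nat) (F1 F2 : vectType K)
  (I1 : {symmetric F1}) (I2 : {symmetric F2})
  (R1 : set F1) (R2 : set F2) (G1 : {vspace F1}) (G2 : {vspace F2})
  (f1 : 'Hom('rV[K]_l.+1, F1)) (f2 : 'Hom('rV[K]_l.+1, F2)) (a1 : F1) (a2 : F2) (k1 k2 : K) T :
  frame I1 R1 G1 f1 a1 k1 -> frame I2 R2 G2 f2 a2 k2 ->
  tabulates R1 f1 a1 T -> tabulates R2 f2 a2 T -> marked_iso R1 G1 R2 G2.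
Proof.
move=> fr1 fr2 T1 T2.
have [psi psiE] := frame_map f2 a2 fr1; have [chi chiE] := frame_map f1 a1 fr2.
have psipt y m n : psi (point f1 a1 y m n) = point f2 a2 y m n by rewrite !pointE psiE.
exists psi; split.
- exists chi => x.
    by have [v [q ->]] := fr_surj fr1 x; rewrite psiE chiE.
  by have [v [q ->]] := fr_surj fr2 x; rewrite chiE psiE.
- apply/seteqP; split=> [_ [x Rx <-]|x Rx].
    have [c [y [m [n [yc xE]]]]] := fr_cover fr1 Rx; rewrite -/(point f1 a1 y m n) in xE.
    by rewrite xE psipt; apply/(T2 c _ _ _ yc)/(T1 c _ _ _ yc); rewrite -xE.
  have [c [y [m [n [yc xE]]]]] := fr_cover fr2 Rx; rewrite -/(point f2 a2 y m n) in xE.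
  exists (point f1 a1 y m n); last by rewrite psipt.
  by apply/(T1 c _ _ _ yc)/(T2 c _ _ _ yc); rewrite -xE.
- rewrite (fr_marking fr1) (fr_marking fr2) limg_line.
  by have := psiE 0 1; rewrite !linear0 !add0r !scale1r => ->.
Qed.

Lemma frame_dim (K : realType) (l : nat) (F : vectType K) (I : {symmetric F}) (R : set F)
  (G : {vspace F}) (f : 'Hom('rV[K]_l.+1, F)) (a : F) (kappa : K) :
  frame I R G f a kappa -> \dim {:F} = l.+2.
Proof.
move=> fr; have f0 : lker f = 0%VS.
  apply/eqP; rewrite -subv0; apply/subvP => v; rewrite memv_ker memv0 => /eqP v0.
  by have [|-> _] := @fr_inj _ _ _ _ _ _ _ _ _ fr v 0; rewrite ?v0 ?scale0r ?addr0.
have df : \dim (limg f) = l.+1.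
  by rewrite limg_dim_eq ?f0 ?capv0 // dimvf /dim /= mul1n.
have -> : fullv = (limg f + <[a]>)%VS.
  apply/esym/vspaceP => x; rewrite memvf; have [v [q ->]] := fr_surj fr x.
  by rewrite memv_add ?memv_img ?memvf // memvZ // memv_line.
rewrite dimv_disjoint_sum ?df ?dim_vline ?(frame_a_neq0 fr) ?addn1 //.
apply/eqP; rewrite -subv0; apply/subvP => x; rewrite memv_cap memv0 => /andP[/memv_imgP[v _ ->]
  /vlineP[q e]].
have [|-> _] := @fr_inj _ _ _ _ _ _ _ _ _ fr v (- q); last by rewrite linear0.
by rewrite e scaleNr subrr.
Qed.

(** The generator a is only determined up to sign. *)
Lemma frame_opp (K : realType) (l : nat) (F : vectType K) (I : {symmetric F}) (R : set F)
  (G : {vspace F}) (f : 'Hom('rV[K]_l.+1, F)) (a : F) (kappa : K) :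
  frame I R G f a kappa -> frame I R G f (- a) kappa.
Proof.
have sN q (b : F) : q *: (- b) = (- q) *: b by rewrite scalerN scaleNr.
move=> fr; split.
- exact: fr_rank fr.
- rewrite (fr_marking fr); apply/eqP; rewrite eqEsubv -!memvE memvN memv_line andbT.
  by rewrite -[X in X \in _]opprK memvN memv_line.
- move=> v q; rewrite sN => /(fr_inj fr)[-> /eqP]; rewrite oppr_eq0 => /eqP ->.
  by [].
- by move=> x; have [v [q ->]] := fr_surj fr x; exists v, (- q); rewrite sN opprK.
- exact: fr_pos fr.
- by move=> v q w r; rewrite !sN (fr_form fr).
- rewrite /zgenerator (fr_gen fr); apply/seteqP; split=> x /zspan1P[n ->]; apply/zspan1P;
  exists (- n).
    by rewrite mulNrz mulrNz opprK.
  by rewrite mulNrz mulrNz.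
- move=> x /(fr_cover fr)[c [y [m [n [yc ->]]]]]; exists c, y, m, (- n); split=> //.
  by rewrite mulNrz mulrNz opprK.
- exact: fr_short fr.
- exact: fr_middle fr.
- exact: fr_b fr.
Qed.

Lemma tabulates_opp (K : realType) (F : vectType K) (R : set F) t
  (f : 'Hom('rV[K]_(row_rank t).+1, F)) (a : F) :
  valid_row t -> tabulates R f a (row_table t) -> tabulates R f (- a) (row_table t).
Proof.
move=> tv Tf c y m n yc; have -> : point f (- a) y m n = point f a y m (- n).
  by rewrite /point mulNrz mulrNz.
apply: (iff_trans (Tf c y m (- n) yc)).
have /and5P[_ _ _ _ /and3P[_ /allP Topp _]] := row_fact_valid tv.
have cin : c \in [:: Sh; Md; Lg] by case: (c).
have /allP/(_ (res m)) := Topp _ cin; rewrite !inE => /(_ _)/allP h.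
have /eqP -> : row_table t c (res m) (res n) == row_table t c (res m) ((4 - res n) %% 4)%N.
  have r4 k : res k \in residues by have := res_lt k; rewrite !inE; lia.
  by apply: h (r4 n); have := r4 m; rewrite !inE.
by have -> : res (- n) = ((4 - res n) %% 4)%N by rewrite /res; lia.
Qed.

(** * Invariants that separate the rows *)
Section Invariants.
Variables (K : realType) (F : vectType K) (I : {symmetric F}) (R : set F) (a : F).

(** A description of the short roots that makes no reference to a frame. *)
Definition shortest x := R x /\ forall y, R y -> I x x <= I y y.

Definition short_invariant (s : bool) (w : seq bool) := exists x,
  [/\ shortest x, `[< R (x + a) >] = s & [seq `[< R (2 *: x + a *+ j) >] | j <- residues] = w].

(** The value of I x x' tells whether the finite parts of x and x' are equal or
orthogonal. *)
Definition pair_invariant (d : len) (w : seq bool) := exists x x',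
  [/\ shortest x, shortest x', I x x' = (if d is Lg then I x x else 0)
    & [seq `[< R (x + x' + a *+ j) >] | j <- residues] = w].

Variables (G : {vspace F}) (l : nat) (T : table).
Variables (f : 'Hom('rV[K]_l.+1, F)) (kappa : K).
Hypotheses (rs : root_system I R) (fr : frame I R G f a kappa) (Tf : tabulates R f a T).
Local Notation pt := (point f a).
Local Notation eps := (unitv K l).

Let asboolE (P : Prop) (b : bool) : (P <-> b) -> `[< P >] = b.
Proof. by move=> Pb; apply/asboolP/idP => /Pb. Qed.

Let e1 : finite_roots Sh (eps 1).
Proof. by exists 1%N, false; rewrite expr0 scale1r (fr_rank fr). Qed.

(** This brings the residues of short roots to 0 and 1, where the queries look
for them. *)
Lemma table_period c (y : 'rV[K]_l.+1) (m n m' n' : int) : finite_roots c y ->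
  T c (res (m + (period c)%:Z * m')) (res (n + (period c)%:Z * n')) = T c (res m) (res n).
Proof.
move=> yc; have e p q : T c (res p) (res q) <-> fibre R f a c p q.
  by split=> [/(Tf p q yc)/(fibreP rs fr p q yc)|/(fibreP rs fr p q yc)/(Tf p q yc)].
have per := fibre_period rs fr c m n m' n'.
by apply/idP/idP => /e/per/e.
Qed.

Lemma shortestP x : shortest x <->
  exists y m n, [/\ finite_roots Sh y, T Sh (res m) (res n) & x = pt y m n].
Proof.
have norm c y m n : finite_roots c y -> I (pt y m n) (pt y m n) = kappa * (sqlen c)%:R.
  by move=> yc; rewrite (form_point fr); have [_ ->] := finite_rootsP yc.
have k0 := fr_pos fr; split=> [[Rx xmin]|[y [m [n [yS Ty ->]]]]].
  have [c [y [m [n [yc xE]]]]] := fr_cover fr Rx; rewrite -/(point f a y m n) in xE.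
  have cS : c = Sh.
    have := xmin _ (fr_short fr e1); rewrite xE (norm _ _ _ _ yc) -(point0 f a) (norm _ _ _ _ e1).
    by rewrite ler_pM2l // ler_nat; case: (c).
  by rewrite cS in yc; exists y, m, n; split=> //; apply/(Tf _ _ yc); rewrite -xE.
split; first exact/(Tf _ _ yS).
move=> z Rz; have [c [w [p [q [wc zE]]]]] := fr_cover fr Rz; rewrite -/(point f a w p q) in zE.
by rewrite zE (norm _ _ _ _ wc) (norm _ _ _ _ yS) ler_pM2l // ler_nat; case: (c).
Qed.

Let parity (m : int) : exists m0 : nat, exists2 q : int, m0 \in [:: 0; 1]%N & m = m0%:Z + 2 * q.
Proof. by exists (absz (m %% 2)%Z), (m %/ 2)%Z; rewrite ?inE; lia. Qed.

Let res01 (m : nat) : m \in [:: 0; 1]%N -> res m = m.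
Proof. by rewrite !inE => /orP[] /eqP ->. Qed.

Lemma short_queryP s w : short_query T s w <-> short_invariant s w.
Proof.
have data y (m n : int) (m0 n0 : nat) (p q : int) : finite_roots Sh y ->
    m0 \in [:: 0; 1]%N -> n0 \in [:: 0; 1]%N -> m = m0%:Z + 2 * p -> n = n0%:Z + 2 * q ->
    [/\ T Sh (res m) (res n) = T Sh m0 n0,
        `[< R (pt y m n + a) >] = T Sh m0 (n0 + 1)%N
      & [seq `[< R (2 *: pt y m n + a *+ j) >] | j <- residues] =
        [seq T Lg m0.*2 ((n0.*2 + j) %% 4)%N | j <- residues]].
  move=> yS m01 n01 mE nE; split.
  - by rewrite mE nE (table_period m0 n0 p q yS) !res01.
  - apply: asboolE; rewrite -[a]mulr1n point_add (Tf _ _ yS) mE nE addrAC.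
    rewrite (table_period m0 (n0%:Z + 1) p q yS) res01 //.
    by have -> : res (n0%:Z + 1) = (n0 + 1)%N by move: n01; rewrite !inE => /orP[] /eqP ->.
  - apply: eq_map => j; apply: asboolE.
    have y2 : finite_roots Lg (2 *: y) by apply/longP; exists y.
    have -> : 2 *: pt y m n + a *+ j = pt (2 *: y) (2 * m) (2 * n + j%:Z).
      rewrite -point_add; congr (_ + _); rewrite /point !scalerDr linearZ -!scaler_int !scalerA.
      by rewrite -!(intrM _ 2).
    rewrite (Tf _ _ y2) (_ : res (2 * m) = m0.*2); last first.
      by rewrite mE; move: m01; rewrite !inE /res => /orP[] /eqP ->; lia.
    by rewrite (_ : res _ = ((n0.*2 + j) %% 4)%N) // nE /res; lia.
split.
  move=> /hasP[m m01 /hasP[n n01 /and3P[Tmn /eqP sE /eqP wE]]].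
  have [h1 h2 h3] := data (eps 1) m n m n 0 0 e1 m01 n01 (esym (addr0 _)) (esym (addr0 _)).
  exists (pt (eps 1) m n); rewrite h2 h3; split=> //.
  by apply/shortestP; exists (eps 1), m, n; rewrite h1.
move=> [x [/shortestP[y [m [n [yS Tx ->]]]] sE wE]].
have [m0 [p m01 mE]] := parity m; have [n0 [q n01 nE]] := parity n.
have [h1 h2 h3] := data y m n m0 n0 p q yS m01 n01 mE nE.
apply/hasP; exists m0 => //; apply/hasP; exists n0 => //.
by rewrite -h1 Tx -h2 sE -h3 wE !eqxx.
Qed.

Lemma pair_queryP d w : d != Sh -> relevant l d -> pair_query T d w <-> pair_invariant d w.
Proof.
move=> dS rd.
have data y y' (m n m' n' : int) : finite_roots d (y + y') ->
    [seq `[< R (pt y m n + pt y' m' n' + a *+ j) >] | j <- residues] =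
    [seq T d (res (m + m')) (res (n + n' + j%:Z)) | j <- residues].
  move=> yd; apply: eq_map => j; apply: asboolE.
  have -> : pt y m n + pt y' m' n' + a *+ j = pt (y + y') (m + m') (n + n' + j%:Z).
    rewrite -point_add; congr (_ + _).
    by rewrite /point linearD !mulrzDr /= addrACA (addrACA (f y)).
  by rewrite (Tf _ _ yd).
split.
  move=> /hasP[m m01 /hasP[n n01 /andP[Tmn /hasP[m' m'4 /hasP[n' n'4 /andP[Tmn' /eqP wE]]]]]].
  have [y' [yS yd ydot]] : exists y', [/\ finite_roots Sh y', finite_roots d (eps 1 + y')
      & dot (eps 1) y' = (if d is Lg then 1 else 0)].
    case: (d) dS rd => // _ rd.
      exists (eps 2); have e2 : finite_roots Sh (eps 2).
        by exists 2%N, false; rewrite expr0 scale1r; split=> //; exact: rd.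
      have d12 : dot (eps 1) (eps 2) = 0 by rewrite dot_eps ?(fr_rank fr).
      by split=> //; apply: middleD.
    exists (eps 1); split=> //; last by rewrite dot_eps ?(fr_rank fr).
    by apply/longP; exists (eps 1) => //; rewrite scaler_nat mulr2n.
  have r4 (k : nat) : k \in residues -> res k = k.
    by rewrite res_nat !inE => k4; rewrite modn_small //; lia.
  have r01 (k : nat) : k \in [:: 0; 1]%N -> k \in residues by rewrite !inE; lia.
  exists (pt (eps 1) m n), (pt y' m' n'); split.
  - by apply/shortestP; exists (eps 1), m, n; rewrite !r4 ?r01.
  - by apply/shortestP; exists y', m', n'; rewrite !r4.
  - rewrite !(form_point fr) ydot dot_eps ?(fr_rank fr) //.
    by case: (d) => //; rewrite mulr0.
  - rewrite data // -wE; apply: eq_map => j; rewrite -!PoszD !res_nat //.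
move=> [x [x' [/shortestP[y [m [n [yS Tx ->]]]] /shortestP[y' [m' [n' [y'S Tx' ->]]]] xx]]].
have [yi y1] := finite_rootsP yS.
have yd : finite_roots d (y + y').
  have k0 := lt0r_neq0 (fr_pos fr); move: xx; rewrite !(form_point fr).
  case: (d) dS => // _ /eqP.
    by rewrite mulf_eq0 (negPf k0) => /eqP; apply: middleD.
  move=> /eqP/(mulfI k0); rewrite y1 /= => yy.
  have [->|e|e] := short_trichotomy yS y'S.
  - by apply/longP; exists y => //; rewrite scaler_nat mulr2n.
  - by exfalso; move: yy; rewrite e dotNr y1 /=; lra.
  - by exfalso; lra.
rewrite data // => wE.
have [m0 [p m01 mE]] := parity m; have [n0 [q n01 nE]] := parity n.
have resin k : res k \in residues by have := res_lt k; rewrite !inE; lia.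
apply/hasP; exists m0 => //; apply/hasP; exists n0 => //; apply/andP; split.
  by move: Tx; rewrite mE nE (table_period m0 n0 p q yS) !res01.
apply/hasP; exists (res (m' + 2 * p)); rewrite ?resin //.
apply/hasP; exists (res (n' + 2 * q)); rewrite ?resin //.
rewrite (table_period m' n' p q y'S) Tx' -wE; apply/eqP/eq_map => j; rewrite mE nE.
have -> : m0%:Z + 2 * p + m' = m0%:Z + (m' + 2 * p) by ring.
have -> : n0%:Z + 2 * q + n' + j%:Z = n0%:Z + (n' + 2 * q) + j%:Z by ring.
congr (T d _ _); first by rewrite (resD m0) (res01 m01).
by rewrite (resD _ j%:Z) (resD n0) (res01 n01) res_nat modnDml modnDmr.
Qed.

End Invariants.

(** * The classification *)
Definition type_eqb X Y :=
  match X, Y with BCC, BCC | CvBC, CvBC | BBv, BBv | CvC, CvC => true | _, _ => false end.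
Lemma type_eqP : Equality.axiom type_eqb.
Proof. by case=> -[]; constructor. Qed.
HB.instance Definition _ := hasDecEq.Build affine_type type_eqP.

Definition rank_rows (l : nat) : seq (affine_type * nat) :=
  [seq (X, j.+1) | X <- [seq X <- [:: BCC; CvBC; BBv; CvC] | (min_rank X <= l)%N],
                   j <- iota 0 (size (rows X l))].

Lemma rank_rowsP X l j : valid_row (RowLabel X l j) -> (X, j) \in rank_rows l.
Proof.
case/andP=> /= lX /andP[j0 jn]; apply/allpairsPdep; exists X, j.-1; rewrite prednK //; split=> //.
  by rewrite mem_filter lX; case: (X).
by rewrite mem_iota add0n; move: jn; case: (j) j0.
Qed.

Definition row_signature l (p : affine_type * nat) :=
  signature l (row_table (RowLabel p.1 l p.2)).

Lemma row_signatures_uniq_small : all (fun l => uniq [seq row_signature l p | p <- rank_rows l])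
  [:: 1; 2; 3]%N.
Proof. by vm_compute. Qed.

Lemma uniq_map_inj (A B : eqType) (g : A -> B) (s : seq A) :
  uniq [seq g x | x <- s] -> {in s &, injective g}.
Proof.
elim: s => //= z s IH /andP[zs us] x y; rewrite !inE => /orP[/eqP ->|xs] /orP[/eqP ->|ys] // e.
- by move: zs; rewrite e map_f.
- by move: zs; rewrite -e map_f.
- exact: IH us _ _ xs ys e.
Qed.

(** A computation in ranks 1, 2, 3; tables and queries of higher rank are those
of rank 3. *)
Lemma row_signature_inj X X' l j j' :
  valid_row (RowLabel X l j) -> valid_row (RowLabel X' l j') ->
  signature l (row_table (RowLabel X l j)) = signature l (row_table (RowLabel X' l j')) ->
  X = X' /\ j = j'.
Proof.
move=> v v'.
have small m k k' : m \in [:: 1; 2; 3]%N -> valid_row (RowLabel X m k) ->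
  valid_row (RowLabel X' m k') ->
   signature m (row_table (RowLabel X m k)) = signature m (row_table (RowLabel X' m k')) ->
     X = X' /\ k = k'.
  move=> min vk vk' e.
  have := uniq_map_inj (allP row_signatures_uniq_small m min) (rank_rowsP vk) (rank_rowsP vk') e.
  by case.
have l0 : (0 < l)%N by move: v => /andP[]; case: (X) => /=; lia.
have [l3|l3] := leqP l 3; first by apply: small => //; rewrite !inE; lia.
case: l l3 l0 v v' => [//|[//|[//|n]]] _ _ v v'; rewrite !row_table_large => e.
have valid3 Y i : valid_row (RowLabel Y n.+3 i) -> valid_row (RowLabel Y 3 i).
  by rewrite /valid_row /= size_rows_large => /andP[_ ->]; case: (Y).
exact: (small 3%N _ _ _ (valid3 _ _ v) (valid3 _ _ v')).
Qed.

Lemma frame_signature (K : realType) (l : nat) (F : vectType K) (I : {symmetric F}) (R : set F)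
  (G : {vspace F}) (f f' : 'Hom('rV[K]_l.+1, F)) (a : F) (kappa kappa' : K) T T' :
  root_system I R -> frame I R G f a kappa -> tabulates R f a T ->
  frame I R G f' a kappa' -> tabulates R f' a T' -> signature l T = signature l T'.
Proof.
move=> rs fr Tf fr' Tf'; have iffE (b c : bool) : (b <-> c) -> b = c by move=> h;
  apply/idP/idP => /h.
rewrite /signature; congr (_ ++ _); last congr (_ ++ _).
- by apply: eq_allpairs => s w; apply: iffE; apply: iff_trans (short_queryP rs fr Tf s w)
  (iff_sym (short_queryP rs fr' Tf' s w)).
- apply: eq_map => w; apply: iffE; have d : Lg != Sh by [].
  by apply: iff_trans (pair_queryP rs fr Tf w d isT) (iff_sym (pair_queryP rs fr' Tf' w d isT)).
case: ifP => // l2; apply: eq_map => w; apply: iffE; have d : Md != Sh by [].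
by apply: iff_trans (pair_queryP rs fr Tf w d l2) (iff_sym (pair_queryP rs fr' Tf' w d l2)).
Qed.

Section Main.
Variables (K : realType) (F : vectType K) (I : {symmetric F}) (R : set F) (G : {vspace F}).
Hypothesis me : marked_elliptic I R G.
Let rs : root_system I R. Proof. by case: me => -[]. Qed.

Lemma row_exists : ~ reduced (quo_roots R G) -> exists t, valid_row t /\ realizes I R G t.
Proof.
move=> /(frame_exists me)[l [f [a [kappa [fr L0 good0]]]]].
have [X [f' [fr' ad]]] := adapt rs fr L0 good0.
have [j [g [tv frg Tg]]] := adapted_row rs fr' ad.
by exists (RowLabel X l j); split=> //; apply: (frame_realizes tv frg).
Qed.

(** Both rows give frames of the same (R, G). Their ranks agree by dimension,
their markings up to sign, and the invariants of the common system are the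
signatures of both tables. *)
Lemma realizes_inj t t' : valid_row t -> realizes I R G t -> valid_row t' -> realizes I R G t' ->
  t = t'.
Proof.
move=> tv /(realizes_frame me tv)[f [a [k [fr Tf]]]] tv' /(realizes_frame me tv')[f' [a' [k' [fr'
  Tf']]]].
have e := frame_dim fr; rewrite (frame_dim fr') in e; case: e => e.
have [f2 [k2 [fr2 Tf2]]] : exists (f2 : 'Hom('rV[K]_(row_rank t').+1, F)) k2,
    frame I R G f2 a k2 /\ tabulates R f2 a (row_table t').
  have /zspan1P[n aE] : zspan [set a']%classic a.
    by rewrite -(fr_gen fr') (fr_gen fr); apply: zspan_gen.
  have /zspan1P[m a'E] : zspan [set a]%classic a'.
    by rewrite -(fr_gen fr) (fr_gen fr'); apply: zspan_gen.
  have nm : n * m = 1.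
    have /eqP : ((n * m)%:~R - 1) *: a' = 0.
      by rewrite scalerBl scale1r scaler_int mulrzA -aE -a'E subrr.
    rewrite scaler_eq0 (negPf (frame_a_neq0 fr')) orbF subr_eq0 => /eqP h.
    by apply/eqP; rewrite -(eqr_int K) h.
  have n1 : n = 1 \/ n = -1.
    have : (n %| 1)%Z by apply/dvdzP; exists m; rewrite mulrC nm.
    by rewrite dvdz1 => /eqP; clear; lia.
  case: n1 => n1.
    by exists f', k'; rewrite aE n1 mulr1z.
  exists f', k'; rewrite aE n1 mulrN1z; split; first exact: frame_opp.
  exact: tabulates_opp.
case: t t' e tv tv' f fr Tf f2 fr2 Tf2 {f' fr' Tf'} => [X l j] [X' l' j'] /= e tv tv'.
move: e tv' => -> {l'} tv' f fr Tf f2 fr2 Tf2.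
have [-> ->] := row_signature_inj tv tv' (frame_signature rs fr Tf fr2 Tf2).
by [].
Qed.

End Main.

Theorem theorem8p15 (K : realType) :
  (forall (F : vectType K) (I : {symmetric F}) (R : set F) (G : {vspace F}),
     marked_elliptic I R G -> ~ reduced (quo_roots R G) ->
     exists! t : row_label, valid_row t /\ realizes I R G t) /\
  (forall t : row_label, valid_row t ->
     (exists (F : vectType K) (I : {symmetric F}) (R : set F) (G : {vspace F}),
        marked_elliptic I R G /\ realizes I R G t) /\
     (forall (F1 F2 : vectType K) (I1 : {symmetric F1}) (I2 : {symmetric F2})
        (R1 : set F1) (R2 : set F2) (G1 : {vspace F1}) (G2 : {vspace F2}),
        marked_elliptic I1 R1 G1 -> realizes I1 R1 G1 t ->
        marked_elliptic I2 R2 G2 -> realizes I2 R2 G2 t ->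
        marked_iso R1 G1 R2 G2)).
Proof.
split=> [F I R G me nr|t tv].
  have [t [tv rt]] := row_exists me nr; exists t; split=> // t' [tv' rt'].
  exact: realizes_inj me _ _ tv rt tv' rt'.
split; first exact: row_model.
move=> F1 F2 I1 I2 R1 R2 G1 G2 me1 /(realizes_frame me1 tv)[f1 [a1 [k1 [fr1 T1]]]].
move=> me2 /(realizes_frame me2 tv)[f2 [a2 [k2 [fr2 T2]]]].
exact: frames_iso fr1 fr2 T1 T2.
Qed.
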